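(* Let $k\ge1$, and let $C$ be the character table of the propagating partition monoid $PP_k$ (bordered by a row and column for the empty partition), $Y$ the block diagonal matrix whose diagonal blocks are the character tables of the symmetric groups $S_i$ for $0\le i\le k$, and let $L$ and $R$ be the unique upper unitriangular matrices with $C=LY$ and $C=YR$. Then for all partitions $\lambda,\mu$ of size at most $k$, $$L_{\lambda,\mu}=\langle s_\lambda[\Omega-1],\,s_\mu\rangle\qquad\text{and}\qquad R_{\lambda,\mu}=\frac1{z_\lambda}\langle p_\lambda[\Omega-1],\,p_\mu\rangle .$$
   Context: $\Lambda=\mathbb Q[p_1,p_2,\ldots]$ is the ring of symmetric functions, with Schur functions $s_\lambda$, complete functions $h_n$, and Hall scalar product $\langle s_\lambda,s_\mu\rangle=\delta_{\lambda\mu}$, extended to pairings of $\Lambda$ with its graded completion. For $\lambda=(1^{m_1}2^{m_2}\cdots)$, $z_\lambda=\prod_i m_i!\,i^{m_i}$. $\Omega=1+\sum_{n\ge1}h_n$ in the completion. Plethysm: $p_k[f]$ is $f$ with each $p_r$ replaced by $p_{kr}$ (constants fixed), and $g[f]$ is obtained from the power sum expansion of $g$ by replacing each $p_k$ by $p_k[f]$. Propagating partition monoid: $PP_k$ is the set of set partitions $\pi$ of $\{1,\ldots,k\}\cup\{\overline1,\ldots,\overline k\}$ such that every block contains at least one unbarred and at least one barred element. $\pi$ acts on $(\mathbb C^n)^{\otimes k}$ by: on $e_{i_1}\otimes\cdots\otimes e_{i_k}$, assign $e_{i_j}$ to $\overline j$; if two barred elements in the same block are assigned distinct vectors the result is $0$;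 otherwise the result is $e_{i'_1}\otimes\cdots\otimes e_{i'_k}$, where $e_{i'_j}$ is the common vector assigned to the barred elements in the block of $j$. The product in $PP_k$ is composition of these maps (for $n\ge k$). Rook monoid: $R_n$ is the monoid of $n\times n$ $0$-$1$ matrices with at most one $1$ in each row and column (partial injective maps of $[n]$). For $\lambda\vdash m\le n$, its irreducible representation indexed by $\lambda$ is $W^\lambda_{R_n}=\mathbb C\{\text{injective maps }[m]\to[n]\}\otimes_{\mathbb CS_m}W^\lambda_{S_m}$ ($W^\lambda_{S_m}$ the irreducible $S_m$-module), with $\sigma\in R_n$ sending $f$ to $\sigma\circ f$ if the image of $f$ lies in the domain of $\sigma$ and to $0$ otherwise. $R_n$ acts diagonally on $(\mathbb C^n)^{\otimes k}$, and for $n\ge k$ the actions of $R_n$ and $PP_k$ generate each other's centralizers. Irreducibles of $PP_k$: for $k\ge1$ they are indexed by partitions $\lambda$ with $1\le|\lambda|\le k$, where $W^\lambda_{PP_k}$ is the multiplicity space of $W^\lambda_{R_n}$ in $(\mathbb C^n)^{\otimes k}$ for $n\ge k$, i.e. $(\mathbb C^n)^{\otimes k}\cong\bigoplus_{\lambda}W^\lambda_{R_n}\otimes W^\lambda_{PP_k}$ as $R_n\times PP_k$-modules. $\chi^\lambda_{PP_k}$ is the character of $W^\lambda_{PP_k}$. Class representatives: for $\sigma\in S_i$, $1\le i\le k$, let $\sigma[k]\in PP_k$ be obtained from $\{\{\sigma(1),\overline1\},\ldots,\{\sigma(i),\overline i\}\}$ by adding $i+1,\ldots,k$ to the block containing $i$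 and $\overline{i+1},\ldots,\overline k$ to the block containing $\overline i$. For $\mu\vdash i$, let $\sigma_\mu\in S_i$ be the permutation of cycle type $\mu$ which is the product of the cycles $(1,2,\ldots,\mu_1)$, $(\mu_1+1,\ldots,\mu_1+\mu_2)$, etc. (parts equal to $1$ giving fixed points), and $d_\mu=\sigma_\mu[k]$. Then $\chi^\lambda_{PP_k}(\mu)$ denotes $\chi^\lambda_{PP_k}(d_\mu)$. Matrices: $C,Y,L,R$ have rows and columns indexed by all partitions of size $0,1,\ldots,k$, in the order $\emptyset,(1),(2),(1,1),(3),(2,1),\ldots,(1^k)$ (by size, and within a size from $(i)$ down to $(1^i)$ in lexicographic order). $C_{\lambda,\mu}=\chi^\lambda_{PP_k}(\mu)$ for non-empty $\lambda,\mu$, with the convention $C_{\emptyset,\emptyset}=1$ and $C_{\emptyset,\mu}=C_{\lambda,\emptyset}=0$ for $\lambda,\mu\ne\emptyset$. $Y_{\lambda,\mu}=\chi^\lambda_{S_i}(\mu)$ if $|\lambda|=|\mu|=i$, and $0$ if $|\lambda|\ne|\mu|$. *)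

(* Defs.v *)
From HB Require Import structures.
From mathcomp Require Import all_boot all_order all_fingroup all_algebra.
From mathcomp Require Import finmap.
From mathcomp Require Import monalg.

Set Implicit Arguments.
Unset Strict Implicit.
Unset Printing Implicit Defensive.

Import Order.TTheory GRing.Theory Num.Theory.
Local Open Scope ring_scope.

Definition is_part (la : seq nat) : bool := sorted geq la && (0%N \notin la).

(* Partitions of [n] with all parts at most [m]; [c] is the multiplicity of the
   part [m], and taking [c] in decreasing order lists the partitions from the
   lexicographically largest to the smallest. *)
Fixpoint parts_le (m n : nat) : seq (seq nat) :=
  if m is m'.+1 then
    flatten [seq [seq nseq c m ++ mu | mu <- parts_le m' (n - c * m)]
            | c <- rev (iota 0 (n %/ m).+1)]
  else if n == 0%N then [:: [::]] else [::].

Definition parts_of (n : nat) : seq (seq nat) := parts_le n n.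

Definition parts_upto (k : nat) : seq (seq nat) :=
  flatten [seq parts_of n | n <- iota 0 k.+1].

Definition nparts (k : nat) : nat := size (parts_upto k).

Definition part (k : nat) (i : 'I_(nparts k)) : seq nat :=
  nth [::] (parts_upto k) i.

Definition zee (la : seq nat) : nat :=
  (\prod_(i <- undup la) ((count_mem i la)`! * i ^ count_mem i la))%N.

Lemma parts_leP (m n : nat) (la : seq nat) :
  reflect [/\ is_part la, sumn la = n & all (fun r => r <= m)%N la]
          (la \in parts_le m n).
Proof.
elim: m n la => [|m IH] n la.
  apply: (iffP idP) => [|[/andP[_ n0] <- le0]] /=.
    by case: eqP => //= ->; rewrite inE => /eqP ->; split.
  case: la n0 le0 => [|r la] //=; rewrite inE negb_or leqn0.
  by case/andP=> r0 _ /andP[/eqP r0' _]; rewrite r0' in r0.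
apply: (iffP flatten_mapP) => [[c]|[/andP[so n0] su le]].
  rewrite mem_rev mem_iota add0n ltnS => /andP[_ lec].
  case/mapP=> mu /IH[/andP[so n0] su le] ->.
  have lecn : (c * m.+1 <= n)%N.
    by rewrite (leq_trans _ (leq_divM n m.+1)) // leq_mul2r lec orbT.
  split.
  - rewrite /is_part mem_cat negb_or n0 andbT mem_nseq andbF andbT.
    elim: c {su lec lecn} => //= c IHc.
    rewrite (path_sortedE (rev_trans leq_trans)) IHc andbT all_cat all_nseq leqnn orbT /=.
    by apply: sub_all le => r /leqW.
  - by rewrite sumn_cat sumn_nseq su mulnC subnKC // mulnC.
  - rewrite all_cat all_nseq leqnn orbT /=.
    by apply: sub_all le => r /leqW.
exists (count_mem m.+1 la).
  rewrite mem_rev mem_iota add0n ltnS leq0n /= leq_divRL // -su.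
  elim: la {so n0 su le} => //= r la IHla.
  by rewrite mulnDl leq_add //; case: eqP => [->|]; rewrite ?mul1n ?mul0n.
apply/mapP; exists [seq r <- la | r != m.+1].
  have perm := perm_filterC (pred1 m.+1) la.
  apply/IH; split.
  - rewrite /is_part sorted_filter //; last exact: (rev_trans leq_trans).
    by rewrite mem_filter (negbTE n0) andbF.
  - rewrite -su; elim: (la) => //= r l IHl.
    case: eqP => [->|_] /=; first by rewrite IHl mulnDl mul1n subnDl.
    rewrite IHl add0n addnBA //.
    elim: (l) => //= a l' IHl'; rewrite mulnDl leq_add //.
    by case: eqP => [->|]; rewrite ?mul1n ?mul0n.
  - apply/allP=> r; rewrite mem_filter => /andP[ne rla].
    by have := allP le r rla; rewrite leq_eqVlt (negbTE ne).
elim: la so le {n0 su} => //= r la IHla so /andP[ler le].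
case: eqP => [->|ne] /=; first by rewrite -IHla // (path_sorted so).
have nin : m.+1 \notin la.
  apply/negP=> /(allP (order_path_min (rev_trans leq_trans) so)) /= ge.
  by case: ne; apply/eqP; rewrite eqn_leq ler.
rewrite (count_memPn nin) /=; congr (_ :: _).
rewrite -[LHS](filter_predT); apply: eq_in_filter => a ain /=.
by apply/esym/eqP=> ea; rewrite -ea ain in nin.
Qed.

Lemma mem_parts_upto (k : nat) (la : seq nat) :
  (la \in parts_upto k) = is_part la && (sumn la <= k)%N.
Proof.
apply/flatten_mapP/andP => [[n]|[pa le]].
  by rewrite mem_iota add0n ltnS => /andP[_ le] /parts_leP[pa -> _].
exists (sumn la); first by rewrite mem_iota add0n ltnS le.
apply/parts_leP; split=> //; apply/allP=> r.
elim: (la) => //= a l IHl; rewrite inE => /orP[/eqP ->|/IHl H]; first exact: leq_addr.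
exact: leq_trans H (leq_addl _ _).
Qed.

(* The variable of index [i] stands for the power sum p_(i+1). *)
Notation Lambda := {malg rat[{cmonom nat}]}.

Definition psum1 (r : nat) : Lambda := << 1 *g ucm r.-1 >>.

Definition psum (la : seq nat) : Lambda := \prod_(r <- la) psum1 r.

Definition hsym (n : nat) : Lambda :=
  \sum_(la <- parts_of n) (zee la)%:R^-1 *: psum la.

(* Jacobi-Trudi: det (h_(la_i - i + j)), with h_r = 0 for r < 0. *)
Definition schur (la : seq nat) : Lambda :=
  \det (\matrix_(i < size la, j < size la)
     if (i <= nth 0%N la i + j)%N then hsym (nth 0%N la i + j - i) else 0).

Definition hall_product (hall : Lambda -> Lambda -> rat) : Prop :=
  [/\ forall f, scalar (hall f),
      forall g, scalar (hall^~ g)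
    & forall la mu, is_part la -> is_part mu ->
        hall (schur la) (schur mu) = (la == mu)%:R].

(* Image of [f] under p_r |-> [x r], with scalars embedded by [c]. *)
Definition psubst (A : comNzRingType) (c : rat -> A) (x : nat -> A)
    (f : Lambda) : A :=
  mmap c (fun m : {cmonom nat} => \prod_(i <- finsupp m) x i.+1 ^+ m i) f.

(* p_r[f]; the constants of [f] are fixed. *)
Definition adams (r : nat) (f : Lambda) : Lambda :=
  psubst (fun c => c%:MP) (fun j => psum1 (r * j)%N) f.

(* An element of the graded completion of Lambda is the sequence of its homogeneous
   components: [F d] has degree [d], where p_r has degree r. *)
Definition cLambda := nat -> Lambda.

Definition Omega : cLambda := hsym.

Definition Omega_minus_1 : cLambda := fun d => Omega d - (d == 0%N)%:R.

Definition cpsum_pleth (r : nat) (F : cLambda) : cLambda :=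
  fun d => if (r %| d)%N then adams r (F (d %/ r)%N) else 0.

(* Degrees are recorded by an auxiliary polynomial variable: the component
   of degree d of g[F] only involves the components of degree <= d of the
   p_r[F]. *)
Definition pleth (g : Lambda) (F : cLambda) : cLambda := fun d =>
  (psubst (fun c => (c%:MP)%:P)
     (fun r => \poly_(e < d.+1) cpsum_pleth r F e) g)`_d.

Definition wdeg (m : {cmonom nat}) : nat :=
  (\sum_(i <- finsupp m) i.+1 * m i)%N.

Definition sdeg (g : Lambda) : nat := (\max_(m <- msupp g) wdeg m)%N.

(* Components of different degrees are orthogonal, so that only the components
   of F of degree at most the degree of g matter. *)
Definition cpairing (hall : Lambda -> Lambda -> rat) (F : cLambda) (g : Lambda) :
  rat := \sum_(d < (sdeg g).+1) hall (F d) g.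

Section LinearAlgebra.
Variable F : fieldType.

(* Trace on [U] of an endomorphism [g] that maps [U] to itself. *)
Definition trace_on (T : vectType F) (U : {vspace T}) (g : T -> T) : F :=
  \sum_(i < \dim U) coord (vbasis U) i (g (vbasis U)`_i).

(* {ffun X -> W} is the direct sum of copies of W indexed by X; [ten x w] is the
   element w of the copy of index x. *)
Definition ten (X : finType) (W : vectType F) (x : X) (w : W) : {ffun X -> W} :=
  [ffun y => if y == x then w else 0].

(* The linear map [ten x w |-> ten (g x) w], which is 0 where g is undefined. *)
Definition linz (X Y : finType) (W : vectType F) (g : X -> option Y) :
    'Hom({ffun X -> W}, {ffun Y -> W}) :=
  linfun (fun v : {ffun X -> W} => [ffun y => \sum_(x | g x == Some y) v x]).

(* The quotient T / U, modelled on a complement of U. *)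
Definition quo (T : vectType F) (U : {vspace T}) : vectType F :=
  subvs_of (U^C)%VS.

Definition quo_pi (T : vectType F) (U : {vspace T}) (t : T) : quo U :=
  vsproj (U^C)%VS (daddv_pi (U^C)%VS U t).

Definition quo_map (T : vectType F) (U : {vspace T}) (g : 'End(T)) :
    'End(quo U) :=
  linfun (fun x : quo U => quo_pi U (g (vsval x))).

End LinearAlgebra.

Section Specht.
Variables (F : fieldType) (m : nat) (la : seq nat).

(* The tableau of shape [la] (with m = |la|) filled with 0, 1, ..., m-1 row by
   row: [a] lies in row [reshape_index la a], column [reshape_offset la a]. *)
Definition row_stab (s : 'S_m) : bool :=
  [forall a, reshape_index la (s a) == reshape_index la a].

Definition col_stab (s : 'S_m) : bool :=
  [forall a, reshape_offset la (s a) == reshape_offset la a].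

Notation group_algebra := {ffun 'S_m -> F^o}.

(* In MathComp [s * t] is the permutation "s, then t"; hence left
   multiplication by [t] sends the basis element [s] to [s * t]. *)
Definition lmulp (t : 'S_m) : 'End(group_algebra) :=
  linz F^o (fun s : 'S_m => Some (s * t)%g).

Definition young_symmetrizer : group_algebra :=
  \sum_(p : 'S_m | row_stab p) \sum_(q : 'S_m | col_stab q)
     (-1) ^+ q *: ten (q * p)%g (1 : F^o).

(* The left ideal of the group algebra generated by the Young symmetrizer. *)
Definition specht : {vspace group_algebra} :=
  <<[seq lmulp t young_symmetrizer | t : 'S_m]>>%VS.

Definition WS : vectType F := subvs_of specht.

Definition WS_act (t : 'S_m) : 'End(WS) :=
  linfun (fun w : WS => vsproj specht (lmulp t (vsval w))).

Definition chiS (t : 'S_m) : F := trace_on fullv (WS_act t).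

End Specht.

(* A rook matrix is encoded as the partial injective map i |-> row of the 1 in
   column i, if any. *)
Definition rookb (n : nat) (s : {ffun 'I_n -> option 'I_n}) : bool :=
  [forall i, forall j, (s i != None) && (s i == s j) ==> (i == j)].

Definition rook (n : nat) : finType :=
  {s : {ffun 'I_n -> option 'I_n} | rookb s}.

Definition rook_comp (n : nat) (s : rook n) (X : finType) (f : {ffun X -> 'I_n}) :
    option {ffun X -> 'I_n} :=
  if [forall x, val s (f x) != None]
  then Some [ffun x => odflt (f x) (val s (f x))] else None.

Definition inj_map (m n : nat) : finType :=
  {f : {ffun 'I_m -> 'I_n} | injectiveb f}.

Lemma inj_map_comp_subproof (m n : nat) (f : inj_map m n) (t : 'S_m) :
  injectiveb [ffun a => val f (t a)].
Proof.
apply/injectiveP => a b; rewrite !ffunE => e.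
exact: perm_inj (injectiveP _ (valP f) _ _ e).
Qed.

Definition inj_map_comp (m n : nat) (f : inj_map m n) (t : 'S_m) : inj_map m n :=
  Sub [ffun a => val f (t a)] (inj_map_comp_subproof f t).

(* C{injective maps [m] -> [n]} (x)_{C S_m} W, for m = |la|: the quotient of
   C{injective maps} (x) W by the relations (f o t) (x) w = f (x) (t w). *)
Section RookModule.
Variables (F : fieldType) (n : nat) (la : seq nat).
Notation m := (sumn la).
Notation W := (WS F m la).

Definition balance_rel : {vspace {ffun inj_map m n -> W}} :=
  (\sum_(f : inj_map m n) \sum_(t : 'S_m)
     <<[seq (ten (inj_map_comp f t) w - ten f (WS_act F la t w) : {ffun inj_map m n -> W})
       | w <- vbasis {:W}]>>)%VS.

Definition WR : vectType F := quo balance_rel.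

Definition WR_act (s : rook n) : 'End(WR) :=
  quo_map balance_rel
    (linz W (fun f : inj_map m n => obind insub (rook_comp s (val f)))).

End RookModule.

(* [inl j] is the unbarred element j, [inr j] the barred one. *)
Definition diagram (k : nat) : finType := {set {set 'I_k + 'I_k}}.

Definition propagating (k : nat) (P : diagram k) : bool :=
  partition P [set: 'I_k + 'I_k] &&
  [forall (B | B \in P), [exists j, inl j \in B] && [exists j, inr j \in B]].

Definition PP (k : nat) : finType := {P : diagram k | propagating P}.

(* The default value [j] in [odflt] is never used, since the block of [inl j]
   contains a barred element. *)
Definition PP_map (n k : nat) (d : PP k) (i : {ffun 'I_k -> 'I_n}) :
    option {ffun 'I_k -> 'I_n} :=
  if [forall (B | B \in val d), forall j, forall j',
       (inr j \in B) && (inr j' \in B) ==> (i j == i j')]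
  then Some [ffun j => i (odflt j [pick j' | inr j' \in pblock (val d) (inl j)])]
  else None.

(* sigma[k], for sigma in S_i and 1 <= i <= k. With indices starting at 0, the
   elements i, ..., k-1 are put together with i-1, both barred and unbarred. *)
Definition extend_diagram (k i : nat) (s : 'S_i) : diagram k :=
  [set [set x : 'I_k + 'I_k |
         match x with
         | inl u => minn u i.-1 == s a :> nat
         | inr b => minn b i.-1 == a :> nat
         end] | a : 'I_i].

Lemma extend_diagramP (k i : nat) (s : 'S_i) :
  (0 < i <= k)%N -> propagating (extend_diagram k s).
Proof.
case/andP=> i0 ik.
have cap (u : nat) : (minn u i.-1 < i)%N by rewrite gtn_min prednK // leqnn orbT.
have wid (a : 'I_i) : minn a i.-1 = a by apply/minn_idPl; rewrite -ltnS prednK.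
apply/andP; split; last first.
  apply/forall_inP => B /imsetP[a _ ->]; apply/andP; split; apply/existsP.
    by exists (widen_ord ik (s a)); rewrite inE /= wid.
  by exists (widen_ord ik a); rewrite inE /= wid.
apply/and3P; split.
- rewrite eqEsubset subsetT /=; apply/subsetP=> -[u|b] _; apply/bigcupP.
    exists [set x : 'I_k + 'I_k | match x with
         | inl u' => minn u' i.-1 == s (s^-1 (Ordinal (cap u)))%g :> nat
         | inr b => minn b i.-1 == (s^-1 (Ordinal (cap u)))%g :> nat end].
      exact: imset_f.
    by rewrite inE permKV.
  exists [set x : 'I_k + 'I_k | match x with
         | inl u' => minn u' i.-1 == s (Ordinal (cap b)) :> nat
         | inr b' => minn b' i.-1 == Ordinal (cap b) :> nat end].
    exact: imset_f.
  by rewrite inE.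
- apply/trivIsetP => A B /imsetP[a _ ->] /imsetP[b _ ->] neq.
  have {}neq : a != b by apply: contra neq => /eqP ->.
  rewrite -setI_eq0; apply/eqP/setP=> -[u|u]; rewrite !inE.
    apply/negP=> /andP[/eqP-> /eqP/val_inj/perm_inj eab].
    by rewrite eab eqxx in neq.
  apply/negP=> /andP[/eqP-> /eqP/val_inj eab].
  by rewrite eab eqxx in neq.
- apply/negP=> /imsetP[a _ /setP/(_ (inr (widen_ord ik a)))].
  by rewrite !inE /= wid eqxx.
Qed.

(* The product of the cycles (0, ..., mu_1 - 1), (mu_1, ..., mu_1 + mu_2 - 1),
   etc., as a map on natural numbers. *)
Fixpoint cycles_fun (mu : seq nat) (a : nat) : nat :=
  if mu is r :: mu' then
    if (a < r)%N then (if a.+1 == r then 0 else a.+1)%N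
    else (r + cycles_fun mu' (a - r))%N
  else a.

Lemma cycles_fun_lt (mu : seq nat) (a : nat) :
  (a < sumn mu)%N -> (cycles_fun mu a < sumn mu)%N.
Proof.
elim: mu a => //= r mu IH a lt; case: (ltnP a r) => [ar|ra].
  apply: (@leq_trans r); last exact: leq_addr.
  case: (a.+1 =P r) => [<-//|/eqP ne].
  by rewrite ltn_neqAle ne.
rewrite ltn_add2l IH // ltn_subLR //.
Qed.

Lemma cycles_fun_inj (mu : seq nat) : injective (cycles_fun mu).
Proof.
elim: mu => [|r mu IH] a b //=.
have lt x : (x < r)%N -> ((if x.+1 == r then 0 else x.+1) < r)%N.
  by move=> xr; case: (x.+1 =P r) => [<-//|/eqP ne]; rewrite ltn_neqAle ne.
case: (ltnP a r) (ltnP b r) => [ar|ra] [br|rb].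
- by case: (a.+1 =P r) => [ea|_]; case: (b.+1 =P r) => [eb|_] //;
     last case=> //; move=> _; apply: succn_inj; rewrite ea eb.
- by move=> e; have := lt a ar; rewrite e ltnNge leq_addr.
- by move=> e; have := lt b br; rewrite -e ltnNge leq_addr.
- by move/addnI/IH=> e; rewrite -(subnK ra) e subnK.
Qed.

Definition cycles_ord (mu : seq nat) (a : 'I_(sumn mu)) : 'I_(sumn mu) :=
  Ordinal (cycles_fun_lt (ltn_ord a)).

Lemma cycles_ord_inj (mu : seq nat) : injective (@cycles_ord mu).
Proof. by move=> a b [/cycles_fun_inj/val_inj]. Qed.

Definition cycles_perm (mu : seq nat) : 'S_(sumn mu) :=
  perm (@cycles_ord_inj mu).

Section PPModule.
Variables (F : fieldType) (n k : nat).

Definition tensor_space : vectType F := {ffun {ffun 'I_k -> 'I_n} -> F^o}.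

Definition rook_tensor (s : rook n) : 'End(tensor_space) :=
  linz F^o (@rook_comp n s 'I_k).

Definition PP_tensor (d : PP k) : 'End(tensor_space) := linz F^o (PP_map d).

(* The multiplicity space Hom_{R_n}(WR la, tensor_space), on which PP k acts by
   composition. *)
Definition WPP (la : seq nat) : {vspace 'Hom(WR F n la, tensor_space)} :=
  (\bigcap_(s : rook n)
     lker (linfun (fun phi : 'Hom(WR F n la, tensor_space) =>
       ((phi \o WR_act F la s) - (rook_tensor s \o phi))%VF)))%VS.

Definition chiPP (la : seq nat) (d : PP k) : F :=
  trace_on (WPP la) (fun phi => (PP_tensor d \o phi)%VF).

Definition chiPP_part (la mu : seq nat) : F :=
  oapp (chiPP la) 0 (insub (extend_diagram k (cycles_perm mu))).

Definition Ctable : 'M[F]_(nparts k) :=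
  \matrix_(i, j)
    let la := part i in let mu := part j in
    if (la == [::]) || (mu == [::]) then (la == mu)%:R else chiPP_part la mu.

Definition Ytable : 'M[F]_(nparts k) :=
  \matrix_(i, j)
    let la := part i in let mu := part j in
    if sumn la == sumn mu then chiS F la (cycles_perm mu) else 0.

End PPModule.

Definition upper_unitriangular (F : nzRingType) (N : nat) (A : 'M[F]_N) : Prop :=
  forall i j : 'I_N, ((j < i)%N -> A i j = 0) /\ (i = j -> A i j = 1).

(* Main.v *)
(* For n >= k, evaluating a morphism of rook modules at (inclusion [m] -> [n])
   tensor w identifies W^lambda_{PP_k}, m = |lambda|, with the S_m-morphisms from
   the Specht module to the permutation module on surjections [k] -> [m].  Hence
   C_{lambda,mu} = sum_rho chi^lambda(rho) N(rho,mu) / z_rho, where N(rho,mu) is the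
   number of surjections that intertwine permutations of cycle types mu and rho.
   Inclusion-exclusion over the cycles of rho gives N(rho,mu) as a coefficient of
   p_rho[Omega-1], which is C = Y R; then L = Y R Y^-1 is computed by the
   orthogonality of characters.

   The Schur functions are defined by Jacobi-Trudi determinants, so the characters
   of the Specht modules have to be identified with the coefficients of s_lambda on
   power sums.  Both families have norm 1, and both pair with h_lambda to 1 and with
   h_alpha to 0 for alpha lexicographically larger than lambda.  As s_lambda is a
   combination of such h_alpha with leading term h_lambda, the two pair to 1, and
   the norm of their difference is 1 - 2 + 1 = 0. *)

Require Import Defs.
From HB Require Import structures.
From mathcomp Require Import all_boot all_order all_fingroup all_algebra.
From mathcomp Require Import finmap.
From mathcomp Require Import monalg.
From mathcomp Require Import zify ring.

Set Implicit Arguments.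
Unset Strict Implicit.
Unset Printing Implicit Defensive.

Import Order.TTheory GRing.Theory Num.Theory.
Local Open Scope ring_scope.

(** * Partitions and averages over cycle types *)

(** The Hall product is given only by its values on Schur functions, and Lambda is a polynomial ring
    in the power sums, so symmetric functions are handled as averages [avg] of power sums over cycle
    types. No formal exponential is formed: the recursion [avg_rec], which contains Newton's
    identity, determines the series degree by degree. The numbers [nsurj] link all sides. They are
    the coefficients of p_rho[Omega - 1], they count equivariant surjections, and, since
    p_rho[Omega - 1] starts with p_rho, for partitions of one size they give the orders of
    centralizers. Cycle decompositions are thereby avoided: that every permutation is conjugate to a
    standard one follows from a count. On the module side no basis of a Specht module or of a
    multiplicity space is exhibited. With c the Young symmetrizer and c^2 = n c, the idempotent c/n
    yields spanning families with coordinate functions, from which [trace_on_frame] computes traces.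
    The numerical identities are proved over the rationals and transported to F by [ratr]. *)

Lemma zee_perm (s t : seq nat) : perm_eq s t -> zee s = zee t.
Proof.
move=> st; rewrite /zee (perm_big _ (perm_undup (perm_mem st))) /=.
by apply: eq_bigr => i _; rewrite (seq.permP st).
Qed.

Lemma zee_cons (r : nat) (s : seq nat) :
  zee (r :: s) = (zee s * (r * (count_mem r s).+1))%N.
Proof.
rewrite /zee /=; case: ifP => rs.
  rewrite (bigD1_seq r) ?mem_undup ?undup_uniq //= [in RHS](bigD1_seq r) ?mem_undup ?undup_uniq //=.
  rewrite eqxx /= add1n factS expnS.
  rewrite (eq_bigr (fun i => (count_mem i s)`! * i ^ count_mem i s)%N).
    ring.
  by move=> i ne; rewrite eq_sym (negbTE ne).
rewrite big_cons /= eqxx (count_memPn (negbT rs)) mulnC; congr (_ * _)%N; last first.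
  by rewrite addn0 /= expn1 mul1n muln1.
rewrite !big_seq; apply: eq_bigr => i; rewrite mem_undup => ins.
by case: eqP => // e; rewrite e ins in rs.
Qed.

Lemma zee_gt0 (s : seq nat) : 0%N \notin s -> (0 < zee s)%N.
Proof.
elim: s => [|r s IH]; first by rewrite /zee big_nil.
by rewrite inE negb_or zee_cons !muln_gt0 eq_sym -lt0n => /andP[-> /IH->].
Qed.

(** The multiplicity of the largest allowed part tells which block of the enumeration a partition
    comes from, so the blocks are disjoint. *)
Lemma parts_le_uniq (m n : nat) : uniq (parts_le m n).
Proof.
elim: m n => [|m IH] n /=; first by case: ifP.
move: (rev_uniq (iota 0 (n %/ m.+1).+1)); rewrite iota_uniq.
elim: (rev _) => //= c cs IHc /andP[cn ucs].
rewrite cat_uniq map_inj_uniq ?IH; last first.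
  by move=> s t /eqP; rewrite eqseq_cat // eqxx => /eqP.
rewrite IHc // andbT /=; apply/hasPn => la /flatten_mapP[d dcs] /mapP[s].
case/parts_leP=> _ _ /allP les ->; apply/negP=> /mapP[t /parts_leP[_ _ /allP let_] e].
have nin (x : seq nat) : {in x, forall r, (r <= m)%N} -> count_mem m.+1 x = 0%N.
  by move=> h; apply/count_memPn/negP => /h; rewrite ltnn.
have := congr1 (count_mem m.+1) e; rewrite !count_cat (nin s les) (nin t let_) !count_nseq /= eqxx.
by rewrite !mul1n !addn0 => e'; rewrite -e' dcs in cn.
Qed.

Lemma parts_of_uniq (n : nat) : uniq (parts_of n).
Proof. exact: parts_le_uniq. Qed.

Lemma mem_parts_of (n : nat) (la : seq nat) :
  (la \in parts_of n) = is_part la && (sumn la == n).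
Proof.
apply/parts_leP/andP => [[-> -> _] //|[pa /eqP su]]; split=> //.
apply/allP=> r; rewrite -su; elim: (la) => //= a l IHl.
rewrite inE => /orP[/eqP ->|/IHl H]; first exact: leq_addr.
exact: leq_trans H (leq_addl _ _).
Qed.

Lemma parts_of_pos (n : nat) (la : seq nat) : la \in parts_of n -> 0%N \notin la.
Proof. by rewrite mem_parts_of => /andP[/andP[]]. Qed.

Lemma parts_of_sumn (n : nat) (la : seq nat) : la \in parts_of n -> sumn la = n.
Proof. by rewrite mem_parts_of => /andP[_ /eqP]. Qed.

Lemma parts_of_perm (n : nat) (la mu : seq nat) :
  la \in parts_of n -> mu \in parts_of n -> perm_eq la mu = (la == mu).
Proof.
rewrite !mem_parts_of => /andP[/andP[sl _] _] /andP[/andP[sm _] _].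
apply/idP/eqP => [|-> //]; apply: (sorted_eq (rev_trans leq_trans)) => //.
by move=> x y /=; rewrite -eqn_leq => /eqP.
Qed.

Lemma sort_parts_of (n : nat) (s : seq nat) :
  0%N \notin s -> sumn s = n -> sort geq s \in parts_of n.
Proof.
move=> s0 su; rewrite mem_parts_of /is_part mem_sort s0.
rewrite sort_sorted; last by move=> x y; apply: leq_total.
by rewrite -su /= !sumnE (perm_big s) //= perm_sort.
Qed.

(* The sum over [mu] of the cycle index weights: the average over the symmetric
   group of the class function with value [Phi mu] at cycle type [mu]. *)
Definition avg (V : lmodType rat) (m : nat) (Phi : seq nat -> V) : V :=
  \sum_(mu <- parts_of m) (zee mu)%:R^-1 *: Phi mu.

Lemma eq_avg (V : lmodType rat) (m : nat) (Phi Psi : seq nat -> V) :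
  (forall mu, is_part mu -> sumn mu = m -> Phi mu = Psi mu) ->
  avg m Phi = avg m Psi.
Proof.
move=> e; rewrite /avg !big_seq; apply: eq_bigr => mu.
by rewrite mem_parts_of => /andP[p /eqP s]; rewrite e.
Qed.

Lemma avg0 (V : lmodType rat) (Phi : seq nat -> V) : avg 0 Phi = Phi [::].
Proof. by rewrite /avg /parts_of /= big_seq1 /zee big_nil invr1 scale1r. Qed.

(* Removing one part: z_(r u nu) = r (m_r(nu) + 1) z_nu, and the numbers r m_r(mu)
   add up to |mu|. *)
Lemma avg_rec (V : lmodType rat) (m : nat) (Phi : seq nat -> V) :
  (forall s t, perm_eq s t -> Phi s = Phi t) ->
  m%:R *: avg m Phi = \sum_(r < m) avg (m - r.+1) (fun nu => Phi (r.+1 :: nu)).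
Proof.
move=> inv.
have step (r : nat) : (r < m)%N ->
    avg (m - r.+1) (fun nu => Phi (r.+1 :: nu)) =
    \sum_(mu <- parts_of m) ((r.+1 * count_mem r.+1 mu)%:R / (zee mu)%:R) *: Phi mu.
  move=> rm; rewrite /avg.
  rewrite [RHS](bigID (fun mu => r.+1 \in mu)) /= [X in _ = _ + X]big1 ?addr0; last first.
    by move=> mu /count_memPn ->; rewrite muln0 mul0r scale0r.
  (* Inserting the part r + 1 is a bijection from the partitions of m - (r + 1) to the partitions of
     m that contain r + 1; sorting restores the normal form. *)
  have pe : perm_eq [seq sort geq (r.+1 :: nu) | nu <- parts_of (m - r.+1)]
                    [seq mu <- parts_of m | r.+1 \in mu].
    apply: uniq_perm.
    - rewrite map_inj_in_uniq ?parts_of_uniq // => s t ps pt e.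
      apply/eqP; rewrite -(parts_of_perm ps pt) -(perm_cons r.+1).
      by rewrite -(perm_sort geq) e perm_sort.
    - by rewrite filter_uniq ?parts_of_uniq.
    - move=> mu; rewrite mem_filter; apply/mapP/andP => [[nu pnu ->]|[rmu pmu]].
        rewrite mem_sort inE eqxx; split=> //; apply: sort_parts_of.
          by rewrite inE negb_or /= (parts_of_pos pnu).
        by rewrite /= (parts_of_sumn pnu) subnKC.
      have pr := perm_to_rem rmu.
      exists (sort geq (rem r.+1 mu)).
        apply: sort_parts_of; first by apply: contra (parts_of_pos pmu) => /mem_rem.
        have := parts_of_sumn pmu; rewrite sumnE (perm_big _ pr) big_cons -sumnE /= => <-.
        by rewrite addKn.
      have pmu' : sort geq (r.+1 :: sort geq (rem r.+1 mu)) \in parts_of m.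
        apply: sort_parts_of.
          rewrite inE negb_or mem_sort /=.
          by apply: contra (parts_of_pos pmu) => /mem_rem.
        rewrite -(parts_of_sumn pmu) !sumnE (perm_big _ pr) !big_cons; congr addn.
        by apply: perm_big; rewrite perm_sort.
      apply/eqP; rewrite -(parts_of_perm pmu pmu') (perm_trans pr) //.
      by rewrite perm_sym perm_sort perm_cons perm_sort.
  rewrite -[RHS]big_filter -(perm_big _ pe) /= big_map !big_seq.
  apply: eq_bigr => nu pnu.
  have ps : perm_eq (sort geq (r.+1 :: nu)) (r.+1 :: nu) by rewrite perm_sort.
  rewrite (inv _ _ ps) (zee_perm ps) (seq.permP ps) zee_cons /= eqxx add1n.
  congr (_ *: _); rewrite !natrM invfM mulrC -mulrA mulVf ?mulr1 //.
  by rewrite mulf_neq0 ?pnatr_eq0.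
under eq_bigr => r _ do rewrite step //.
rewrite exchange_big /= /avg scaler_sumr !big_seq; apply: eq_bigr => mu pmu.
rewrite -scaler_suml scalerA; congr (_ *: _); rewrite -mulr_suml; congr (_ / _).
rewrite -natr_sum; congr (_%:R).
have := parts_of_pos pmu; have := parts_of_sumn pmu.
elim: mu m {inv step pmu} => [|a mu IH] m /=.
  by move=> <- _; rewrite big_ord0.
move=> sm; rewrite inE negb_or => /andP[a0 mu0].
under eq_bigr => r _ do rewrite mulnDr.
rewrite big_split /=.
have am : (a.-1 < m)%N by rewrite -sm; case: a a0 {sm} => // a _; rewrite /= addSn ltnS leq_addr.
rewrite (bigD1 (Ordinal am)) //= big1 ?addn0; last first.
  move=> r ne; case: eqP => [ea|_]; last by rewrite muln0.
  by case/eqP: ne; apply/val_inj; rewrite /= ea.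
rewrite prednK ?lt0n 1?eq_sym // eqxx muln1 -{1}sm; congr (_ + _)%N.
rewrite (IH _ erefl mu0).
have le : (sumn mu <= m)%N by rewrite -sm leq_addl.
rewrite (big_ord_widen m (fun r => (r.+1 * count_mem r.+1 mu)%N) le) big_mkcond /=.
apply: eq_bigr => r _; case: ltnP => // sr.
suff /count_memPn -> : r.+1 \notin mu by rewrite muln0.
apply/negP=> rmu; move: sr; rewrite leqNgt => /negP; apply.
elim: (mu) rmu => //= b l IHl; rewrite inE => /orP[/eqP <-|/IHl]; first exact: leq_addr.
by move=> h; apply: leq_trans h (leq_addl _ _).
Qed.

(** By [avg_rec], m times this average is a sum of m smaller ones. In [sum_perm_class] it shows that
    the standard permutations represent all conjugacy classes. *)
Lemma avg_one (m : nat) : avg m (fun=> 1 : rat^o) = 1.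
Proof.
elim/ltn_ind: m => [[|m]] IH; first by rewrite avg0.
have h := avg_rec m.+1 (Phi := fun=> 1 : rat^o) (fun _ _ _ => erefl).
apply: (@scalerI _ rat^o m.+1%:R); first by rewrite pnatr_eq0.
rewrite h (eq_bigr (fun=> 1)); first by rewrite sumr_const card_ord [RHS]mulr1.
by move=> r _; apply: IH; rewrite subSS ltnS leq_subr.
Qed.

(** * Power sum monomials *)

Section PowerSumSubstitution.
Variables (A : comNzRingType) (c : {rmorphism rat -> A}) (x : nat -> A).

Let ev (m : {cmonom nat}) := \prod_(i <- finsupp m) x i.+1 ^+ m i.

Fact ev_mmorphism : mmorphism ev.
Proof.
have evw (m : {cmonom nat}) (d : {fset nat}) : (finsupp m `<=` d)%fset ->
    ev m = \prod_(i <- d) x i.+1 ^+ m i.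
  move=> le; rewrite /ev (big_fset_incl _ le) // => i _.
  by rewrite -cmE_eq0 => /eqP ->; rewrite expr0.
split; last by rewrite /ev mdom1 big_seq_fset0.
move=> m1 m2.
rewrite (evw _ _ (fsubsetUl (finsupp m1) (finsupp m2))).
rewrite (evw _ _ (fsubsetUr (finsupp m1) (finsupp m2))).
rewrite /ev mdomD -big_split /=; apply: eq_bigr => i _.
by rewrite cmM exprD.
Qed.

HB.instance Definition _ := monalg.isMultiplicative.Build _ _ ev ev_mmorphism.

Definition psubst_rmorphism : {rmorphism Lambda -> A} := mmap c ev.

Lemma psubstZ (a : rat) (f : Lambda) :
  psubst_rmorphism (a *: f) = c a * psubst_rmorphism f.
Proof. exact: (mmapZ (h := ev)). Qed.

Lemma psubst_psum1 (r : nat) : (0 < r)%N -> psubst_rmorphism (psum1 r) = x r.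
Proof.
move=> r0; have -> : psubst_rmorphism (psum1 r) = c 1 * ev (ucm r.-1) by exact: mmapU.
by rewrite rmorph1 mul1r /ev mdomU big_seq_fset1 cmUU prednK.
Qed.

Lemma psubst_psum (la : seq nat) : 0%N \notin la ->
  psubst_rmorphism (psum la) = \prod_(r <- la) x r.
Proof.
move=> la0; rewrite /psum rmorph_prod !big_seq; apply: eq_bigr => r rla.
rewrite psubst_psum1 // lt0n; apply/eqP => r0.
by rewrite r0 in rla; rewrite rla in la0.
Qed.

End PowerSumSubstitution.

Lemma psum_nil : psum [::] = 1.
Proof. by rewrite /psum big_nil. Qed.

Definition mon (la : seq nat) : {cmonom nat} :=
  \big[mmul/mone]_(r <- la) ucm r.-1.

Lemma monE (la : seq nat) (i : nat) :
  mon la i = count (fun r => r.-1 == i) la.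
Proof.
rewrite /mon; elim: la => [|r la IH]; first by rewrite big_nil cm1.
by rewrite big_cons cmM IH cmU.
Qed.

Lemma psumE (la : seq nat) : psum la = << mon la >>.
Proof.
rewrite /psum /mon; elim: la => [|r la IH]; first by rewrite !big_nil.
rewrite big_cons [X in << X >>]big_cons IH /psum1 (malgMEw msuppU_le msuppU_le).
rewrite !big_seq_fset1 !mcoeffUU (mulr1 (1 : rat)).
reflexivity.
Qed.

(** Zero parts must be excluded because [r.-1] sends both 0 and 1 to the variable of index 0. *)
Lemma mon_perm (s t : seq nat) : 0%N \notin s -> 0%N \notin t ->
  (mon s == mon t) = perm_eq s t.
Proof.
move=> s0 t0; apply/cmP/idP => [e|st i]; last by rewrite !monE (seq.permP st).
rewrite /perm_eq; apply/allP => -[|r] _ /=.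
  by rewrite !(count_memPn _).
have cm (u : seq nat) : 0%N \notin u -> count_mem r.+1 u = mon u r.
  by move=> u0; rewrite monE; apply: eq_in_count => -[|a] //= h; rewrite h in u0.
by rewrite !cm // e.
Qed.

Lemma psum_coef (n : nat) (la mu : seq nat) : la \in parts_of n ->
  is_part mu -> (psum la)@_(mon mu) = (la == mu)%:R.
Proof.
move=> pla /[dup] pmu /andP[smu mu0].
rewrite psumE mcoeffU1 mon_perm ?(parts_of_pos pla) //.
case: (eqVneq (sumn mu) n) => [su|ne].
  by rewrite (parts_of_perm pla) // mem_parts_of pmu su eqxx.
have [pe|_] := boolP (perm_eq _ _); have [e|_] := eqVneq la mu => //; case/eqP: ne.
  by rewrite -(parts_of_sumn pla) !sumnE (perm_big _ pe).
by rewrite -(parts_of_sumn pla) e.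
Qed.

Lemma avg_psum_coef (n : nat) (Phi : seq nat -> rat) (mu : seq nat) :
  is_part mu ->
  (avg n (fun nu => Phi nu *: psum nu))@_(mon mu) =
    if sumn mu == n then (zee mu)%:R^-1 * Phi mu else 0.
Proof.
move=> pmu; rewrite /avg raddf_sum /= big_seq.
under eq_bigr => nu pnu do rewrite 2!linearZ /= (psum_coef pnu pmu) eq_sym.
case: ifP => smu.
  have mumem : mu \in parts_of n by rewrite mem_parts_of pmu.
  rewrite -big_seq (bigD1_seq mu) ?parts_of_uniq //= big1 ?addr0 => [|nu /negbTE ne].
    by rewrite eqxx mulr1.
  by rewrite eq_sym ne !mulr0.
rewrite big1 // => nu; rewrite mem_parts_of => /andP[_ snu].
by case: eqP => [e|]; rewrite ?mulr0 //; rewrite e snu in smu.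
Qed.

(** * Exponential series and plethysm with Omega - 1 *)

(** The reindexing behind the Leibniz rule in [gexpM]: the triples (r, u, v) with r + 1 + u + v = d
    are grouped by e = r + 1 + u on the left and by r on the right. *)
Lemma exchange_big_triangle (V : zmodType) (F : nat -> nat -> nat -> V) (d : nat) :
  \sum_(e < d.+1) \sum_(r < e) F r (e - r.+1)%N (d - e)%N =
  \sum_(r < d) \sum_(e < (d - r.+1).+1) F r e (d - r.+1 - e)%N.
Proof.
transitivity (\sum_(e < d.+1) \sum_(r < d | (r < e)%N) F r (e - r.+1)%N (d - e)%N).
  by apply: eq_bigr => e _; rewrite (big_ord_widen d (fun r => F r (e - r.+1)%N (d - e)%N)) // -ltnS.
rewrite (exchange_big_dep xpredT) //=; apply: eq_bigr => r _.
have le : (r.+1 <= d.+1)%N by rewrite ltnS ltnW.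
rewrite -(big_mkord (fun e => r < e)%N (fun e => F r (e - r.+1)%N (d - e)%N)).
rewrite (big_cat_nat (leq0n _) le) //= big1_seq ?add0r; last first.
  by move=> e; rewrite mem_index_iota => /andP[re /andP[_ er]]; rewrite leqNgt er in re.
rewrite big_nat_cond (eq_bigl (fun e => r.+1 <= e < d.+1)%N); last first.
  by move=> e; case: (ltnP r e); rewrite ?andbF ?andbT.
rewrite -big_nat -{1}[r.+1]add0n big_addn big_mkord subSS.
have e1 : (d - r = (d - r.+1).+1)%N by rewrite subnSK.
rewrite e1; apply: eq_bigr => e _; rewrite addnK; congr F; lia.
Qed.

Lemma sum_multiples (V : zmodType) (F : nat -> V) (r n : nat) : (0 < r)%N ->
  \sum_(t < r * n) (if (r %| t.+1)%N then F t.+1 else 0) = \sum_(s < n) F (r * s.+1)%N.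
Proof.
move=> r0; elim: n => [|n IH]; first by rewrite muln0 !big_ord0.
rewrite big_ord_recr /= -IH.
rewrite -(big_mkord xpredT (fun t => if (r %| t.+1)%N then F t.+1 else 0)).
have le : (r * n <= r * n.+1)%N by rewrite leq_mul.
rewrite (big_cat_nat (leq0n _) le) //= big_mkord; congr (_ + _).
rewrite -{1}[(r * n)%N]add0n big_addn mulnS addnK big_mkord.
(* Among the last r indices only the final one, t = r - 1, has a successor divisible by r. *)
have r1 : (r.-1 < r)%N by rewrite prednK.
rewrite (bigD1 (Ordinal r1)) //= big1 ?addr0.
  by rewrite addnC -addnS prednK // dvdn_addl ?dvdnn ?dvdn_mulr // addnC.
move=> t ne; rewrite -addSn dvdn_addl ?dvdn_mulr //.
case: ifP => // /dvdn_leq -/(_ isT) rt; case/eqP: ne; apply/val_inj => /=.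
by have := ltn_ord t; lia.
Qed.

(* For partitions: the number of surjections that intertwine permutations of cycle
   types [mu] and [rho], by inclusion-exclusion over the cycles [A] that are hit. *)
Definition nsurj (rho mu : seq nat) : rat :=
  \sum_(A : {set 'I_(size rho)}) (-1) ^+ #|~: A| *
    \prod_(s <- mu) \sum_(j in A) (nth 0%N rho j * (nth 0%N rho j %| s))%:R.

Section PowerSums.
Variables (A : comAlgType rat) (p : nat -> A).

Definition pprod (la : seq nat) : A := \prod_(r <- la) p r.

Lemma pprod_cons (r : nat) (la : seq nat) : pprod (r :: la) = p r * pprod la.
Proof. by rewrite /pprod big_cons. Qed.

Lemma pprod_nil : pprod [::] = 1.
Proof. by rewrite /pprod big_nil. Qed.

Lemma pprod_perm (s t : seq nat) : perm_eq s t -> pprod s = pprod t.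
Proof. by move=> st; rewrite /pprod (perm_big _ st). Qed.

Definition hprod (n : nat) : A := avg n pprod.

Lemma hprod0 : hprod 0 = 1.
Proof. by rewrite /hprod avg0 pprod_nil. Qed.

Lemma newton (n : nat) :
  n%:R *: hprod n = \sum_(r < n) p r.+1 * hprod (n - r.+1).
Proof.
rewrite /hprod avg_rec; last exact: pprod_perm.
apply: eq_bigr => r _; rewrite /avg mulr_sumr; apply: eq_bigr => mu _.
by rewrite pprod_cons scalerAr.
Qed.

(* The degree d component of exp (\sum_r a_r p_r / r). *)
Definition gexp (a : nat -> rat) (d : nat) : A :=
  avg d (fun nu => (\prod_(r <- nu) a r) *: pprod nu).

Lemma eq_gexp (a b : nat -> rat) (d : nat) : a =1 b -> gexp a d = gexp b d.
Proof.
by move=> ab; apply: eq_avg => nu _ _; rewrite (eq_bigr b).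
Qed.

Lemma gexp0 (a : nat -> rat) : gexp a 0 = 1.
Proof. by rewrite /gexp avg0 big_nil scale1r pprod_nil. Qed.

Lemma gexp_rec (a : nat -> rat) (d : nat) :
  d%:R *: gexp a d = \sum_(r < d) a r.+1 *: (p r.+1 * gexp a (d - r.+1)).
Proof.
rewrite /gexp avg_rec; last first.
  by move=> s t st; rewrite (pprod_perm st) (perm_big _ st).
apply: eq_bigr => r _; rewrite /avg mulr_sumr scaler_sumr; apply: eq_bigr => mu _.
by rewrite pprod_cons big_cons -!scalerAr !scalerA mulrCA mulrA.
Qed.

(** Division by d is possible over the rationals, so the recursion of the logarithmic derivative
    determines the series. The identities between exponentials are proved by checking this
    recursion. *)
Lemma gexp_uniq (a : nat -> rat) (F : nat -> A) : F 0%N = 1 ->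
  (forall d, d%:R *: F d = \sum_(r < d) a r.+1 *: (p r.+1 * F (d - r.+1)%N)) ->
  F =1 gexp a.
Proof.
move=> F0 Frec d; elim/ltn_ind: d => [[|d]] IH; first by rewrite F0 gexp0.
apply: (@scalerI _ _ d.+1%:R); first by rewrite pnatr_eq0.
rewrite Frec gexp_rec; apply: eq_bigr => r _; rewrite IH //.
by rewrite subSS ltnS leq_subr.
Qed.

(** Multiplication by the degree is a derivation: writing d as e + (d - e) in each term shows that
    the product satisfies the recursion for a + b. *)
Lemma gexpM (a b : nat -> rat) (d : nat) :
  \sum_(e < d.+1) gexp a e * gexp b (d - e) = gexp (fun s => a s + b s) d.
Proof.
pose F d := \sum_(e < d.+1) gexp a e * gexp b (d - e).
apply: (gexp_uniq (F := F)); first by rewrite /F big_ord1 !gexp0 mulr1.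
move=> {}d; rewrite /F scaler_sumr.
under eq_bigr => e _.
  have -> : d%:R *: (gexp a e * gexp b (d - e)) =
     (e%:R *: gexp a e) * gexp b (d - e) + gexp a e * ((d - e)%:R *: gexp b (d - e)).
    have le : (e <= d)%N by rewrite -ltnS.
    by rewrite -scalerAl -scalerAr -scalerDl -natrD subnKC.
  rewrite !gexp_rec mulr_suml mulr_sumr; over.
rewrite big_split /=; under [RHS]eq_bigr => r _ do rewrite scalerDl mulr_sumr.
rewrite [RHS]big_split /=; congr (_ + _).
  rewrite (exchange_big_triangle (fun r u v => a r.+1 *: (p r.+1 * gexp a u) * gexp b v)).
  apply: eq_bigr => r _; rewrite scaler_sumr; apply: eq_bigr => e _.
  by rewrite -scalerAl mulrA.
rewrite (reindex_inj rev_ord_inj) /=.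
transitivity (\sum_(e < d.+1) \sum_(r < e)
    b r.+1 *: (p r.+1 * (gexp b (e - r.+1) * gexp a (d - e)))).
  apply: eq_bigr => e _; rewrite subSS subKn -1?ltnS //.
  by apply: eq_bigr => r _; rewrite -scalerAr mulrCA [gexp a _ * _]mulrC.
rewrite (exchange_big_triangle (fun r u v => b r.+1 *: (p r.+1 * (gexp b u * gexp a v)))).
apply: eq_bigr => r _; rewrite scaler_sumr (reindex_inj rev_ord_inj) /=.
apply: eq_bigr => e _; rewrite subSS subKn -1?ltnS //.
by rewrite [gexp b _ * _]mulrC.
Qed.

Lemma gexp_zero (d : nat) : gexp (fun=> 0) d = (d == 0%N)%:R.
Proof.
case: d => [|d]; first exact: gexp0.
apply: (@scalerI _ _ d.+1%:R); first by rewrite pnatr_eq0.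
by rewrite gexp_rec scaler0 big1 // => r _; rewrite scale0r.
Qed.

(** Truncating the factors in degree d leaves the coefficients of degree at most d intact, whence
    the bound on e. *)
Lemma coef_prod_gexp (I : Type) (s : seq I) (P : pred I) (a : I -> nat -> rat)
    (d e : nat) : (e <= d)%N ->
  (\prod_(i <- s | P i) \poly_(j < d.+1) gexp (a i) j)`_e =
    gexp (fun r => \sum_(i <- s | P i) a i r) e.
Proof.
elim: s e => [|i s IH] e le.
  rewrite big_nil coef1 -gexp_zero; apply: eq_gexp => r.
  by rewrite big_nil.
rewrite big_cons; case: ifP => Pi; last first.
  by rewrite IH //; apply: eq_gexp => r; rewrite big_cons Pi.
rewrite coefM; transitivity (gexp (fun r => a i r + \sum_(j <- s | P j) a j r) e); last first.
  by apply: eq_gexp => r; rewrite big_cons Pi.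
rewrite -gexpM; apply: eq_bigr => j _.
have jd : (j < d.+1)%N by apply: leq_trans (ltn_ord j) _; rewrite ltnS.
by rewrite coef_poly jd IH // (leq_trans (leq_subr _ _)).
Qed.

(** The third hypothesis is Newton's identity after p_s -> p_(rs). Thus p_r[Omega] is the
    exponential of the sum of p_(rs) / s, that is of r p_t / t over the multiples t of r, and the
    coefficient r comes from 1/s = r/t. *)
Lemma gexp_multiples (r : nat) (F : nat -> A) : (0 < r)%N -> F 0%N = 1 ->
  (forall n, n%:R *: F n = \sum_(s < n) p (r * s.+1) * F (n - s.+1)%N) ->
  (fun d => if (r %| d)%N then F (d %/ r)%N else 0) =1
    gexp (fun s => (r * (r %| s))%:R).
Proof.
move=> r0 F0 Frec; apply: gexp_uniq => [|d]; first by rewrite dvdn0 div0n.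
case: ifP => [/dvdnP[n ->]|rd]; last first.
  rewrite scaler0 big1 // => t _.
  case: (boolP (r %| t.+1)%N) => [rt|]; last by rewrite muln0 scale0r.
  by rewrite dvdn_subl // rd mulr0 scaler0.
rewrite mulnK // natrM mulrC -scalerA Frec scaler_sumr.
rewrite mulnC; symmetry.
transitivity (\sum_(t < r * n) if (r %| t.+1)%N then
   r%:R *: (p t.+1 * F ((r * n - t.+1) %/ r)%N) else 0).
  apply: eq_bigr => t _; case: (boolP (r %| t.+1)%N) => rt; last by rewrite muln0 scale0r.
  by rewrite muln1 dvdn_subl ?dvdn_mulr.
rewrite (sum_multiples (fun t => r%:R *: (p t * F ((r * n - t) %/ r)%N))) //.
by apply: eq_bigr => s _; rewrite -mulnBr mulKn.
Qed.

(** Expanding the product over the parts of rho means choosing from each factor either the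
    exponential or -1. The chosen exponentials multiply by adding their exponents, which is the
    inner sum in [nsurj]. *)
Lemma coef_prod_gexp_sub1 (rho : seq nat) (d : nat) :
  (\prod_(r <- rho) \poly_(e < d.+1)
     (gexp (fun s => (r * (r %| s))%:R) e - (e == 0%N)%:R))`_d =
  avg d (fun nu => nsurj rho nu *: pprod nu).
Proof.
pose a (j : 'I_(size rho)) s : rat := (nth 0%N rho j * (nth 0%N rho j %| s))%:R.
rewrite (big_nth 0%N) big_mkord.
have step (j : 'I_(size rho)) :
    \poly_(e < d.+1) (gexp (a j) e - (e == 0%N)%:R) =
    \poly_(e < d.+1) gexp (a j) e + (-1).
  apply/polyP => e; rewrite coefD !coef_poly coefN coef1.
  by case: ltnP => [_ //|de]; rewrite gtn_eqF ?subr0 // (leq_trans _ de).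
under eq_bigr => j _ do rewrite step.
rewrite bigA_distr coef_sum.
transitivity (\sum_(B : {set 'I_(size rho)})
    (-1) ^+ #|~: B| *: gexp (fun s => \sum_(j in B) a j s) d).
  apply: eq_bigr => B _; rewrite (bigID (mem B)) /=.
  rewrite (eq_bigr (fun j => \poly_(e < d.+1) gexp (a j) e)); last by move=> j ->.
  rewrite [X in _ * X](eq_bigr (fun=> -1)); last by move=> j /negbTE ->.
  rewrite prodr_const -(eq_card (A := ~: B)); last by move=> j; rewrite !inE.
  rewrite -[(-1) ^+ _ in LHS]signr_odd -[in RHS]signr_odd; case: (odd _) => /=.
    by rewrite expr1 mulrN1 coefN coef_prod_gexp // scaleN1r.
  by rewrite expr0 mulr1 coef_prod_gexp // scale1r.
rewrite /gexp /avg; under eq_bigr => B _ do rewrite scaler_sumr.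
rewrite exchange_big /=; apply: eq_bigr => nu _; rewrite /nsurj scaler_suml scaler_sumr.
by apply: eq_bigr => B _; rewrite !scalerA mulrCA mulrA.
Qed.

(** In degree at most r + |rho| every term of the convolution except the leading one has a factor
    below the degree where that factor starts. Nothing is known of [Q r] above degree r or above the
    truncation degree d. *)
Lemma coef_prod_low (rho : seq nat) (d : nat) (Q : nat -> {poly A}) :
  0%N \notin rho ->
  (forall r e, r \in rho -> (e <= r)%N -> (e <= d)%N ->
     (Q r)`_e = if e == r then p r else 0) ->
  forall e, (e <= sumn rho)%N -> (e <= d)%N ->
  (\prod_(r <- rho) Q r)`_e = if e == sumn rho then pprod rho else 0.
Proof.
elim: rho => [|r rho IH] /= rho0 HQ e.
  by rewrite leqn0 => /eqP -> _; rewrite big_nil coef1 pprod_nil.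
move: rho0; rewrite inE negb_or eq_sym => /andP[r0 rho0] le ed.
have {}IH e' : (e' <= sumn rho)%N -> (e' <= d)%N ->
    (\prod_(r <- rho) Q r)`_e' = if e' == sumn rho then pprod rho else 0.
  by apply: IH => // s f srho; apply: HQ; rewrite inE srho orbT.
have {}HQ e' : (e' <= r)%N -> (e' <= d)%N -> (Q r)`_e' = if e' == r then p r else 0.
  by apply: HQ; rewrite inE eqxx.
rewrite big_cons coefM pprod_cons.
case: eqP => [ee|/eqP ne].
  have re : (r < e.+1)%N by rewrite ltnS ee leq_addr.
  rewrite (bigD1 (Ordinal re)) //= [X in _ + X]big1 ?addr0.
    rewrite HQ ?eqxx //; last by apply: leq_trans ed; rewrite ee leq_addr.
    by rewrite IH // ?ee ?addKn ?eqxx // (leq_trans _ ed) // ee leq_addl.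
  move=> j jr; have jne : (j != r :> nat) by apply: contra jr => /eqP jr; apply/eqP/val_inj.
  have jd := ltn_ord j; case: (leqP j r) => jr'.
    by rewrite HQ ?(negbTE jne) ?mul0r //; lia.
  rewrite IH ?ifN ?mulr0 //; lia.
apply: big1 => j _; have jd := ltn_ord j; case: (leqP j r) => jr'.
  rewrite HQ //; last by lia.
  case: eqP => [ej|]; last by rewrite mul0r.
  by rewrite IH ?ifN ?mulr0 //; lia.
by rewrite [X in _ * X]IH ?ifN ?mulr0 //; lia.
Qed.

End PowerSums.

Lemma hsymE (n : nat) : hsym n = hprod psum1 n.
Proof. by []. Qed.

Lemma hsym0 : hsym 0 = 1.
Proof. exact: hprod0. Qed.

Lemma hsym1 : hsym 1 = psum1 1.
Proof. by have := newton psum1 1; rewrite scale1r big_ord1 subnn hprod0 mulr1. Qed.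

Definition adams_rmorphism (r : nat) : {rmorphism Lambda -> Lambda} :=
  psubst_rmorphism (@malgC {cmonom nat} rat) (fun j => psum1 (r * j)%N).

Lemma adamsE (r : nat) (f : Lambda) : adams r f = adams_rmorphism r f.
Proof. by []. Qed.

Lemma adamsZ (r : nat) (c : rat) (f : Lambda) :
  adams_rmorphism r (c *: f) = c *: adams_rmorphism r f.
Proof. by rewrite psubstZ mul_malgC. Qed.

Lemma cpsum_pleth_Omega_minus_1 (r e : nat) : (0 < r)%N ->
  cpsum_pleth r Omega_minus_1 e =
    gexp psum1 (fun s => (r * (r %| s))%:R) e - (e == 0%N)%:R.
Proof.
move=> r0; rewrite -(@gexp_multiples _ psum1 r (fun n => adams_rmorphism r (hsym n))) //.
- rewrite /cpsum_pleth /Omega_minus_1 /Omega adamsE rmorphB.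
  case: (eqVneq e 0%N) => [->|e0]; first by rewrite dvdn0 div0n rmorph1.
  rewrite subr0; case: ifP => // re.
  have -> : (e %/ r == 0)%N = false.
    by apply/negbTE; rewrite -lt0n divn_gt0 // dvdn_leq // lt0n.
  by rewrite rmorph0 subr0.
- by rewrite hsym0 rmorph1.
- move=> n; rewrite -adamsZ hsymE newton rmorph_sum; apply: eq_bigr => s _.
  by rewrite rmorphM psubst_psum1.
Qed.

Section Plethysm.
Variable F : cLambda.

Definition pleth_rmorphism (d : nat) : {rmorphism Lambda -> {poly Lambda}} :=
  psubst_rmorphism (@polyC Lambda \o @malgC {cmonom nat} rat)
    (fun r => \poly_(e < d.+1) cpsum_pleth r F e).

Lemma plethE (g : Lambda) (d : nat) : pleth g F d = (pleth_rmorphism d g)`_d.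
Proof. by []. Qed.

Lemma plethZ (a : rat) (g : Lambda) (d : nat) :
  pleth (a *: g) F d = a *: pleth g F d.
Proof.
rewrite !plethE psubstZ.
rewrite [LHS](@coefCM Lambda a%:MP (pleth_rmorphism d g) d).
exact: mul_malgC.
Qed.

Lemma pleth_avg (m : nat) (c : seq nat -> rat) (G : seq nat -> Lambda) (d : nat) :
  pleth (avg m (fun nu => c nu *: G nu)) F d =
  avg m (fun nu => c nu *: pleth (G nu) F d).
Proof.
rewrite plethE /avg rmorph_sum coef_sum; apply: eq_bigr => nu _.
by rewrite -plethE !plethZ.
Qed.

End Plethysm.

(** Pairing with p_nu cancels 1/z_nu, so [nsurj rho nu] is the scalar product in the formula for
    R. *)
Lemma pleth_psum (rho : seq nat) (d : nat) : 0%N \notin rho ->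
  pleth (psum rho) Omega_minus_1 d = avg d (fun nu => nsurj rho nu *: psum nu).
Proof.
move=> rho0; rewrite plethE psubst_psum // -(coef_prod_gexp_sub1 psum1 rho d).
congr ((polyseq _)`_d); rewrite !big_seq; apply: eq_bigr => r rrho.
apply: eq_poly => e _; apply: cpsum_pleth_Omega_minus_1.
by rewrite lt0n; apply: contraNneq rho0 => <-.
Qed.

(** Without its constant term Omega starts with h_1 = p_1, so p_r[Omega - 1] starts with p_r in
    degree r. *)
Lemma pleth_psum_low (rho : seq nat) (d : nat) : 0%N \notin rho ->
  (d <= sumn rho)%N ->
  pleth (psum rho) Omega_minus_1 d = if d == sumn rho then psum rho else 0.
Proof.
move=> rho0 le; rewrite plethE psubst_psum //.
apply: (coef_prod_low (p := psum1) (d := d)) => // r e rrho er ed.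
have r0 : (0 < r)%N by rewrite lt0n; apply: contraNneq rho0 => <-.
rewrite coef_poly ltnS ed /cpsum_pleth.
case: (eqVneq e 0%N) => [->|e0].
  rewrite dvdn0 div0n /Omega_minus_1 /Omega hsym0 subrr adamsE rmorph0.
  by rewrite eq_sym gtn_eqF.
case: (eqVneq e r) => [->|ne].
  rewrite dvdnn divnn r0 /Omega_minus_1 /Omega hsym1 -[(_ == _)%:R]/(1 *+ 0) mulr0n subr0.
  by rewrite adamsE (@psubst_psum1 _ _ _ 1 isT) muln1.
by rewrite gtnNdvd ?lt0n // ltn_neqAle ne.
Qed.

(** The coefficient of p_mu is compared in the two expansions of p_rho[Omega - 1]. This gives both
    the unitriangularity of R and, for equal sizes, the centralizer orders in [card_perm_conj]. *)
Lemma nsurj_low (rho mu : seq nat) : is_part rho -> is_part mu ->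
  (sumn mu <= sumn rho)%N -> nsurj rho mu = (zee rho)%:R * (rho == mu)%:R.
Proof.
move=> /[dup] prho /andP[_ rho0] /[dup] pmu /andP[_ mu0] le.
have := pleth_psum_low rho0 le; rewrite pleth_psum //.
move/(congr1 (mcoeff (mon mu))); rewrite avg_psum_coef // eqxx.
have rhoP : rho \in parts_of (sumn rho) by rewrite mem_parts_of prho eqxx.
have -> : (if sumn mu == sumn rho then psum rho else 0)@_(mon mu) = (rho == mu)%:R.
  case: eqP => [_|ne]; first by rewrite (psum_coef rhoP).
  by case: eqP => [e|]; rewrite ?mcoeff0 //; rewrite e in ne.
move=> e; case: (eqVneq rho mu) e => [->|_] e.
  apply/eqP; rewrite mulr1 -(inj_eq (@mulfI _ (zee mu)%:R^-1 _)) ?e ?mulVf //.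
    by rewrite pnatr_eq0 -lt0n zee_gt0.
  by rewrite invr_neq0 // pnatr_eq0 -lt0n zee_gt0.
rewrite mulr0; apply/eqP; move/eqP: e; rewrite mulf_eq0 invr_eq0 pnatr_eq0.
by rewrite gtn_eqF ?zee_gt0.
Qed.

(** * Skewing by complete functions and the Jacobi-Trudi characters *)

(** Sequences are padded by zeros and need not be sorted, since the index sequences of the
    h-products in a Jacobi-Trudi determinant are not. *)
Definition lex_gt (al la : seq nat) : Prop :=
  exists2 s, forall r, (r < s)%N -> nth 0%N al r = nth 0%N la r
           & (nth 0%N la s < nth 0%N al s)%N.

Section Skewing.
Variables (A : comAlgType rat) (p : nat -> A).
(** [theta] adjoins one more variable 'X to the alphabet, where p_r becomes p_r + 'X^r; [eps] takes
    the constant term, setting all variables to 0. *)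
Variables (theta : {rmorphism A -> {poly A}}) (eps : {rmorphism A -> rat}).
Hypothesis thetaZ : forall c f, theta (c *: f) = (c%:A)%:P * theta f.
Hypothesis theta_p : forall r, (0 < r)%N -> theta (p r) = (p r)%:P + 'X^r.
Hypothesis epsZ : forall c f, eps (c *: f) = c * eps f.
Hypothesis eps_p : forall r, (0 < r)%N -> eps (p r) = 0.

Local Notation h := (hprod p).

(* The adjoint of multiplication by h_a. *)
Definition skew (a : nat) (f : A) : A := (theta f)`_a.

Lemma skewZ (a : nat) (c : rat) (f : A) : skew a (c *: f) = c *: skew a f.
Proof. by rewrite /skew thetaZ coefCM mulr_algl. Qed.

Lemma skew_sum (a : nat) (I : Type) (s : seq I) (P : pred I) (F : I -> A) :
  skew a (\sum_(i <- s | P i) F i) = \sum_(i <- s | P i) skew a (F i).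
Proof. by rewrite /skew rmorph_sum coef_sum. Qed.

Lemma skew1 (a : nat) : skew a 1 = (a == 0%N)%:R.
Proof. by rewrite /skew rmorph1 coef1. Qed.

Lemma skew_pM (a r : nat) (f : A) : (0 < r)%N ->
  skew a (p r * f) = p r * skew a f + (if (r <= a)%N then skew (a - r) f else 0).
Proof.
move=> r0; rewrite /skew rmorphM theta_p // mulrDl coefD coefCM coefXnM.
by rewrite ltnNge; case: (r <= a)%N.
Qed.

(** In Newton's identity for h_n, the skewed factors h_(n-r) rebuild (n - a) h_(n-a), and the
    summands 'X^r of theta(p_r), for r from 1 to a, contribute the missing a h_(n-a). *)
Lemma skew_h (a n : nat) : skew a (h n) = if (a <= n)%N then h (n - a) else 0.
Proof.
elim/ltn_ind: n a => [[|n]] IH a.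
  by rewrite hprod0 skew1 leqn0; case: eqP.
apply: (@scalerI _ A n.+1%:R); first by rewrite pnatr_eq0.
rewrite -skewZ newton skew_sum.
under eq_bigr => r _.
  rewrite skew_pM // !IH; [|lia|lia].
  rewrite (_ : (a - r.+1 <= n.+1 - r.+1)%N = (a <= n.+1)%N); last by have := ltn_ord r; lia.
  over.
rewrite big_split /=.
case: (leqP a n.+1) => [le|gt] /=; last first.
  rewrite scaler0 [X in X + _]big1 ?[X in _ + X]big1 ?addr0 // => r _; first by rewrite if_same.
  by rewrite ifN ?mulr0 // -ltnNge; have := ltn_ord r; lia.
have -> : n.+1%:R *: h (n.+1 - a) = (n.+1 - a)%:R *: h (n.+1 - a) + a%:R *: h (n.+1 - a).
  by rewrite -scalerDl -natrD subnK.
congr (_ + _).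
  rewrite newton (big_ord_widen n.+1 (fun r => p r.+1 * h (n.+1 - a - r.+1))) ?leq_subr //.
  rewrite [RHS]big_mkcond /=; apply: eq_bigr => r _.
  rewrite (_ : (a <= n.+1 - r.+1)%N = (r < n.+1 - a)%N); last by have := ltn_ord r; lia.
  by case: ltnP => _; rewrite ?mulr0 // subnAC.
rewrite -big_mkcond /= (eq_bigr (fun=> h (n.+1 - a))); last first.
  by move=> r ra; congr (h _); lia.
by rewrite -(big_ord_widen n.+1 (fun=> h (n.+1 - a))) // sumr_const card_ord scaler_nat.
Qed.

(* The scalar product with h_al, i.e. the coefficient of x^al. *)
Fixpoint hcoef (al : seq nat) (f : A) : rat :=
  if al is a :: al' then hcoef al' (skew a f) else eps f.

Lemma hcoefZ (al : seq nat) (c : rat) (f : A) : hcoef al (c *: f) = c * hcoef al f.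
Proof. by elim: al f => [|a al IH] f /=; rewrite ?epsZ // skewZ IH. Qed.

Lemma hcoef_sum (al : seq nat) (I : Type) (s : seq I) (P : pred I) (F : I -> A) :
  hcoef al (\sum_(i <- s | P i) F i) = \sum_(i <- s | P i) hcoef al (F i).
Proof.
by elim: al F => [|a al IH] F /=; rewrite ?rmorph_sum // skew_sum IH.
Qed.

Lemma hcoefD (al : seq nat) (f g : A) : hcoef al (f + g) = hcoef al f + hcoef al g.
Proof.
by elim: al f g => [|a al IH] f g /=; rewrite ?rmorphD // /skew rmorphD coefD IH.
Qed.

Lemma hcoef0 (al : seq nat) : hcoef al 0 = 0.
Proof. by rewrite -[0 in LHS](scale0r (0 : A)) hcoefZ mul0r. Qed.

Definition lower (al : seq nat) (i r : nat) : seq nat :=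
  set_nth 0%N al i (nth 0%N al i - r)%N.

(** As p_r is the sum of the x_i^r, multiplying by it moves one exponent by r. The last term of the
    recursion vanishes by [eps_p]. *)
Lemma hcoef_pM (al : seq nat) (r : nat) (f : A) : (0 < r)%N ->
  hcoef al (p r * f) =
  \sum_(i < size al) if (r <= nth 0%N al i)%N then hcoef (lower al i r) f else 0.
Proof.
move=> r0; elim: al f => [|a al IH] f /=.
  by rewrite big_ord0 rmorphM eps_p ?mul0r.
rewrite skew_pM // hcoefD IH big_ord_recl /= addrC; congr (_ + _).
by case: ifP; rewrite ?hcoef0.
Qed.

(** The character, at cycle type [nu], of the permutation module on words of content [al]; see
    [hword_fixed_words]. *)
Definition hword (al nu : seq nat) : rat := hcoef al (pprod p nu).

Lemma size_lower (al : seq nat) (i r : nat) : (i < size al)%N -> size (lower al i r) = size al.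
Proof. by move=> lt; rewrite size_set_nth; apply/maxn_idPr. Qed.

Lemma sumn_lower (al : seq nat) (i r : nat) : (i < size al)%N ->
  (r <= nth 0%N al i)%N -> (sumn (lower al i r) = sumn al - r)%N.
Proof.
move=> lt le; rewrite /lower sumn_set_nth lt.
have : (nth 0%N al i <= sumn al)%N; last by lia.
by rewrite sumnE (big_nth 0%N) big_mkord (bigD1 (Ordinal lt)) //= leq_addr.
Qed.

(** Both sides satisfy the same recursion on the total size. On the left m is distributed as the sum
    of the entries of al, and Newton's identity for one factor lowers that entry, just as p_r does
    in [hcoef_pM]. *)
Lemma hprod_avg (al : seq nat) :
  \prod_(a <- al) h a = avg (sumn al) (fun nu => hword al nu *: pprod p nu).
Proof.
elim/ltn_ind: {al}(sumn al) {-2}al (erefl (sumn al)) => m IH al sal.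
rewrite sal; case: (posnP m) => [m0|mpos].
  rewrite m0 avg0 /hword pprod_nil.
  have al0 a : a \in al -> a = 0%N.
    move=> ain; move: sal; rewrite m0 sumnE (big_rem a ain) /= => /eqP.
    by rewrite addn_eq0 => /andP[/eqP].
  rewrite big_seq big1 => [|a /al0 ->]; last exact: hprod0.
  suff -> : hcoef al 1 = 1 by rewrite scale1r.
  elim: al al0 {sal} => [|a al IHal] al0 /=; first by rewrite rmorph1.
  by rewrite (al0 a) ?mem_head // skew1 eqxx IHal // => b bin; apply: al0; rewrite inE bin orbT.
apply: (@scalerI _ A m%:R); first by rewrite pnatr_eq0 -lt0n.
rewrite avg_rec; last by move=> s t st; rewrite /hword (pprod_perm p st).
have -> : m%:R *: \prod_(a <- al) h a =
    \sum_(i < size al) \sum_(r < m | (r < nth 0%N al i)%N)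
       p r.+1 * \prod_(a <- lower al i r.+1) h a.
  have -> : m%:R = \sum_(i < size al) (nth 0%N al i)%:R :> rat.
    by rewrite -sal sumnE (big_nth 0%N) big_mkord natr_sum.
  rewrite scaler_suml; apply: eq_bigr => i _.
  rewrite (big_nth 0%N) big_mkord (bigD1 i) //= scalerAl newton mulr_suml.
  have le : (nth 0%N al i <= m)%N.
    by rewrite -sal sumnE (big_nth 0%N) big_mkord (bigD1 i) //= leq_addr.
  rewrite (big_ord_widen m (fun r => p r.+1 * h (nth 0%N al i - r.+1) *
     \prod_(j < size al | j != i) h (nth 0%N al j))) //.
  apply: eq_bigr => r _; rewrite -mulrA; congr (_ * _).
  rewrite [RHS](big_nth 0%N) big_mkord size_lower //.
  rewrite [RHS](bigD1 i) //= nth_set_nth /= eqxx; congr (_ * _).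
  by apply: eq_bigr => j ji; rewrite nth_set_nth /= ifN.
rewrite (exchange_big_dep xpredT) //=; apply: eq_bigr => r _.
rewrite big_mkcond /=; symmetry.
transitivity (avg (m - r.+1) (fun nu => \sum_(i < size al)
    (if (r < nth 0%N al i)%N then hword (lower al i r.+1) nu else 0) *:
      (p r.+1 * pprod p nu))).
  apply: eq_avg => nu _ _; rewrite -scaler_suml /hword pprod_cons.
  by rewrite hcoef_pM.
rewrite /avg; under [LHS]eq_bigr => nu _ do rewrite scaler_sumr.
rewrite exchange_big /=; apply: eq_bigr => i _; case: ifP => [lt|_]; last first.
  by rewrite big1 // => nu _; rewrite scale0r scaler0.
rewrite (IH (m - r.+1)%N); last 2 first.
- by rewrite ltn_subrL.
- by rewrite sumn_lower // sal.
rewrite sumn_lower // sal /avg mulr_sumr; apply: eq_bigr => nu _.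
by rewrite -!scalerAr.
Qed.

(** This is h_(x-y), with h of a negative index equal to 0; keeping x and y apart avoids truncated
    subtraction. *)
Definition hz (x y : nat) : A := if (y <= x)%N then h (x - y) else 0.

Definition jacobi_trudi (la : seq nat) : A :=
  \det (\matrix_(i < size la, j < size la) hz (nth 0%N la i + j) i).

Lemma skew_hz (a x y : nat) : skew a (hz x y) = hz x (y + a).
Proof.
rewrite /hz; case: leqP => [yx|xy].
  by rewrite skew_h leq_subRL // -subnDA.
rewrite /skew rmorph0 coef0 ifN // -ltnNge.
exact: leq_trans xy (leq_addr _ _).
Qed.

Lemma theta_hz_step (x y : nat) :
  theta (hz x.+1 y) = (hz x.+1 y)%:P + 'X * theta (hz x y).
Proof.
apply/polyP => a; rewrite coefD coefC coefXM -[LHS]/(skew _ _) skew_hz.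
case: a => [|a]; first by rewrite addn0 addr0.
by rewrite add0r /= -[RHS]/(skew _ _) skew_hz /hz addnS ltnS subSS.
Qed.

(* Subtracting 'X times the previous column from each column leaves the shifted
   entries in column 0 only. *)
Lemma theta_jacobi_trudi (l : nat) (la : seq nat) :
  theta (jacobi_trudi (l :: la)) =
  \det (\matrix_(i < (size la).+1, j < (size la).+1)
     if j == 0 then theta (hz (nth 0%N (l :: la) i) i)
     else (hz (nth 0%N (l :: la) i + j) i)%:P).
Proof.
rewrite /jacobi_trudi -det_map_mx; set M := (RHS).
(* [T] undoes all the column operations at once: it has determinant 1, and the simplified matrix
   times [T] is the matrix of the images under [theta]. *)
pose T : 'M[{poly A}]_((size la).+1) := \matrix_(i, j) if (i <= j)%N then 'X^(j - i) else 0.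
have detT : \det T = 1.
  rewrite -det_tr det_trig.
    by rewrite big1 // => i _; rewrite !mxE leqnn subnn expr0.
  by apply/is_trig_mxP => i j ij; rewrite !mxE leqNgt ij.
rewrite -[M]mulr1 -detT -det_mulmx; congr (\det _).
apply/matrixP => i j; rewrite !mxE.
under [RHS]eq_bigr => k _ do rewrite !mxE.
set x := nth 0%N _ i; clearbody x.
have -> : \sum_(k < (size la).+1)
    (if k == 0 then theta (hz x i) else (hz (x + k) i)%:P) *
    (if (k <= j)%N then 'X^(j - k) else 0) =
  \sum_(k < j.+1) (if k == 0 :> nat then theta (hz x i) else (hz (x + k) i)%:P) * 'X^(j - k).
  rewrite (big_ord_widen (size la).+1 (fun k => (if k == 0%N then theta (hz x i)
    else (hz (x + k) i)%:P) * 'X^(j - k))) //.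
  rewrite [RHS]big_mkcond /=; apply: eq_bigr => k _; rewrite ltnS.
  by case: leqP => _; rewrite ?mulr0.
elim: (j : nat) => [|n IH]; first by rewrite big_ord1 subnn expr0 mulr1 addn0.
rewrite big_ord_recr /= subnn expr0 mulr1 addnS theta_hz_step IH addrC mulr_sumr.
congr (_ + _); apply: eq_bigr => k _.
by rewrite subSn -1?ltnS // exprS mulrCA.
Qed.

(** Expand along column 0. Row i > 0 contributes h of index la_i - i - a, which is negative because
    la_i <= l <= a. Row 0 contributes h_(l-a), which is 1 or 0, and its minor is the determinant for
    [la]. *)
Lemma skew_jacobi_trudi (a l : nat) (la : seq nat) :
  sorted geq (l :: la) -> (l <= a)%N ->
  skew a (jacobi_trudi (l :: la)) = (a == l)%:R * jacobi_trudi la.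
Proof.
move=> so le; rewrite /skew theta_jacobi_trudi (expand_det_col _ 0) coef_sum.
pose N (i : 'I_(size la).+1) : 'M[A]_(size la) :=
  \matrix_(i' < size la, j' < size la)
    hz (nth 0%N (l :: la) (lift i i') + j'.+1) (lift i i').
have cof i : cofactor (\matrix_(i < (size la).+1, j < (size la).+1)
     if j == 0 then theta (hz (nth 0%N (l :: la) i) i)
     else (hz (nth 0%N (l :: la) i + j) i)%:P) i 0 = ((-1) ^+ i * \det (N i))%:P.
  rewrite /cofactor addn0 rmorphM rmorphXn /= polyCN; congr (_ * _).
  by rewrite -det_map_mx; congr (\det _); apply/matrixP => i' j'; rewrite !mxE.
under eq_bigr => i _ do
  rewrite cof coefMC mxE eqxx -[(theta _)`_a]/(skew a _) skew_hz.
rewrite big_ord_recl big1 ?addr0 => [|i _].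
  rewrite expr0 mul1r /hz add0n; case: (ltngtP a l) le => // [la_ _|-> _].
    by rewrite !mul0r.
  rewrite subnn hprod0; congr (_ * \det _); apply/matrixP => i' j'.
  by rewrite !mxE /hz /= addnS ltnS subSS.
suff -> : hz (nth 0%N (l :: la) (lift ord0 i)) (lift ord0 i + a) = 0 by rewrite mul0r.
rewrite /hz ifN // -ltnNge /= /bump add1n addSn ltnS.
apply: leq_trans (leq_trans _ le) (leq_addl _ _).
have /allP omin := order_path_min (rev_trans leq_trans) so.
exact: omin (mem_nth 0%N (ltn_ord i)).
Qed.

(** Equal leading entries are peeled off one by one; at the first difference the skewing gives 0.
    Once [la] is exhausted, zero entries of [al] leave the empty determinant 1 unchanged. *)
Lemma hcoef_jacobi_trudi_gt (al la : seq nat) :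
  sorted geq la -> lex_gt al la -> hcoef al (jacobi_trudi la) = 0.
Proof.
have nilE : jacobi_trudi [::] = 1 by rewrite /jacobi_trudi det_mx00.
move=> so [s]; elim: s al la so => [|s IH] [|a al] [|l la] so //=.
- by move=> _ a0; rewrite nilE skew1 (gtn_eqF a0); apply: hcoef0.
- move=> _ la_; rewrite (skew_jacobi_trudi so (ltnW la_)) (gtn_eqF la_) mul0r.
  exact: hcoef0.
- move=> e lt; have a0 := e 0%N isT; rewrite /= in a0; rewrite nilE skew1 a0 /= -nilE.
  apply: (IH _ [::]) => // [r rs|]; last by rewrite nth_nil.
  by have /= := e r.+1 rs; rewrite nth_nil.
- move=> e lt; have a0 := e 0%N isT; rewrite /= in a0; subst a.
  rewrite (skew_jacobi_trudi so (leqnn l)) eqxx mul1r; apply: IH => //.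
    exact: path_sorted so.
  by move=> r rs; apply: (e r.+1).
Qed.

Lemma hcoef_jacobi_trudi (la : seq nat) :
  sorted geq la -> hcoef la (jacobi_trudi la) = 1.
Proof.
elim: la => [|l la IH] so /=; first by rewrite /jacobi_trudi det_mx00 rmorph1.
by rewrite (skew_jacobi_trudi so (leqnn l)) eqxx mul1r; apply: IH (path_sorted so).
Qed.

(** The subtraction is truncated. Where this matters the product contains an h of negative index,
    and [jt_ok] discards the term. *)
Definition jt_term (la : seq nat) (w : 'S_(size la)) : seq nat :=
  [seq (nth 0%N la i + w i - i)%N | i : 'I_(size la) <- enum 'I_(size la)].

Definition jt_ok (la : seq nat) (w : 'S_(size la)) : bool :=
  [forall i : 'I_(size la), (i <= nth 0%N la i + w i)%N].

(* By the determinant, the value of the irreducible character indexed by [la] at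
   cycle type [nu]. *)
Definition jt_char (la nu : seq nat) : rat :=
  \sum_(w : 'S_(size la) | jt_ok w) (-1) ^+ w * hword (jt_term w) nu.

Lemma nth_jt_term (la : seq nat) (w : 'S_(size la)) (i : 'I_(size la)) :
  nth 0%N (jt_term w) i = (nth 0%N la i + w i - i)%N.
Proof. by rewrite (nth_map i) ?size_enum_ord // nth_ord_enum. Qed.

Lemma size_jt_term (la : seq nat) (w : 'S_(size la)) : size (jt_term w) = size la.
Proof. by rewrite size_map size_enum_ord. Qed.

Lemma jt_term1 (la : seq nat) : jt_term (1%g : 'S_(size la)) = la.
Proof.
apply: (@eq_from_nth _ 0%N); rewrite size_jt_term // => i lt.
by rewrite (nth_jt_term 1%g (Ordinal lt)) perm1 addnK.
Qed.

Lemma sumn_jt_term (la : seq nat) (w : 'S_(size la)) : jt_ok w ->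
  sumn (jt_term w) = sumn la.
Proof.
move/forallP => ok; rewrite !sumnE (big_nth 0%N) big_mkord size_jt_term.
rewrite [RHS](big_nth 0%N) big_mkord; apply/eqP.
rewrite -(eqn_add2r (\sum_(i < size la) i)) -big_split /=; apply/eqP.
under eq_bigr => i _ do rewrite nth_jt_term subnK //.
rewrite !big_split /=; congr (_ + _)%N.
by rewrite [RHS](reindex_inj (@perm_inj _ w)).
Qed.

Lemma jacobi_trudi_avg (la : seq nat) :
  jacobi_trudi la = avg (sumn la) (fun nu => jt_char la nu *: pprod p nu).
Proof.
rewrite /jacobi_trudi /determinant (bigID (@jt_ok la)) /= [X in _ + X]big1 ?addr0.
  transitivity (\sum_(w : 'S_(size la) | jt_ok w)
      avg (sumn la) (fun nu => ((-1) ^+ w * hword (jt_term w) nu) *: pprod p nu)).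
    apply: eq_bigr => w ok.
    transitivity ((-1) ^+ w * \prod_(a <- jt_term w) h a).
      congr (_ * _); rewrite (big_nth 0%N) big_mkord size_jt_term.
      apply: eq_bigr => i _; rewrite mxE nth_jt_term /hz.
      by rewrite (forallP ok i).
    rewrite hprod_avg sumn_jt_term // /avg mulr_sumr; apply: eq_bigr => nu _.
    rewrite -!scalerAr -[in RHS]scalerA; congr (_ *: _).
    by case: (odd_perm w); rewrite ?expr1 ?expr0 ?mulN1r ?mul1r ?scaleN1r ?scale1r ?scalerN.
  rewrite /avg exchange_big /=; apply: eq_bigr => nu _.
  by rewrite /jt_char scaler_suml scaler_sumr.
move=> w; rewrite negb_forall => /existsP[i ni].
by rewrite (bigD1 i) //= mxE /hz (negbTE ni) mul0r mulr0.
Qed.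

(** The scalar product of class functions on the symmetric group, summed over cycle types;
    [cform_cyc] relates it to the sum over permutations. *)
Definition cform (m : nat) (x y : seq nat -> rat) : rat :=
  \sum_(nu <- parts_of m) (zee nu)%:R^-1 * (x nu * y nu).

(** Pairing with h_al extracts the coefficient of x^al from the Frobenius characteristic of c. *)
Lemma cform_hword (m : nat) (c : seq nat -> rat) (al : seq nat) :
  cform m c (hword al) = hcoef al (avg m (fun nu => c nu *: pprod p nu)).
Proof.
by rewrite /cform /avg hcoef_sum; apply: eq_bigr => nu _; rewrite !hcoefZ.
Qed.

Lemma cform_jt_charr (m : nat) (c : seq nat -> rat) (mu : seq nat) :
  cform m c (jt_char mu) =
  \sum_(w : 'S_(size mu) | jt_ok w) (-1) ^+ w * cform m c (hword (jt_term w)).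
Proof.
rewrite /cform; under [RHS]eq_bigr => w _ do rewrite mulr_sumr.
rewrite [RHS]exchange_big /=; apply: eq_bigr => nu _.
rewrite /jt_char !mulr_sumr; apply: eq_bigr => w _.
by rewrite [c nu * _]mulrCA [X in X = _]mulrCA.
Qed.

(** At the first point i moved by w one has w(i) > i, the smaller values being taken. So the
    sequence agrees with mu before i and exceeds it at i. *)
Lemma lex_gt_jt_term (la mu : seq nat) (w : 'S_(size mu)) :
  jt_ok w -> mu = la \/ lex_gt mu la -> w != 1%g \/ mu <> la ->
  lex_gt (jt_term w) la.
Proof.
case: (eqVneq w 1%g) => [->|w1] ok le ne.
  rewrite jt_term1.
  by case: le => // e; case: ne; rewrite ?eqxx.
have [i [fixi gti]] : exists i : 'I_(size mu),
    (forall j : 'I_(size mu), (j < i)%N -> w j = j) /\ (i < w i)%N.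
  have /existsP[i0 i0P] : [exists i, w i != i].
    rewrite -negb_forall; apply: contra w1 => /forallP e; apply/eqP/permP => i.
    by rewrite perm1; apply/eqP.
  case: (@arg_minnP _ i0 (fun i => w i != i) (fun i => i : nat) i0P) => i iP imin.
  have fx (j : 'I_(size mu)) : (j < i)%N -> w j = j.
    by move=> ji; apply/eqP; apply: contraLR ji => jP; rewrite -leqNgt imin.
  exists i; split=> //; rewrite ltnNge leq_eqVlt negb_or iP /=; apply/negP => wi.
  by move: (fx _ wi) => /perm_inj e; rewrite e eqxx in iP.
have lo (j : nat) : (j < i)%N -> nth 0%N (jt_term w) j = nth 0%N mu j.
  move=> ji; have lt := ltn_trans ji (ltn_ord i).
  by rewrite (nth_jt_term w (Ordinal lt)) fixi //= addnK.
have hi : (nth 0%N mu i < nth 0%N (jt_term w) i)%N.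
  by rewrite nth_jt_term; lia.
case: le => [e|[s es gs]].
  by rewrite -e; exists i.
case: (ltnP s i) => [si|is_].
  by exists s => [r rs|]; [rewrite lo ?es // (ltn_trans rs)|rewrite lo].
exists i => [r ri|]; first by rewrite lo ?es // (leq_trans ri).
move: is_; rewrite leq_eqVlt => /predU1P[e|is_].
  by rewrite -e in gs; apply: ltn_trans gs hi.
by rewrite -es.
Qed.

Lemma cform_jt_char_lex (m : nat) (c : seq nat -> rat) (la mu : seq nat) :
  sumn mu = m ->
  (forall al, sumn al = m -> lex_gt al la -> cform m c (hword al) = 0) ->
  cform m c (hword la) = 1 ->
  mu = la \/ lex_gt mu la ->
  cform m c (jt_char mu) = (mu == la)%:R.
Proof.
move=> smu cgt c1 le; rewrite cform_jt_charr.
have ok1 : jt_ok (1%g : 'S_(size mu)) by apply/forallP => i; rewrite perm1 leq_addl.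
rewrite (bigD1 1%g) //= big1 ?addr0 => [|w /andP[ok w1]]; last first.
  rewrite cgt ?mulr0 ?sumn_jt_term //.
  by apply: lex_gt_jt_term => //; left.
rewrite odd_perm1 expr0 mul1r jt_term1.
by case: eqP le => [-> _|ne [//|gt]]; rewrite ?c1 ?cgt.
Qed.

Lemma cform_jt_char_gt (al la : seq nat) : sorted geq la -> lex_gt al la ->
  cform (sumn la) (jt_char la) (hword al) = 0.
Proof.
by move=> so gt; rewrite cform_hword -jacobi_trudi_avg hcoef_jacobi_trudi_gt.
Qed.

Lemma cform_jt_char_hword (la : seq nat) : sorted geq la ->
  cform (sumn la) (jt_char la) (hword la) = 1.
Proof. by move=> so; rewrite cform_hword -jacobi_trudi_avg hcoef_jacobi_trudi. Qed.

Lemma cformC (m : nat) (x y : seq nat -> rat) : cform m x y = cform m y x.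
Proof. by apply: eq_bigr => nu _; rewrite [y nu * _]mulrC. Qed.

Lemma lex_total (la mu : seq nat) : 0%N \notin la -> 0%N \notin mu ->
  [\/ mu = la, lex_gt mu la | lex_gt la mu].
Proof.
elim: la mu => [|l la IH] [|r mu] la0 mu0.
- by constructor 1.
- constructor 2; exists 0%N => //=.
  by rewrite lt0n; apply: contraNneq mu0 => ->; rewrite mem_head.
- constructor 3; exists 0%N => //=.
  by rewrite lt0n; apply: contraNneq la0 => ->; rewrite mem_head.
move: la0 mu0; rewrite !inE !negb_or => /andP[_ la0] /andP[_ mu0].
case: (ltngtP l r) => [lt|gt|->].
- by constructor 2; exists 0%N.
- by constructor 3; exists 0%N.
case: (IH mu la0 mu0) => [->|[s es gs]|[s es gs]].
- by constructor 1.
- by constructor 2; exists s.+1 => // -[|i] //; apply: es.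
- by constructor 3; exists s.+1 => // -[|i] //; apply: es.
Qed.

(** Triangularity and the symmetry of the form suffice: the lexicographically larger of the two is
    expanded in h-products, all of which pair to 0 with the smaller one. *)
Lemma cform_jt_char (m : nat) (la mu : seq nat) :
  la \in parts_of m -> mu \in parts_of m ->
  cform m (jt_char la) (jt_char mu) = (la == mu)%:R.
Proof.
rewrite !mem_parts_of => /andP[/andP[sla la0] /eqP <-] /andP[/andP[smu mu0] /eqP smula].
have aux (x y : seq nat) : sorted geq x -> sumn y = sumn x -> y = x \/ lex_gt y x ->
    cform (sumn x) (jt_char x) (jt_char y) = (y == x)%:R.
  move=> sx yx le; apply: cform_jt_char_lex => //.
    by move=> al _; apply: cform_jt_char_gt.
  exact: cform_jt_char_hword.
case: (lex_total la0 mu0) => le; rewrite ?[la == mu]eq_sym.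
- by apply: aux => //; left.
- by apply: aux => //; right.
- by rewrite cformC -smula aux //; [rewrite eq_sym|right].
Qed.

(* If c has norm 1 and <c, chi> = 1 with chi = jt_char la of norm 1, then
   |c - chi|^2 = 1 - 2 + 1 = 0. *)
Lemma eq_jt_char (m : nat) (c : seq nat -> rat) (la nu : seq nat) :
  la \in parts_of m -> nu \in parts_of m ->
  cform m c c = 1 ->
  (forall al, sumn al = m -> lex_gt al la -> cform m c (hword al) = 0) ->
  cform m c (hword la) = 1 ->
  c nu = jt_char la nu.
Proof.
move=> pla pnu cc cgt c1.
have c2 : cform m c (jt_char la) = 1.
  rewrite (cform_jt_char_lex _ cgt c1) ?eqxx //; first exact: parts_of_sumn pla.
  by left.
have c3 : cform m (jt_char la) (jt_char la) = 1 by rewrite cform_jt_char // eqxx.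
pose y nu := c nu - jt_char la nu.
have yy : cform m y y = 0.
  transitivity (cform m c c - cform m c (jt_char la) *+ 2 + cform m (jt_char la) (jt_char la)).
    rewrite /cform -sumrMnl -sumrB -big_split /=; apply: eq_bigr => mu _.
    by rewrite /y; ring.
  by rewrite cc c2 c3; ring.
have : y nu = 0; last by move/eqP; rewrite subr_eq0 => /eqP.
have ge0 mu : mu \in parts_of m -> 0 <= (zee mu)%:R^-1 * (y mu * y mu).
  by move=> _; rewrite mulr_ge0 ?invr_ge0 ?ler0n // -expr2 sqr_ge0.
move: yy; rewrite /cform big_seq => /eqP.
rewrite psumr_eq0 // => /allP/(_ nu pnu); rewrite pnu /= => /eqP.
move/eqP; rewrite mulf_eq0 invr_eq0 pnatr_eq0 gtn_eqF ?zee_gt0 ?(parts_of_pos pnu) //=.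
by rewrite mulf_eq0 orbb => /eqP.
Qed.

End Skewing.

(** * Maps intertwining two permutations *)

Section Intertwiners.
Variables (X : finType) (t : X -> X).

Definition intertwine (mu : seq nat) (g : {ffun 'I_(sumn mu) -> X}) : bool :=
  [forall a, g (cycles_ord a) == t (g a)].

Lemma intertwineP (mu : seq nat) (g : {ffun 'I_(sumn mu) -> X}) :
  reflect (forall a, g (cycles_ord a) = t (g a)) (intertwine g).
Proof. exact: 'forall_eqP. Qed.

Definition glue (r : nat) (mu : seq nat)
    (u : X * {ffun 'I_(sumn mu) -> X}) : {ffun 'I_(sumn (r :: mu)) -> X} :=
  [ffun a : 'I_(r + sumn mu) =>
     match split a with inl b => iter b t u.1 | inr c => u.2 c end].

Lemma glue_lshift (r : nat) (mu : seq nat) u (b : 'I_r) :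
  glue r u (lshift (sumn mu) b) = iter b t u.1.
Proof. by rewrite ffunE (unsplitK (inl b)). Qed.

Lemma glue_rshift (r : nat) (mu : seq nat) u (c : 'I_(sumn mu)) :
  glue r u (rshift r c) = u.2 c.
Proof. by rewrite ffunE (unsplitK (inr c)). Qed.

Lemma cycles_ord_rshift (r : nat) (mu : seq nat) (c : 'I_(sumn mu)) :
  @cycles_ord (r :: mu) (rshift r c) = rshift r (cycles_ord c).
Proof. by apply/val_inj; rewrite /= ltnNge leq_addr addKn. Qed.

Lemma cycles_ord_lshift (r : nat) (mu : seq nat) (b b' : 'I_r) :
  b' = (if b.+1 == r then 0 else b.+1)%N :> nat ->
  @cycles_ord (r :: mu) (lshift (sumn mu) b) = lshift (sumn mu) b'.
Proof. by move=> e; apply/val_inj; rewrite /= ltn_ord e. Qed.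

Lemma intertwine_glue (r : nat) (mu : seq nat) u : (0 < r)%N ->
  @intertwine (r :: mu) (glue r u) = (iter r t u.1 == u.1) && intertwine u.2.
Proof.
move=> r0; apply/intertwineP/andP => [e|[/eqP e1 /intertwineP e2] a].
  split.
    have lt : (r.-1 < r)%N by rewrite prednK.
    have := e (lshift (sumn mu) (Ordinal lt)).
    rewrite (@cycles_ord_lshift _ _ _ (Ordinal r0)) /= ?prednK ?eqxx //.
    have e1 : iter r t u.1 = t (iter r.-1 t u.1) by rewrite -[in LHS](prednK r0).
    by rewrite !glue_lshift /= e1 => <-.
  apply/intertwineP => c; have := e (rshift r c).
  by rewrite cycles_ord_rshift !glue_rshift.
case: (split_ordP (a : 'I_(r + sumn mu))) => [b|c] ->; last first.
  by rewrite cycles_ord_rshift !glue_rshift.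
case: (eqVneq b.+1 r) => [br|br].
  rewrite (@cycles_ord_lshift _ _ _ (Ordinal r0)) /= ?br ?eqxx //.
  by rewrite !glue_lshift /= -iterS br e1.
have lt : (b.+1 < r)%N by rewrite ltn_neqAle br ltn_ord.
rewrite (@cycles_ord_lshift _ _ _ (Ordinal lt)) /= ?(negbTE br) //.
by rewrite !glue_lshift.
Qed.

(* On the first cycle, an intertwiner is given by the image x of one point, with
   t^r x = x. *)
Lemma big_intertwine_cons (V : zmodType) (r : nat) (mu : seq nat)
    (F : {ffun 'I_(sumn (r :: mu)) -> X} -> V) : (0 < r)%N ->
  \sum_(g | @intertwine (r :: mu) g) F g =
  \sum_(x | iter r t x == x) \sum_(g | @intertwine mu g) F (glue r (x, g)).
Proof.
move=> r0; rewrite pair_big /=.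
pose h' (g : {ffun 'I_(sumn (r :: mu)) -> X}) : X * {ffun 'I_(sumn mu) -> X} :=
  (g (lshift (sumn mu) (Ordinal r0)), [ffun c => g (rshift r c)]).
rewrite (reindex_onto (@glue r mu) h') /=.
  apply: eq_big => [[x g]|[x g] _ //]; rewrite intertwine_glue //=.
  suff -> : h' (glue r (x, g)) = (x, g) by rewrite eqxx andbT.
  by congr (_, _); [rewrite glue_lshift|apply/ffunP => c; rewrite ffunE glue_rshift].
move=> g /intertwineP gP; apply/ffunP => a.
case: (split_ordP (a : 'I_(r + sumn mu))) => [[b ltb]|c] ->; last first.
  by rewrite glue_rshift ffunE.
rewrite glue_lshift /=; elim: b ltb => [|b IH] ltb /=.
  by congr (g (lshift _ _)); apply/val_inj.
rewrite (IH (ltnW ltb)) -gP; congr (g _).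
by apply: cycles_ord_lshift; rewrite /= (ltn_eqF ltb).
Qed.

Lemma big_intertwine_nil (V : zmodType) (F : {ffun 'I_(sumn [::]) -> X} -> V)
    (g0 : {ffun 'I_(sumn [::]) -> X}) :
  \sum_(g | @intertwine [::] g) F g = F g0.
Proof.
rewrite (big_pred1 g0) // => g; rewrite -[RHS]/(g == g0).
have -> : g = g0 by apply/ffunP => -[].
by rewrite eqxx; apply/intertwineP => -[].
Qed.

(** An intertwiner amounts to a free choice, for each cycle of length s, of a point fixed by t^s; it
    stays in the t-stable set P exactly when the chosen points lie in P. *)
Lemma sum_intertwine_in (P : pred X) (mu : seq nat) :
  (forall x, P (t x) = P x) -> 0%N \notin mu ->
  \sum_(g | @intertwine mu g) ([forall a, P (g a)])%:R =
  \prod_(s <- mu) (\sum_(x | iter s t x == x) (P x)%:R) :> rat.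
Proof.
move=> Pt; elim: mu => [|r mu IH] mu0.
  have g0 : {ffun 'I_(sumn [::]) -> X} by apply: finfun; case.
  rewrite big_nil (big_intertwine_nil _ g0).
  by case: forallP => //; case; case.
move: mu0; rewrite inE negb_or eq_sym => /andP[r0 mu0].
rewrite big_intertwine_cons ?lt0n // big_cons -IH // mulr_suml.
apply: eq_bigr => x _; rewrite mulr_sumr; apply: eq_bigr => g _.
rewrite -natrM mulnb; congr ((nat_of_bool _)%:R).
apply/forallP/andP => [H|[Px /forallP Pg] a].
  split; last by apply/forallP => c; have := H (rshift r c); rewrite glue_rshift.
  have := H (lshift (sumn mu) (Ordinal (etrans (lt0n r) r0))).
  by rewrite glue_lshift.
case: (split_ordP (a : 'I_(r + sumn mu))) => [b|c] ->; last by rewrite glue_rshift Pg.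
by rewrite glue_lshift /=; elim: (b : nat) => //= n; rewrite Pt.
Qed.

Lemma iter_intertwine (mu : seq nat) (g : {ffun 'I_(sumn mu) -> X}) (s : nat) a :
  intertwine g -> g (iter s (@cycles_ord mu) a) = iter s t (g a).
Proof. by move=> /intertwineP gP; elim: s => //= s <-. Qed.

End Intertwiners.

Lemma reshape_index_cons (r : nat) (sh : seq nat) (i : nat) :
  reshape_index (r :: sh) i =
    if (i < r)%N then 0%N else (reshape_index sh (i - r)).+1.
Proof.
by rewrite /reshape_index /= subn_eq0; case: ltnP => // ri; rewrite subSn.
Qed.

Lemma iter_cycles_fun_lt (r s x : nat) (mu : seq nat) : (x < r)%N ->
  iter s (cycles_fun (r :: mu)) x = ((x + s) %% r)%N.
Proof.
move=> xr; elim: s => [|s IH]; first by rewrite addn0 modn_small.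
rewrite iterS IH /= ltn_mod (leq_ltn_trans _ xr) // addnS.
have -> : ((x + s).+1 %% r = ((x + s) %% r).+1 %% r)%N.
  by rewrite -[in LHS]addn1 -modnDml addn1.
have := ltn_pmod (x + s) (leq_ltn_trans (leq0n x) xr).
case: eqP => [->|/eqP ne] lt; first by rewrite modnn.
by rewrite [RHS]modn_small // [(_.+1 < _)%N]ltn_neqAle ne.
Qed.

Lemma iter_cycles_fun_ge (r s y : nat) (mu : seq nat) :
  iter s (cycles_fun (r :: mu)) (r + y) = (r + iter s (cycles_fun mu) y)%N.
Proof.
elim: s => //= s ->; rewrite ltnNge leq_addr addKn.
by [].
Qed.

Lemma val_iter_cycles_ord (mu : seq nat) (s : nat) (a : 'I_(sumn mu)) :
  iter s (@cycles_ord mu) a = iter s (cycles_fun mu) a :> nat.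
Proof. by elim: s => //= s ->. Qed.

(** [reshape_index rho x] is the number of the cycle through x. The s-th power fixes all points of a
    cycle of length r if r divides s, and none otherwise. *)
Lemma sum_fixed_cycles (rho : seq nat) (s : nat) (Q : pred nat) :
  \sum_(x : 'I_(sumn rho) | iter s (@cycles_ord rho) x == x)
     (Q (reshape_index rho x))%:R =
  \sum_(j < size rho | Q j) (nth 0%N rho j * (nth 0%N rho j %| s))%:R :> rat.
Proof.
transitivity (\sum_(x < sumn rho) (((iter s (cycles_fun rho) x == x) &&
    Q (reshape_index rho x)))%:R : rat).
  rewrite big_mkcond; apply: eq_bigr => x _.
  by rewrite -val_eqE /= val_iter_cycles_ord; case: (_ == _).
rewrite [RHS]big_mkcond /=; elim: rho Q => [|r rho IH] Q /=; first by rewrite !big_ord0.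
rewrite big_split_ord big_ord_recl /=; congr (_ + _).
  under eq_bigr => x _.
    rewrite iter_cycles_fun_lt // -{2}(modn_small (ltn_ord x)) -{2}[x : nat]addn0.
    rewrite eqn_modDl mod0n -/(dvdn r s) reshape_index_cons ltn_ord; over.
  rewrite sumr_const card_ord; case: (Q 0%N).
    by rewrite andbT natrM mulr_natl.
  by rewrite andbF mul0rn.
rewrite -(IH (fun j => Q j.+1)); apply: eq_bigr => x _.
rewrite iter_cycles_fun_ge eqn_add2l reshape_index_cons.
by rewrite ltnNge leq_addr /= addKn.
Qed.

Lemma cycles_fun_trans (rho : seq nat) (x y : nat) :
  (x < sumn rho)%N -> (y < sumn rho)%N ->
  reshape_index rho x = reshape_index rho y ->
  exists s, iter s (cycles_fun rho) x = y.
Proof.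
elim: rho x y => // r rho IH x y ltx lty; rewrite !reshape_index_cons.
case: (ltnP x r) (ltnP y r) => [xr|rx] [yr|ry] //.
  (* The walk passes through 0, so x <= y and y < x need not be distinguished: x + (r - x + y) is y
     modulo r. *)
  exists (r - x + y)%N; rewrite iter_cycles_fun_lt // addnA subnKC ?(ltnW xr) //.
  by rewrite modnDl modn_small.
have ltx' : (x - r < sumn rho)%N by rewrite ltn_subLR.
have lty' : (y - r < sumn rho)%N by rewrite ltn_subLR.
case=> /(IH _ _ ltx' lty')[s es].
by exists s; rewrite -{1}(subnKC rx) iter_cycles_fun_ge es subnKC.
Qed.

Lemma reshape_index_cycles_fun (rho : seq nat) (x : nat) :
  reshape_index rho (cycles_fun rho x) = reshape_index rho x.
Proof.
elim: rho x => //= r rho IH x; rewrite !reshape_index_cons.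
case: (ltnP x r) => [xr|rx]; last by rewrite ltnNge leq_addr /= addKn IH.
suff -> : ((if x.+1 == r then 0 else x.+1) < r)%N by [].
by case: (x.+1 =P r) => [<-//|/eqP ne]; rewrite ltn_neqAle ne.
Qed.

Lemma reshape_index_onto (rho : seq nat) (j : nat) : 0%N \notin rho ->
  (j < size rho)%N -> exists x : 'I_(sumn rho), reshape_index rho x = j.
Proof.
move=> rho0 lt.
suff [x ltx e] : exists2 x, (x < sumn rho)%N & reshape_index rho x = j.
  by exists (Ordinal ltx).
elim: rho j rho0 lt => // r rho IH [|j] /=; rewrite inE negb_or eq_sym -lt0n => /andP[r0 rho0] lt.
  by exists 0%N; rewrite ?addn_gt0 ?r0 // reshape_index_cons r0.
have [x ltx e] := IH j rho0 lt.
exists (r + x)%N; first by rewrite ltn_add2l.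
by rewrite reshape_index_cons ltnNge leq_addr /= addKn e.
Qed.

Definition onto (X Y : finType) (g : {ffun X -> Y}) : bool :=
  [forall y, exists x, g x == y].

(** The image of an intertwiner is a union of cycles of rho, so being onto means meeting every
    cycle. Hence the inclusion-exclusion can run over sets of cycles, for which the maps with
    restricted image are counted by a product over mu. *)
Lemma sum_onto_intertwine (rho mu : seq nat) :
  0%N \notin rho -> 0%N \notin mu ->
  \sum_(g | intertwine (@cycles_ord rho) (mu := mu) g) (onto g)%:R = nsurj rho mu.
Proof.
move=> rho0 mu0; pose idx (x : 'I_(sumn rho)) := Ordinal (reshape_indexP (ltn_ord x)).
have ontoE g : intertwine (@cycles_ord rho) (mu := mu) g ->
    onto g = [forall j, exists a, idx (g a) == j].
  move=> gP; apply/forallP/forallP => H => [j|x].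
    have [x ex] := reshape_index_onto rho0 (ltn_ord j).
    have /existsP[a /eqP e] := H x; apply/existsP; exists a.
    by rewrite -val_eqE /= e ex.
  have /existsP[a /eqP /(congr1 val) /= e] := H (idx x).
  have [s es] := cycles_fun_trans (ltn_ord _) (ltn_ord _) e.
  apply/existsP; exists (iter s (@cycles_ord mu) a).
  by rewrite (iter_intertwine _ _ gP) -val_eqE /= val_iter_cycles_ord es.
transitivity (\sum_(g | intertwine (@cycles_ord rho) (mu := mu) g)
    \sum_(A : {set 'I_(size rho)})
      (-1) ^+ #|~: A| * ([forall a, idx (g a) \in A])%:R : rat).
  apply: eq_bigr => g gP; rewrite ontoE //.
  (* The indicator of being onto is a product of factors 1 - [cycle j is missed], which is then
     expanded. *)
  transitivity (\prod_(j < size rho) (1 + - (~~ [exists a, idx (g a) == j])%:R) : rat).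
    case: forallP => [H|/forallP]; first by rewrite big1 // => j _; rewrite H subr0.
    rewrite negb_forall => /existsP[j nj].
    by rewrite (bigD1 j) //= nj subrr mul0r.
  rewrite bigA_distr; apply: eq_bigr => A _.
  rewrite (bigID (mem A)) /= big1 ?mul1r => [|j -> //].
  rewrite (eq_bigr (fun j => - 1 * (~~ [exists a, idx (g a) == j])%:R)); last first.
    by move=> j /negbTE ->; rewrite mulN1r.
  rewrite big_split /= prodr_const -(eq_card (A := ~: A)); last by move=> j; rewrite !inE.
  congr (_ * _); case: forallP => [H|/forallP].
    rewrite big1 // => j jA; suff -> : [exists a, idx (g a) == j] = false by [].
    by apply/existsP => -[a /eqP e]; rewrite -e H in jA.
  rewrite negb_forall => /existsP[a aA]; rewrite (bigD1 (idx (g a))) //=.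
  by have -> : [exists b, idx (g b) == idx (g a)] by [apply/existsP; exists a]; rewrite mul0r.
rewrite exchange_big; apply: eq_bigr => A _; rewrite -mulr_sumr; congr (_ * _).
rewrite (sum_intertwine_in (P := fun x => idx x \in A)) //; last first.
  move=> x; suff -> : idx (cycles_ord x) = idx x by [].
  by apply/val_inj; rewrite /= reshape_index_cycles_fun.
apply: eq_bigr => s _.
pose Q j := if insub j is Some j' then j' \in A else false.
rewrite (eq_bigr (fun x : 'I_(sumn rho) => (Q (reshape_index rho x))%:R)); last first.
  by move=> x _; rewrite /Q (insubT (fun j => (j < size rho)%N) (reshape_indexP (ltn_ord x))).
rewrite sum_fixed_cycles; apply: eq_bigl => j.
by rewrite /Q valK.
Qed.

(** Made total in [nu], so that sums over [parts_of m] can use it without a proof of [sumn nu = m];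
    on these the default is never met. *)
Definition cyc (m : nat) (nu : seq nat) : 'S_m :=
  if sumn nu =P m is ReflectT e then cast_perm e (cycles_perm nu) else 1%g.

Lemma cyc_id (nu : seq nat) : cyc (sumn nu) nu = cycles_perm nu.
Proof. by rewrite /cyc; case: eqP => // e; rewrite cast_perm_id. Qed.

Lemma onto_injectiveb (T : finType) (g : {ffun T -> T}) : onto g = injectiveb g.
Proof.
apply/forallP/injectiveP => [H|inj y].
  suff : {in T &, injective g} by move=> inj x y; apply: inj.
  apply/image_injP/eqP/eq_card => y; rewrite [RHS]inE; apply/imageP.
  by have /existsP[x /eqP <-] := H y; exists x.
by apply/existsP; exists (invF inj y); rewrite f_invF.
Qed.

Lemma big_perm_ffun (T : finType) (V : zmodType) (F : {ffun T -> T} -> V) :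
  \sum_(g : {ffun T -> T} | injectiveb g) F g = \sum_(s : {perm T}) F (val s).
Proof.
rewrite (reindex_onto (fun s : {perm T} => val s) (insubd (1%g : {perm T}))) /=.
  by apply: eq_bigl => s; rewrite (valP s) valKd eqxx.
by move=> g ginj; rewrite insubdK.
Qed.

(** A permutation s conjugating one standard permutation into the other is a bijective intertwiner.
    Between sets of equal size bijective means onto, so [nsurj_low] gives the count. *)
Lemma card_perm_conj (m : nat) (rho mu : seq nat) :
  rho \in parts_of m -> mu \in parts_of m ->
  \sum_(s : 'S_m) (cyc m mu ^ s == cyc m rho)%g%:R = (zee rho)%:R * (rho == mu)%:R :> rat.
Proof.
rewrite !mem_parts_of => /andP[prho /eqP srho] /andP[pmu /eqP smu].
rewrite -(nsurj_low prho pmu) ?srho ?smu //.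
have rho0 : 0%N \notin rho by case/andP: prho.
have mu0 : 0%N \notin mu by case/andP: pmu.
rewrite -sum_onto_intertwine //; subst m.
have aux n (e : sumn rho = n) :
    \sum_(g | intertwine (@cycles_ord rho) (mu := mu) g) (onto g)%:R =
    \sum_(g | intertwine (cyc n rho) (mu := mu) g) (onto g)%:R :> rat.
  subst n; apply: eq_big => // g; apply: eq_forallb => a.
  by rewrite cyc_id permE.
rewrite (aux (sumn mu) (esym smu)) -smu cyc_id; set t := cyc _ rho.
under [RHS]eq_bigr => g _ do rewrite onto_injectiveb.
rewrite [RHS]big_mkcond /= [RHS](bigID (fun g : {ffun _ -> _} => injectiveb g)) /=.
rewrite [X in _ = _ + X]big1 ?addr0; last first.
  by move=> g ninj; rewrite (negbTE ninj) if_same.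
rewrite big_perm_ffun; apply: eq_bigr => s _.
rewrite (valP s) /=; case: intertwineP => [H|H].
  suff -> : (cycles_perm mu ^ s)%g = t by rewrite eqxx.
  apply: (mulgI s); rewrite conjgE mulKVg; apply/permP => a; rewrite !permM.
  by have := H a; rewrite permE -!pvalE.
case: eqP => // e; case: H => a.
have : (s * (cycles_perm mu ^ s) = s * t)%g by rewrite e.
rewrite conjgE mulKVg => /permP/(_ a); rewrite !permM permE.
by rewrite -!pvalE.
Qed.

(** The weight [c t] is 1 if t is conjugate to some [cyc m nu] and 0 otherwise, by the centralizer
    orders. The weights add up to m! because the numbers 1/z_nu add up to 1 ([avg_one]), so [c] is 1
    everywhere and every t is conjugate to a standard permutation. *)
Lemma sum_perm_class (m : nat) (F : 'S_m -> rat) :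
  (forall s t : 'S_m, F (t ^ s)%g = F t) ->
  \sum_t F t = (m`!)%:R * \sum_(nu <- parts_of m) (zee nu)%:R^-1 * F (cyc m nu).
Proof.
move=> Fcl.
pose c (t : 'S_m) : rat :=
  \sum_(nu <- parts_of m) (zee nu)%:R^-1 * \sum_(s : 'S_m) (cyc m nu ^ s == t)%g%:R.
have sumc (G : 'S_m -> rat) : \sum_t G t * c t =
    \sum_(nu <- parts_of m) (zee nu)%:R^-1 * \sum_(s : 'S_m) G (cyc m nu ^ s)%g.
  under eq_bigr => t _ do rewrite mulr_sumr.
  rewrite exchange_big /=; apply: eq_bigr => nu _.
  under eq_bigr => t _ do rewrite mulrCA mulr_sumr.
  rewrite -mulr_sumr; congr (_ * _); rewrite exchange_big /=; apply: eq_bigr => s _.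
  rewrite (bigD1 (cyc m nu ^ s)%g) //= eqxx mulr1 big1 ?addr0 // => t /negbTE ne.
  by rewrite eq_sym ne mulr0.
have card_S : \sum_(s : 'S_m) (1 : rat) = (m`!)%:R.
  by rewrite sumr_const card_Sn.
have c_le1 t : c t = 0 \/ c t = 1.
  case: (boolP [exists nu : seq_sub (parts_of m), [exists s : 'S_m, cyc m (val nu) ^ s == t]%g]).
    case/existsP => nu0 /existsP[s0 /eqP <-]; right.
    rewrite /c (bigD1_seq (val nu0)) ?(valP nu0) ?parts_of_uniq //=.
    have cnt nu : nu \in parts_of m -> \sum_(s : 'S_m) (cyc m nu ^ s == cyc m (val nu0) ^ s0)%g%:R =
        (zee (val nu0))%:R * (val nu0 == nu)%:R :> rat.
      move=> pnu; rewrite -(card_perm_conj (valP nu0) pnu).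
      rewrite (reindex_inj (mulIg s0)) /=; apply: eq_bigr => s _.
      by rewrite conjgM (inj_eq (conjg_inj s0)).
    rewrite cnt ?(valP nu0) // eqxx mulr1 mulVf; last first.
      by rewrite pnatr_eq0 -lt0n zee_gt0 // (parts_of_pos (valP nu0)).
    rewrite big_seq_cond big1 ?addr0 // => nu /andP[pnu ne].
    by rewrite cnt // eq_sym (negbTE ne) !mulr0.
  rewrite negb_exists => /forallP H; left.
  rewrite /c big_seq big1 // => nu pnu; rewrite big1 ?mulr0 // => s _.
  have := H (SeqSub pnu); rewrite negb_exists => /forallP/(_ s) /= /negbTE ->.
  by [].
have c1 t : c t = 1.
  have : \sum_t (1 - c t) = 0.
    have := sumc (fun=> 1); under eq_bigr => s _ do rewrite mul1r.
    rewrite sumrB card_S => ->; rewrite -mulr_suml.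
    have -> : \sum_(nu <- parts_of m) (zee nu)%:R^-1 = 1 :> rat.
      by rewrite -[RHS](avg_one m) /avg; apply: eq_bigr => nu _; rewrite [RHS]mulr1.
    by rewrite mul1r subrr.
  move/eqP; rewrite psumr_eq0; last by move=> s _; case: (c_le1 s) => ->; rewrite ?subrr ?subr0.
  by move/allP/(_ t (mem_index_enum t)) => /=; rewrite subr_eq0 => /eqP.
transitivity (\sum_t F t * c t); first by apply: eq_bigr => t _; rewrite c1 mulr1.
rewrite sumc mulr_sumr; apply: eq_bigr => nu _; rewrite mulrCA; congr (_ * _).
rewrite (eq_bigr (fun=> F (cyc m nu))); last by move=> s _; rewrite Fcl.
by rewrite -card_S mulr_suml; apply: eq_bigr => s _; rewrite mul1r.
Qed.

(** * Words of given content *)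

Definition has_content (D : finType) (n : nat) (al : seq nat) (g : {ffun D -> 'I_n}) : bool :=
  [forall i : 'I_n, #|[set a | g a == i]| == nth 0%N al i].

Section Words.
Variables (A : comAlgType rat) (p : nat -> A).
Variables (theta : {rmorphism A -> {poly A}}) (eps : {rmorphism A -> rat}).
Hypothesis thetaZ : forall c f, theta (c *: f) = (c%:A)%:P * theta f.
Hypothesis epsZ : forall c f, eps (c *: f) = c * eps f.
Hypothesis theta_p : forall r, (0 < r)%N -> theta (p r) = (p r)%:P + 'X^r.
Hypothesis eps_p : forall r, (0 < r)%N -> eps (p r) = 0.

Lemma hcoef1 (al : seq nat) :
  hcoef theta eps al 1 = [forall i : 'I_(size al), nth 0%N al i == 0%N]%:R.
Proof.
elim: al => [|a al IH] /=; first by rewrite rmorph1; case: forallP => // -[] [].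
rewrite skew1; case: (posnP a) => [->|a0].
  rewrite -[true%:R]/(1 : A) IH; congr ((nat_of_bool _)%:R); apply/forallP/forallP => H.
    by case=> -[|i] lt //=; apply: (H (Ordinal (lt : (i < size al)%N))).
  by move=> i; apply: (H (lift ord0 i)).
rewrite -[false%:R]/(0 : A) (hcoef0 thetaZ epsZ).
suff -> : [forall i : 'I_((size al).+1), nth 0%N (a :: al) i == 0%N] = false by [].
by apply/negP => /forallP/(_ ord0) /= /eqP e; rewrite e in a0.
Qed.

Lemma card_content_glue (n r : nat) (mu : seq nat) (x i : 'I_n)
    (g : {ffun 'I_(sumn mu) -> 'I_n}) :
  #|[set a | glue id r (x, g) a == i]| =
  (r * (x == i) + #|[set a | g a == i]|)%N.
Proof.
rewrite -!sum1dep_card /= big_mkcond /= big_split_ord /=; congr (_ + _)%N.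
  under eq_bigr => b _.
    rewrite glue_lshift (_ : iter b id x = x); last by elim: (b : nat).
    over.
  by rewrite sum_nat_const card_ord; case: eqP.
by rewrite [RHS]big_mkcond /=; apply: eq_bigr => c _; rewrite glue_rshift.
Qed.

(** A word constant on the cycles gives r equal letters i to a cycle of length r, hence the monomial
    x_i^r; removing one cycle is the recursion [hcoef_pM]. *)
Lemma hword_words (n : nat) (al mu : seq nat) : size al = n -> 0%N \notin mu ->
  hword p theta eps al mu =
  \sum_(g : {ffun 'I_(sumn mu) -> 'I_n} | intertwine id (mu := mu) g)
     (has_content al g)%:R.
Proof.
elim: mu al => [|r mu IH] al sal.
  have g0 : {ffun 'I_(sumn [::]) -> 'I_n} by apply: finfun; case.
  move=> _; rewrite (big_intertwine_nil _ _ g0) /hword pprod_nil hcoef1.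
  congr ((nat_of_bool _)%:R); subst n; apply: eq_forallb => i.
  rewrite eq_sym; congr (_ == _); symmetry; apply: eq_card0 => -[].
  by [].
rewrite inE negb_or eq_sym -lt0n => /andP[r0 mu0].
rewrite big_intertwine_cons // /hword pprod_cons (hcoef_pM thetaZ theta_p epsZ eps_p) //.
rewrite -(big_mkord xpredT (fun i => if (r <= nth 0%N al i)%N
   then hcoef theta eps (lower al i r) (pprod p mu) else 0)) sal big_mkord.
apply: eq_big => [x|x _]; first by elim: r {IH r0 mu0} => [|r IHr]; rewrite ?eqxx /= ?IHr.
case: ifP => le; last first.
  rewrite big1 // => g _; suff -> : has_content al (glue id r (x, g)) = false by [].
  apply/negP => /forallP/(_ x) /eqP.
  by rewrite card_content_glue eqxx muln1 => e; rewrite -e leq_addr in le.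
rewrite -[LHS]/(hword p theta eps _ _) IH ?size_lower ?sal //.
apply: eq_bigr => g _; congr ((nat_of_bool _)%:R); apply: eq_forallb => i.
rewrite card_content_glue nth_set_nth /= [(i == x :> nat)]val_eqE [x == i]eq_sym.
case: (eqVneq i x) => [->|ne]; last by rewrite muln0.
by rewrite muln1 -(eqn_add2l r) subnKC.
Qed.

End Words.

(** * Group algebras and Young symmetrizers *)

(** An alias that inherits only the module structure of functions, so that its product can be
    convolution. *)
Definition galg (gT : finGroupType) := {ffun gT -> rat^o}.

HB.instance Definition _ (gT : finGroupType) := GRing.Lmodule.on (galg gT).

Section GroupAlgebra.
Variable gT : finGroupType.
Implicit Types (x y z : galg gT) (g h : gT).

Definition gdelta h : galg gT := [ffun g => (g == h)%:R].

Definition gmul x y : galg gT := [ffun g => \sum_h x h * y (h^-1 * g)%g].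

Fact gmulA : associative gmul.
Proof.
move=> x y z; apply/ffunP => g; rewrite !ffunE.
under eq_bigr => h _ do rewrite ffunE mulr_sumr.
under [RHS]eq_bigr => h _ do rewrite ffunE mulr_suml.
rewrite [RHS]exchange_big /=; apply: eq_bigr => k _.
rewrite [RHS](reindex_inj (mulgI k)) /=; apply: eq_bigr => h _.
by rewrite mulKg invMg !mulgA mulrA.
Qed.

Fact gmul1x : left_id (gdelta 1) gmul.
Proof.
move=> x; apply/ffunP => g; rewrite ffunE (bigD1 1%g) //= ffunE eqxx mul1r invg1 mul1g.
by rewrite big1 ?addr0 // => h /negbTE ne; rewrite ffunE ne mul0r.
Qed.

Fact gmulx1 : right_id (gdelta 1) gmul.
Proof.
move=> x; apply/ffunP => g; rewrite ffunE (bigD1 g) //= ffunE mulVg eqxx mulr1.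
rewrite big1 ?addr0 // => h ne; rewrite ffunE.
by rewrite -eq_mulVg1 (negbTE ne) mulr0.
Qed.

Fact gmulDl : left_distributive gmul +%R.
Proof.
move=> x y z; apply/ffunP => g; rewrite !ffunE -big_split /=.
by apply: eq_bigr => h _; rewrite ffunE mulrDl.
Qed.

Fact gmulDr : right_distributive gmul +%R.
Proof.
move=> x y z; apply/ffunP => g; rewrite !ffunE -big_split /=.
by apply: eq_bigr => h _; rewrite ffunE mulrDr.
Qed.

Fact gone_neq0 : gdelta 1 != 0.
Proof. by apply/eqP => /ffunP/(_ 1%g); rewrite !ffunE eqxx. Qed.

HB.instance Definition _ := GRing.Zmodule_isNzRing.Build (galg gT)
  gmulA gmul1x gmulx1 gmulDl gmulDr gone_neq0.

Lemma gmulE x y g : (x * y) g = \sum_h x h * y (h^-1 * g)%g.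
Proof. by rewrite ffunE. Qed.

Lemma gscaleE (c : rat) x g : (c *: x) g = c * x g.
Proof. by rewrite ffunE. Qed.

Lemma gscaleAl (c : rat) x y : c *: (x * y) = (c *: x) * y.
Proof.
apply/ffunP => g; rewrite gscaleE !gmulE mulr_sumr.
by apply: eq_bigr => h _; rewrite gscaleE mulrA.
Qed.

Lemma gscaleAr (c : rat) x y : c *: (x * y) = x * (c *: y).
Proof.
apply/ffunP => g; rewrite gscaleE !gmulE mulr_sumr.
by apply: eq_bigr => h _; rewrite gscaleE mulrCA.
Qed.

Lemma gdeltaE h g : gdelta h g = (g == h)%:R.
Proof. by rewrite ffunE. Qed.

Lemma gmulx_delta x h g : (x * gdelta h) g = x (g * h^-1)%g.
Proof.
rewrite gmulE (bigD1 (g * h^-1)%g) //= gdeltaE invMg invgK mulgKV eqxx mulr1.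
rewrite big1 ?addr0 // => k ne; rewrite gdeltaE.
suff -> : (k^-1 * g == h)%g = false by rewrite mulr0.
by apply/negbTE; apply: contra ne => /eqP <-; rewrite invMg invgK mulKVg.
Qed.

Lemma gmul_deltax x h g : (gdelta h * x) g = x (h^-1 * g)%g.
Proof.
rewrite gmulE (bigD1 h) //= gdeltaE eqxx mul1r big1 ?addr0 // => k /negbTE ne.
by rewrite gdeltaE ne mul0r.
Qed.

Lemma gdeltaM h k : gdelta h * gdelta k = gdelta (h * k)%g.
Proof.
apply/ffunP => g; rewrite gmulx_delta !gdeltaE; congr (nat_of_bool _)%:R.
by rewrite eq_sym -(can2_eq (mulgK k) (mulgKV k)) eq_sym.
Qed.

Lemma gdelta_sum x : x = \sum_h x h *: gdelta h.
Proof.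
apply/ffunP => g; rewrite sum_ffunE (bigD1 g) //= gscaleE gdeltaE eqxx mulr1.
rewrite big1 ?addr0 // => h ne; rewrite gscaleE gdeltaE eq_sym.
by rewrite (negbTE ne) mulr0.
Qed.

(** Up to the factor |G|, the trace of x in the regular representation. *)
Definition gtrace x : rat := x 1%g.

Lemma gtraceM x y : gtrace (x * y) = \sum_h x h * y h^-1%g.
Proof. by rewrite /gtrace gmulE; apply: eq_bigr => h _; rewrite mulg1. Qed.

Lemma gtraceC x y : gtrace (x * y) = gtrace (y * x).
Proof.
rewrite !gtraceM (reindex_inj invg_inj) /=.
by apply: eq_bigr => h _; rewrite invgK mulrC.
Qed.

Lemma gtraceZ (c : rat) x : gtrace (c *: x) = c * gtrace x.
Proof. exact: gscaleE. Qed.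

Definition gstar x : galg gT := [ffun g => x g^-1%g].

Lemma gstarM x y : gstar (x * y) = gstar y * gstar x.
Proof.
apply/ffunP => g; rewrite ffunE !gmulE.
rewrite (reindex_inj (mulgI g^-1%g)) /=.
by apply: eq_bigr => h _; rewrite !ffunE !invMg !invgK mulgK mulrC.
Qed.

(** The trace is the sum of the squares of the coefficients. This positivity does the work of
    semisimplicity in [hook_product_neq0]. *)
Lemma gstar_pos x : gtrace (x * gstar x) = 0 -> x = 0.
Proof.
rewrite gtraceM => /eqP; rewrite psumr_eq0 => [/allP H|h _].
  apply/ffunP => g; have := H g (mem_index_enum g).
  by rewrite /= !ffunE invgK mulf_eq0 orbb => /eqP.
by rewrite ffunE invgK -expr2 sqr_ge0.
Qed.

Lemma sum_conj_mulC x y (t : gT) :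
  \sum_s (x * y) (s * t * s^-1)%g = \sum_s (y * x) (s * t * s^-1)%g.
Proof.
under eq_bigr => s _ do rewrite gmulE.
under [RHS]eq_bigr => s _ do rewrite gmulE.
rewrite exchange_big /=.
transitivity (\sum_h \sum_s x h * y (s * t * s^-1 * h^-1)%g).
  apply: eq_bigr => h _; rewrite (reindex_inj (mulgI h)) /=.
  by apply: eq_bigr => s _; rewrite invMg !mulgA mulVg mul1g.
rewrite exchange_big /=; apply: eq_bigr => s _.
set u := (s * t * s^-1)%g.
rewrite (reindex_inj (mulIg u)) (reindex_inj invg_inj) /=.
by apply: eq_bigr => h _; rewrite invMg invgK mulKVg mulrC.
Qed.

End GroupAlgebra.

Lemma card_set_sum (T : finType) (P : pred T) : #|[set i | P i]| = (\sum_i P i)%N.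
Proof. by rewrite -sum1dep_card big_mkcond; apply: eq_bigr => i _; case: (P i). Qed.

(** * Row and column stabilizers of tableaux *)

Section Tableaux.
Variable m : nat.
Implicit Types (al la : seq nat) (y : 'S_m).

Lemma card_cells la (r c : nat) : sumn la = m ->
  #|[set i : 'I_m | (reshape_index la i == r) && (reshape_offset la i < c)%N]| =
  minn (nth 0%N la r) c.
Proof.
move=> sla.
have lt (d : 'I_(minn (nth 0%N la r) c)) : (flatten_index la r d < m)%N.
  by rewrite -sla flatten_indexP // (leq_trans (ltn_ord d)) // geq_minl.
rewrite -[RHS]card_ord -cardsT -(card_imset (f := fun d => Ordinal (lt d))); last first.
  by move=> d d' [/addnI/val_inj].
apply: eq_card => i; rewrite inE; apply/andP/imsetP => [[/eqP er ltc]|[d _ ->]].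
  have lti : (i < sumn la)%N by rewrite sla.
  have ltd : (reshape_offset la i < minn (nth 0%N la r) c)%N.
    by rewrite leq_min ltc andbT -er reshape_offsetP.
  by exists (Ordinal ltd) => //; apply/val_inj; rewrite /= -er reshape_indexK.
have := ltn_ord d; rewrite leq_min => /andP[ltr ltc].
by rewrite /= flatten_indexKl // flatten_indexKr.
Qed.

Lemma card_row al (r : nat) : sumn al = m ->
  #|[set i : 'I_m | reshape_index al i == r]| = nth 0%N al r.
Proof.
move=> sal; rewrite -[RHS]minnn -card_cells //; apply: eq_card => i; rewrite !inE.
case: eqP => //= <-; rewrite reshape_offsetP // sal //.
Qed.

(** The condition of von Neumann's lemma: two entries share a row of one tableau and a column of the
    other, y being the relabelling between them. *)
Definition clash al la y : bool :=
  [exists i : 'I_m, exists j : 'I_m, [&& i != j, reshape_index al i == reshape_index al j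
                         & reshape_offset la (y i) == reshape_offset la (y j)]].

Lemma no_clash al la y (i j : 'I_m) : ~~ clash al la y ->
  reshape_index al i = reshape_index al j ->
  reshape_offset la (y i) = reshape_offset la (y j) -> i = j.
Proof.
move=> nc er eo; apply/eqP; apply: contraNT nc => ne.
by apply/existsP; exists i; apply/existsP; exists j; rewrite ne er eo !eqxx.
Qed.

Lemma card_row_cols al la y (r c : nat) : sumn al = m -> ~~ clash al la y ->
  (#|[set i : 'I_m | (reshape_index al i == r) && (reshape_offset la (y i) < c)%N]|
   <= minn (nth 0%N al r) c)%N.
Proof.
move=> sal nc; rewrite leq_min -{1}(card_row r sal); apply/andP; split.
  by apply: subset_leq_card; apply/subsetP => i; rewrite !inE => /andP[].
case: c => [|c].
  by rewrite leqn0 cards_eq0; apply/eqP/setP => i; rewrite !inE andbF.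
rewrite -[leqRHS]card_ord -(card_in_imset (f := fun i => inord (reshape_offset la (y i)) : 'I_c.+1)).
  exact: max_card.
move=> i j; rewrite !inE => /andP[/eqP ri ci] /andP[/eqP rj cj] /(congr1 val).
by rewrite /= !inordK // => /(no_clash nc); apply; rewrite ri rj.
Qed.

Lemma sum_card_rows al (P : pred 'I_m) (N : nat) : sumn al = m -> (size al <= N)%N ->
  (\sum_(r < N) #|[set i : 'I_m | (reshape_index al i == r) && P i]| =
   #|[set i | P i]|)%N.
Proof.
move=> sal sN; under eq_bigr => r _ do rewrite card_set_sum.
rewrite exchange_big card_set_sum /=; apply: eq_bigr => i _.
have lt : (reshape_index al i < N)%N.
  by apply: leq_trans sN; apply: reshape_indexP; rewrite sal.
rewrite (bigD1 (Ordinal lt)) //= eqxx big1 ?addn0 // => r ne.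
by rewrite eq_sym (_ : (r == _ :> nat) = false) //; apply/negbTE.
Qed.

(** The left sum counts the cells in the first c columns of la. All of them are images under y, and
    without a clash row r of al supplies at most min(al_r, c). This is dominance read through
    columns, a form in which al need not be sorted. *)
Lemma no_clash_sum al la y (c N : nat) : sumn al = m -> sumn la = m ->
  (size al <= N)%N -> (size la <= N)%N -> ~~ clash al la y ->
  (\sum_(r < N) minn (nth 0 la r) c <= \sum_(r < N) minn (nth 0 al r) c)%N.
Proof.
move=> sal sla Na Nl nc.
under eq_bigr => r _ do rewrite -card_cells //.
rewrite (sum_card_rows (fun i => reshape_offset la i < c)%N) // card_set_sum.
rewrite (reindex_inj (@perm_inj _ y)) -card_set_sum /=.
rewrite -(sum_card_rows (al := al) _ sal Na).
by apply: leq_sum => r _; apply: card_row_cols.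
Qed.

(** Take c = la_s at the first difference s. Beyond column c, la has cells only in rows before s,
    where al agrees with it, while al also has some in row s. Both have m cells, so al has fewer in
    the first c columns, against [no_clash_sum]. *)
Lemma clash_lex al la y : sumn al = m -> sumn la = m -> sorted geq la ->
  lex_gt al la -> clash al la y.
Proof.
move=> sal sla so [s es gs]; case: (boolP (clash al la y)) => // nc; exfalso.
pose N := (size al + size la)%N.
have sumN (x : seq nat) : (size x <= N)%N -> sumn x = m -> (\sum_(r < N) nth 0 x r = m)%N.
  move=> xN <-; rewrite sumnE (big_nth 0%N) big_mkord (big_ord_widen N (nth 0%N x) xN).
  rewrite [RHS]big_mkcond; apply: eq_bigr => r _.
  by case: ltnP => // le; rewrite nth_default.
have Na : (size al <= N)%N by apply: leq_addr.
have Nl : (size la <= N)%N by apply: leq_addl.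
have sN : (s < N)%N.
  apply: leq_trans Na; rewrite ltnNge; apply/negP => le.
  by rewrite (nth_default _ le) in gs.
have := no_clash_sum (nth 0%N la s) sal sla Na Nl nc.
set c := nth 0%N la s in gs *.
have split_min (x : seq nat) : (size x <= N)%N -> sumn x = m ->
    (\sum_(r < N) minn (nth 0 x r) c + \sum_(r < N) (nth 0 x r - c) = m)%N.
  move=> xN sx; rewrite -big_split /= -(sumN x xN sx); apply: eq_bigr => r _.
  by rewrite minnE subnK // leq_subr.
have e1 := split_min al Na sal; have e2 := split_min la Nl sla.
have lt : (\sum_(r < N) (nth 0 la r - c) < \sum_(r < N) (nth 0 al r - c))%N.
  rewrite (bigD1 (Ordinal sN)) // [ltnRHS](bigD1 (Ordinal sN)) //=.
  apply: (@leq_ltn_trans (0 + \sum_(r < N | r != Ordinal sN) (nth 0 al r - c))%N).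
    rewrite /c subnn leq_add2l; apply: leq_sum => r ne.
    case: (ltnP r s) => [rs|sr]; first by rewrite es.
    suff -> : (nth 0 la r - nth 0 la s = 0)%N by [].
    apply/eqP; rewrite subn_eq0.
    case: (ltnP r (size la)) => [rl|rl]; last by rewrite nth_default.
    have := sorted_leq_nth (rev_trans leq_trans) leqnn 0%N so.
    by apply; rewrite ?inE // (leq_ltn_trans sr).
  by rewrite ltn_add2r subn_gt0.
lia.
Qed.

(** For equal shapes the inequalities of [card_row_cols] are equalities, so y sends row r into the
    first la_r columns. Moving each i inside its row to the column of y(i) is then a permutation p,
    and y differs from p by a column permutation. *)
Lemma no_clash_stab la y : sumn la = m -> ~~ clash la la y ->
  exists p q : 'S_m, [/\ row_stab la p, col_stab la q & y = (p * q)%g].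
Proof.
move=> sla nc.
have colb (i : 'I_m) : (reshape_offset la (y i) < nth 0 la (reshape_index la i))%N.
  set r := reshape_index la i; set c := nth 0%N la r.
  have sz : (size la <= size la)%N by [].
  have rl : (r < size la)%N by apply: reshape_indexP; rewrite sla.
  have eqsum : (\sum_(r' < size la) #|[set i : 'I_m | (reshape_index la i == r') &&
        (reshape_offset la (y i) < c)]| = \sum_(r' < size la) minn (nth 0 la r') c)%N.
    rewrite (sum_card_rows (fun i => reshape_offset la (y i) < c)%N) //.
    under [RHS]eq_bigr => r' _ do rewrite -card_cells //.
    rewrite (sum_card_rows (fun i => reshape_offset la i < c)%N) // !card_set_sum.
    by rewrite [RHS](reindex_inj (@perm_inj _ y)).
  have le r' : (#|[set i : 'I_m | (reshape_index la i == r') &&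
        (reshape_offset la (y i) < c)]| <= minn (nth 0 la r') c)%N.
    exact: card_row_cols.
  have eqr : #|[set i : 'I_m | (reshape_index la i == r) &&
        (reshape_offset la (y i) < c)%N]| = c.
    apply/eqP; rewrite eqn_leq -{2}[c]minnn le /=.
    move: eqsum; rewrite (bigD1 (Ordinal rl)) //= [RHS](bigD1 (Ordinal rl)) //= -/c minnn => e.
    rewrite -(leq_add2r (\sum_(r' < size la | r' != Ordinal rl) minn (nth 0 la r') c)%N).
    by rewrite -e leq_add2l; apply: leq_sum.
  have /setP/(_ i) : [set i : 'I_m | (reshape_index la i == r) &&
        (reshape_offset la (y i) < c)%N] = [set i : 'I_m | reshape_index la i == r].
    apply/eqP; rewrite eqEcard eqr card_row // leqnn andbT.
    by apply/subsetP => j; rewrite !inE => /andP[].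
  by rewrite !inE eqxx.
have ltf (i : 'I_m) : (flatten_index la (reshape_index la i) (reshape_offset la (y i)) < m)%N.
  by apply: leq_trans (flatten_indexP (colb i)) _; rewrite sla.
pose f i := Ordinal (ltf i).
have fr i : reshape_index la (f i) = reshape_index la i by rewrite /= flatten_indexKl.
have fc i : reshape_offset la (f i) = reshape_offset la (y i) by rewrite /= flatten_indexKr.
have finj : injective f.
  by move=> i j e; apply: (no_clash nc); [rewrite -fr e fr|rewrite -fc e fc].
pose p := perm finj.
exists p, (p^-1 * y)%g; split; last by rewrite mulKVg.
  by apply/forallP => i; rewrite permE fr.
by apply/forallP => i; rewrite permM -fc -(permE finj) permKV.
Qed.

Lemma row_col_inj la (i j : 'I_m) : reshape_index la i = reshape_index la j ->
  reshape_offset la i = reshape_offset la j -> i = j.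
Proof.
by move=> er eo; apply/val_inj; rewrite /= -(reshape_indexK la i) er eo reshape_indexK.
Qed.

Definition grow al : galg 'S_m := [ffun s => (row_stab al s)%:R].
Definition gcol la : galg 'S_m :=
  [ffun s : 'S_m => if col_stab la s then (-1) ^+ odd_perm s else 0].

Lemma row_stabP al (s : 'S_m) :
  reflect (forall i, reshape_index al (s i) = reshape_index al i) (row_stab al s).
Proof. exact: 'forall_eqP. Qed.

Lemma col_stabP la (s : 'S_m) :
  reflect (forall i, reshape_offset la (s i) = reshape_offset la i) (col_stab la s).
Proof. exact: 'forall_eqP. Qed.

Lemma row_stabM al (p s : 'S_m) : row_stab al p -> row_stab al (p * s)%g = row_stab al s.
Proof.
move=> /row_stabP pP; apply/row_stabP/row_stabP => H i.
  by have := H (p^-1 i)%g; rewrite permM permKV => ->; rewrite -{2}(permKV p i) pP.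
by rewrite permM H pP.
Qed.

Lemma row_stabV al (s : 'S_m) : row_stab al s^-1%g = row_stab al s.
Proof.
apply/row_stabP/row_stabP => H i; first by rewrite -{2}(permK s i) H.
by rewrite -{2}(permKV s i) H.
Qed.

Lemma col_stabM la (q s : 'S_m) : col_stab la q -> col_stab la (q * s)%g = col_stab la s.
Proof.
move=> /col_stabP qP; apply/col_stabP/col_stabP => H i.
  by have := H (q^-1 i)%g; rewrite permM permKV => ->; rewrite -{2}(permKV q i) qP.
by rewrite permM H qP.
Qed.

Lemma col_stabV la (s : 'S_m) : col_stab la s^-1%g = col_stab la s.
Proof.
apply/col_stabP/col_stabP => H i; first by rewrite -{2}(permK s i) H.
by rewrite -{2}(permKV s i) H.
Qed.

Lemma grow_star al : gstar (grow al) = grow al.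
Proof. by apply/ffunP => s; rewrite !ffunE row_stabV. Qed.

Lemma gcol_star la : gstar (gcol la) = gcol la.
Proof. by apply/ffunP => s; rewrite !ffunE col_stabV odd_permV. Qed.

Lemma gdelta_grow al (p : 'S_m) : row_stab al p -> gdelta p * grow al = grow al.
Proof.
move=> pP; apply/ffunP => s; rewrite gmul_deltax !ffunE.
by rewrite row_stabM // row_stabV.
Qed.

Lemma gcol_gdelta la (q : 'S_m) : col_stab la q ->
  gcol la * gdelta q = (-1) ^+ odd_perm q *: gcol la.
Proof.
move=> qP; apply/ffunP => s; rewrite gmulx_delta gscaleE !ffunE.
rewrite -col_stabV invMg invgK col_stabM // col_stabV odd_permM odd_permV.
by case: ifP; rewrite ?mulr0 // signr_addb mulrC.
Qed.

Lemma grow_sq al : grow al * grow al = (#|[set s : 'S_m | row_stab al s]|)%:R *: grow al.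
Proof.
rewrite {1}[grow al]gdelta_sum mulr_suml card_set_sum natr_sum scaler_suml.
apply: eq_bigr => s _; rewrite -gscaleAl ffunE.
by case: (boolP (row_stab al s)) => sP; rewrite ?scale0r // gdelta_grow.
Qed.

Lemma gcol_sq la : gcol la * gcol la = (#|[set s : 'S_m | col_stab la s]|)%:R *: gcol la.
Proof.
rewrite {2}[gcol la]gdelta_sum mulr_sumr card_set_sum natr_sum scaler_suml.
apply: eq_bigr => s _; rewrite -gscaleAr ffunE.
case: (boolP (col_stab la s)) => sP; rewrite ?scale0r // gcol_gdelta //.
by rewrite scalerA -expr2 sqrr_sign.
Qed.

(** The transposition of the clashing entries is absorbed by the row sum; carried across x it
    becomes an odd element of the column stabilizer. So the product equals its own negative. *)
Lemma gcol_clash al la (x : 'S_m) : clash al la x^-1 -> gcol la * gdelta x * grow al = 0.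
Proof.
case/existsP => i /existsP[j /and3P[ne /eqP er /eqP eo]].
have tP : row_stab al (tperm i j).
  by apply/row_stabP => k; case: tpermP => [->|->|].
have tQ : col_stab la (tperm i j ^ x^-1)%g.
  by rewrite tpermJ; apply/col_stabP => k; case: tpermP => [->|->|].
have odd1 : odd_perm (tperm i j ^ x^-1)%g by rewrite odd_permJ odd_tperm ne.
have e : gcol la * gdelta x * grow al = - (gcol la * gdelta x * grow al).
  rewrite -{1}(gdelta_grow tP) mulrA -[gcol la * _ * _]mulrA gdeltaM.
  have -> : (x * tperm i j = tperm i j ^ x^-1 * x)%g by rewrite conjgE invgK -!mulgA mulVg mulg1.
  rewrite -(gdeltaM (tperm i j ^ x^-1)%g x) mulrA (gcol_gdelta tQ) odd1 expr1 scaleN1r.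
  by rewrite !mulNr.
apply/ffunP => s; have /ffunP/(_ s) := e; rewrite !ffunE.
by move/eqP; rewrite -addr_eq0 -mulr2n mulrn_eq0 /= => /eqP.
Qed.

Definition gyoung la : galg 'S_m := gcol la * grow la.

Lemma gyoung1 la : gtrace (gyoung la) = 1.
Proof.
rewrite gtraceM (bigD1 1%g) //= big1 ?addr0 => [|s ne].
  have -> : grow la 1^-1%g = 1.
    by rewrite ffunE; case: row_stabP => // -[] i; rewrite invg1 perm1.
  rewrite ffunE odd_perm1 expr0 mulr1; case: col_stabP => // -[] i.
  by rewrite perm1.
rewrite !ffunE row_stabV; case: col_stabP => [cP|]; last by rewrite mul0r.
case: row_stabP => [rP|]; last by rewrite mulr0.
case/eqP: ne; apply/permP => i; rewrite perm1.
exact: row_col_inj (rP i) (cP i).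
Qed.

(** For a basis element s, a clash of s^-1 gives 0; otherwise s is a column permutation times a row
    permutation, both absorbed up to sign. The scalar is read at the identity, where the Young
    symmetrizer has coefficient 1. *)
Lemma gcol_mid la (x : galg 'S_m) : sumn la = m ->
  gcol la * x * grow la = gtrace (gcol la * x * grow la) *: gyoung la.
Proof.
move=> sla.
have mid1 s : gcol la * gdelta s * grow la =
    gtrace (gcol la * gdelta s * grow la) *: gyoung la.
  suff [k ->] : exists k, gcol la * gdelta s * grow la = k *: gyoung la.
    by rewrite gtraceZ gyoung1 mulr1.
  case: (boolP (clash la la s^-1)) => [cl|nc].
    by exists 0; rewrite gcol_clash // scale0r.
  have [p [q [pP qP e]]] := no_clash_stab sla nc.
  exists ((-1) ^+ odd_perm q^-1%g).
  have -> : s = (q^-1 * p^-1)%g by rewrite -invMg -e invgK.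
  rewrite -gdeltaM mulrA gcol_gdelta ?col_stabV // -mulrA gdelta_grow ?row_stabV //.
  by rewrite -gscaleAl.
rewrite {1 2}[x]gdelta_sum mulr_sumr mulr_suml.
have -> : gtrace (\sum_s gcol la * (x s *: gdelta s) * grow la) =
    \sum_s x s * gtrace (gcol la * gdelta s * grow la).
  rewrite /gtrace sum_ffunE; apply: eq_bigr => s _.
  by rewrite -gscaleAr -gscaleAl gscaleE.
rewrite scaler_suml; apply: eq_bigr => s _.
by rewrite -gscaleAr -gscaleAl {1}mid1 scalerA.
Qed.

End Tableaux.

(** * Characters of Specht modules *)

Section SpechtCharacter.
Variables (m : nat) (la : seq nat).
Hypothesis sla : sumn la = m.
Implicit Types (s t u : 'S_m) (al : seq nat).

Local Notation a := (@grow m la).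
Local Notation b := (@gcol m la).
Local Notation c := (@gyoung m la).

(** The scalar n in c^2 = n c, classically the product of the hook lengths; below it matters that n
    is not 0. *)
Definition hook_product : rat := gtrace (c * c).
Local Notation n := hook_product.

Lemma gyoung_sq : c * c = n *: c.
Proof.
have e : c * c = b * (a * b) * a by rewrite /gyoung !mulrA.
by rewrite /hook_product e -(gcol_mid (a * b) sla).
Qed.

(* If c^2 = 0 for c = b a then y = b a b satisfies y y* = 0, so y = 0 and c c* = 0. *)
Lemma hook_product_neq0 : n != 0.
Proof.
apply/eqP => n0; have cc : b * a * b * a = 0.
  by have := gyoung_sq; rewrite n0 scale0r /gyoung mulrA.
have y0 : b * a * b = 0.
  apply: gstar_pos; rewrite !gstarM grow_star gcol_star.
  have -> : b * a * b * (b * (a * b)) = #|[set s : 'S_m | col_stab la s]|%:R *: (b * a * b * a * b).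
    by rewrite !mulrA -[b * a * b * b]mulrA gcol_sq -gscaleAr -!gscaleAl.
  by rewrite cc mul0r scaler0 /gtrace ffunE.
have c0 : c = 0.
  apply: gstar_pos; rewrite gstarM grow_star gcol_star.
  rewrite /gyoung -mulrA [a * (a * b)]mulrA grow_sq -gscaleAl -gscaleAr mulrA y0 scaler0.
  by rewrite /gtrace ffunE.
by have := gyoung1 m la; rewrite c0 /gtrace ffunE => /eqP; rewrite eq_sym oner_eq0.
Qed.

(** The trace of t on the ideal generated by c, computed with the idempotent c/n as projection; see
    [chiSE]. *)
Definition specht_char t : rat := n^-1 * \sum_s c (s * t^-1 * s^-1)%g.

Lemma specht_charJ s t : specht_char (t ^ s) = specht_char t.
Proof.
congr (_ * _); rewrite [RHS](reindex_inj (mulIg s^-1%g)) /=.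
apply: eq_bigr => u _; congr (c _).
by rewrite conjgE !invMg !invgK !mulgA.
Qed.

(** Inversion turns c = b a into a b, and averages over conjugates do not see the order of the
    factors. *)
Lemma specht_charV t : specht_char t^-1 = specht_char t.
Proof.
congr (_ * _); rewrite invgK (sum_conj_mulC b a t).
apply: eq_bigr => s _; have -> : a * b = gstar c.
  by rewrite gstarM grow_star gcol_star.
by rewrite ffunE !invMg invgK mulgA.
Qed.

(** Up to m!, pairing with the character evaluates W, extended linearly, at the idempotent c/n. *)
Lemma sum_specht_char (W : 'S_m -> rat) : (forall s t, W (t ^ s)%g = W t) ->
  \sum_t specht_char t * W t = (m`!)%:R * (n^-1 * \sum_u c u * W u).
Proof.
move=> WJ.
transitivity (\sum_t n^-1 * \sum_s c (s * t * s^-1)%g * W t).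
  apply: eq_bigr => t _; rewrite -specht_charV /specht_char invgK.
  by rewrite -mulr_suml mulrA.
rewrite -mulr_sumr mulrCA; congr (_ * _); rewrite exchange_big /=.
rewrite (eq_bigr (fun=> \sum_u c u * W u)); last first.
  move=> s _; rewrite (reindex_inj (@conjg_inj _ s)) /=; apply: eq_bigr => t _.
  by rewrite WJ conjgE !mulgA mulgV mul1g mulgK.
by rewrite sumr_const card_Sn mulr_natl.
Qed.

Lemma gyoung_mid (x : galg 'S_m) : c * x * c = gtrace (c * x * c) *: c.
Proof.
have -> : c * x * c = b * (a * x * b) * a by rewrite /gyoung !mulrA.
by rewrite -(gcol_mid (a * x * b) sla).
Qed.

(** The element c s^-1 c is n c(s) times c, so the traces add up to n times the sum of the c(s)
    c(s^-1), that is to n^2. *)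
Lemma specht_char_norm : n^-1 * \sum_u c u * specht_char u = 1.
Proof.
have n0 := hook_product_neq0.
have inner s : gtrace (c * gdelta s^-1%g * c * gdelta s) = n * c s * c s^-1%g.
  rewrite gyoung_mid -gscaleAl gtraceZ; congr (_ * _).
    rewrite gtraceC mulrA gyoung_sq -gscaleAl gtraceZ; congr (_ * _).
    by rewrite /gtrace gmulx_delta mul1g invgK.
  by rewrite /gtrace gmulx_delta mul1g.
have -> : \sum_u c u * specht_char u = n^-1 * \sum_s gtrace (c * gdelta s^-1%g * c * gdelta s).
  transitivity (\sum_u n^-1 * \sum_s c u * c (s * u^-1 * s^-1)%g).
    by apply: eq_bigr => u _; rewrite /specht_char mulrCA -mulr_sumr.
  rewrite -mulr_sumr exchange_big /=; congr (_ * _); apply: eq_bigr => s _.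
  rewrite -[c * _ * _ * _]mulrA -[c * _ * _]mulrA gtraceM.
  apply: eq_bigr => u _; congr (_ * _).
  by rewrite gmul_deltax gmulx_delta invgK.
under eq_bigr => s _ do rewrite inner -mulrA.
by rewrite -mulr_sumr -gtraceM -/n mulKf // mulVf.
Qed.

Definition fixed_words (k : nat) al t : rat :=
  \sum_(w : {ffun 'I_m -> 'I_k} | has_content al w) [forall i, w (t i) == w i]%:R.

Lemma has_content_perm (k : nat) al (w : {ffun 'I_m -> 'I_k}) s :
  has_content al [ffun i => w (s i)] = has_content al w.
Proof.
apply: eq_forallb => i; rewrite !card_set_sum [in RHS](reindex_inj (@perm_inj _ s)) /=.
by under eq_bigr => j _ do rewrite ffunE.
Qed.

Lemma fixed_wordsJ (k : nat) al s t : fixed_words k al (t ^ s)%g = fixed_words k al t.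
Proof.
rewrite /fixed_words (reindex_onto (fun w : {ffun 'I_m -> 'I_k} => [ffun i => w ((s^-1)%g i)])
  (fun w => [ffun i => w (s i)])) /=; last first.
  by move=> w _; apply/ffunP => i; rewrite !ffunE permKV.
apply: eq_big => [w|w _].
  rewrite has_content_perm; have -> : [ffun i => [ffun j => w ((s^-1)%g j)] (s i)] = w.
    by apply/ffunP => i; rewrite !ffunE permK.
  by rewrite eqxx andbT.
congr (nat_of_bool _)%:R; apply/forallP/forallP => H i.
  by have := H (s i); rewrite !ffunE permJ !permK.
by rewrite !ffunE -{1}(permKV s i) permJ permK; apply: H.
Qed.

Section RowWord.
Variables (al : seq nat) (k : nat).
Hypotheses (sal : sumn al = m) (kal : size al = k).

Lemma row_lt (i : 'I_m) : (reshape_index al i < k)%N.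
Proof. by rewrite -kal reshape_indexP ?sal. Qed.

Definition row_word s : {ffun 'I_m -> 'I_k} := [ffun i => Ordinal (row_lt (s i))].

Lemma row_word_content s : has_content al (row_word s).
Proof.
have := has_content_perm al (row_word 1) s.
have -> : [ffun i => row_word 1 (s i)] = row_word s.
  by apply/ffunP => i; rewrite !ffunE; apply/val_inj; rewrite /= perm1.
move=> ->; apply/forallP => r; rewrite -(card_row r sal); apply/eqP.
by apply: eq_card => i; rewrite !inE ffunE -val_eqE /= perm1.
Qed.

Lemma row_word_onto (w : {ffun 'I_m -> 'I_k}) : has_content al w ->
  exists s, w = row_word s.
Proof.
move=> wal; pose tw := [tuple w i | i < m]; pose tr := [tuple row_word 1 i | i < m].
have cnt (f : {ffun 'I_m -> 'I_k}) (r : 'I_k) :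
    count_mem r [tuple f i | i < m] = #|[set i | f i == r]|.
  rewrite card_set_sum count_map -sum1_count big_mkcond /= big_enum /=.
  by apply: eq_bigr => i _; case: eqP.
have /tuple_permP[s e] : perm_eq tw tr.
  apply/allP => r _ /=; rewrite !cnt (eqP (forallP wal r)).
  by rewrite (eqP (forallP (row_word_content 1) r)).
exists s; apply/ffunP => i.
have : tnth tw i = tnth [tuple tnth tr (s i) | i < m] i.
  by congr tnth; apply/val_inj; exact: e.
rewrite !tnth_mktuple => ->; rewrite !ffunE; apply/val_inj => /=.
by rewrite perm1.
Qed.

Lemma row_word_fix s u :
  [forall i, row_word s (u i) == row_word s i] = row_stab al (s^-1 * u * s)%g.
Proof.
apply/forallP/row_stabP => H i.
  have := H (s^-1 i)%g; rewrite !ffunE -val_eqE /= => /eqP.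
  by rewrite permKV !permM.
have := H (s i); rewrite !permM permK => e.
by rewrite !ffunE -val_eqE /= e.
Qed.

Lemma sum_row_word s : \sum_u c u * [forall i, row_word s (u i) == row_word s i]%:R =
  gtrace (c * gdelta s * grow m al * gdelta s^-1%g).
Proof.
rewrite -[c * _ * _ * _]mulrA -[c * _ * _]mulrA gtraceM.
apply: eq_bigr => u _; congr (_ * _); rewrite row_word_fix gmul_deltax gmulx_delta invgK ffunE -row_stabV.
by rewrite !invMg !invgK mulgA.
Qed.

(** Orbit counting: the words of content al form one orbit, and the fibres of [row_word] are cosets
    of the row stabilizer. *)
Lemma row_word_fiber (f : {ffun 'I_m -> 'I_k} -> rat) :
  \sum_s f (row_word s) =
  #|[set s : 'S_m | row_stab al s]|%:R * \sum_(w | has_content al w) f w.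
Proof.
rewrite (partition_big row_word (@has_content _ k al)) /=; last first.
  by move=> s _; apply: row_word_content.
rewrite mulr_sumr; apply: eq_bigr => w /row_word_onto[s0 ->].
rewrite (eq_bigr (fun=> f (row_word s0))); last by move=> s /eqP ->.
rewrite sumr_const mulr_natl; congr (_ *+ _).
rewrite -sum1_card -[RHS]sum1_card (reindex_inj (mulgI s0)) /=.
apply: eq_bigl => s; rewrite -[LHS]/(row_word (s0 * s)%g == row_word s0) inE.
apply/idP/row_stabP => [e i|H].
  have /ffunP/(_ ((s0^-1)%g i)) := eqP e; rewrite !ffunE => /(congr1 val) /=.
  by rewrite permM permKV.
by apply/eqP/ffunP => i; rewrite !ffunE; apply/val_inj; rewrite /= permM H.
Qed.

Lemma row_stab_card_neq0 : #|[set s : 'S_m | row_stab al s]|%:R != 0 :> rat.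
Proof.
rewrite pnatr_eq0 -lt0n; apply/card_gt0P; exists 1%g; rewrite inE.
by apply/row_stabP => i; rewrite perm1.
Qed.

Lemma sum_fixed_words :
  #|[set s : 'S_m | row_stab al s]|%:R * (\sum_u c u * fixed_words k al u) =
  \sum_s gtrace (c * gdelta s * grow m al * gdelta s^-1%g).
Proof.
under [RHS]eq_bigr => s _ do rewrite -sum_row_word.
rewrite (row_word_fiber (fun w => \sum_u c u * [forall i, w (u i) == w i]%:R)).
congr (_ * _); rewrite exchange_big /=; apply: eq_bigr => u _.
by rewrite mulr_sumr.
Qed.

Lemma sum_fixed_words_gt : sorted geq la -> lex_gt al la ->
  \sum_u c u * fixed_words k al u = 0.
Proof.
move=> so gt; apply: (mulfI row_stab_card_neq0); rewrite mulr0 sum_fixed_words.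
apply: big1 => s _; suff -> : c * gdelta s * grow m al = 0.
  by rewrite mul0r /gtrace ffunE.
have z x : b * x * grow m al = 0.
  rewrite [x]gdelta_sum mulr_sumr mulr_suml big1 // => u _.
  by rewrite -gscaleAr -gscaleAl gcol_clash ?scaler0 // clash_lex.
by rewrite /gyoung -[b * a * _]mulrA z.
Qed.

End RowWord.

(** Here c s a is a multiple of c, with scalar (a c)(s^-1). The sum over s is therefore the trace of
    c a c = N c^2, where N is the order of the row stabilizer. *)
Lemma sum_fixed_words_self : n^-1 * \sum_u c u * fixed_words (size la) la u = 1.
Proof.
have n0 := hook_product_neq0; have P0 := @row_stab_card_neq0 la.
set N := #|[set s : 'S_m | row_stab la s]|%:R in P0.
apply: (mulfI P0); rewrite mulrCA (sum_fixed_words sla erefl) mulr1.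
have inner s : gtrace (c * gdelta s * a * gdelta s^-1%g) = (a * c) s^-1%g * c s.
  have -> : c * gdelta s * a = gtrace (b * (a * gdelta s) * a) *: c.
    by rewrite -(gcol_mid _ sla) /gyoung !mulrA.
  rewrite -gscaleAl gtraceZ; congr (_ * _).
    have -> : b * (a * gdelta s) * a = (b * a * gdelta s) * a by rewrite !mulrA.
    by rewrite gtraceC mulrA /gtrace gmulx_delta mul1g.
  by rewrite /gtrace gmulx_delta mul1g invgK.
under eq_bigr => s _ do rewrite inner mulrC.
rewrite -gtraceM.
have -> : c * (a * c) = N *: (c * c).
  rewrite {1}/gyoung -[b * a * _]mulrA [a * (a * c)]mulrA grow_sq -gscaleAl -gscaleAr.
  by rewrite [b * (a * c)]mulrA.
by rewrite gtraceZ mulrCA -/n mulVf ?mulr1.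
Qed.

Section Identification.
Variables (A : comAlgType rat) (p : nat -> A).
Variables (theta : {rmorphism A -> {poly A}}) (eps : {rmorphism A -> rat}).
Hypothesis thetaZ : forall f g, theta (f *: g) = (f%:A)%:P * theta g.
Hypothesis theta_p : forall r, (0 < r)%N -> theta (p r) = (p r)%:P + 'X^r.
Hypothesis epsZ : forall f g, eps (f *: g) = f * eps g.
Hypothesis eps_p : forall r, (0 < r)%N -> eps (p r) = 0.

Lemma cform_cyc (W V : 'S_m -> rat) : (forall s t, W (t ^ s)%g = W t) ->
  (forall s t, V (t ^ s)%g = V t) ->
  cform m (W \o cyc m) (V \o cyc m) = (m`!)%:R^-1 * \sum_t W t * V t.
Proof.
move=> WJ VJ; have f0 : (m`!)%:R != 0 :> rat by rewrite pnatr_eq0 -lt0n fact_gt0.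
rewrite (sum_perm_class (F := fun t => W t * V t)) ?mulKf // => s t.
by rewrite WJ VJ.
Qed.

Lemma hword_fixed_words al nu : nu \in parts_of m ->
  hword p theta eps al nu = fixed_words (size al) al (cyc m nu).
Proof.
move=> pnu; have snu := parts_of_sumn pnu.
rewrite (hword_words thetaZ epsZ theta_p eps_p erefl (parts_of_pos pnu)).
rewrite /fixed_words -snu cyc_id big_mkcond [RHS]big_mkcond /=.
apply: eq_bigr => w _.
have -> : [forall i, w (cycles_perm nu i) == w i] = intertwine id (mu := nu) w.
  by apply: eq_forallb => i; rewrite permE.
by case: (has_content _ _); case: (intertwine _ _).
Qed.

Lemma cform_specht_char_hword al : sumn al = m ->
  cform m (specht_char \o cyc m) (hword p theta eps al) =
  n^-1 * \sum_u c u * fixed_words (size al) al u.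
Proof.
move=> sal.
transitivity (cform m (specht_char \o cyc m) (fixed_words (size al) al \o cyc m)).
  rewrite /cform !big_seq; apply: eq_bigr => nu pnu.
  by rewrite hword_fixed_words.
rewrite cform_cyc; [|exact: specht_charJ|exact: fixed_wordsJ].
rewrite sum_specht_char; last exact: fixed_wordsJ.
by rewrite mulKf // pnatr_eq0 -lt0n fact_gt0.
Qed.

Lemma specht_char_jt nu : is_part la -> nu \in parts_of m ->
  specht_char (cyc m nu) = jt_char p theta eps la nu.
Proof.
move=> /[dup] pla /andP[so _] pnu.
have lam : la \in parts_of m by rewrite mem_parts_of pla sla eqxx.
apply: (eq_jt_char thetaZ theta_p epsZ eps_p (c := specht_char \o cyc m) lam pnu).
- rewrite cform_cyc; [|exact: specht_charJ|exact: specht_charJ].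
  rewrite sum_specht_char; last exact: specht_charJ.
  by rewrite mulKf ?specht_char_norm // pnatr_eq0 -lt0n fact_gt0.
- move=> al sal gt; rewrite cform_specht_char_hword //.
  by rewrite (sum_fixed_words_gt sal erefl so gt) mulr0.
- by rewrite cform_specht_char_hword // sum_fixed_words_self.
Qed.

End Identification.
End SpechtCharacter.

(** * Traces and the Specht module *)

Section LinearMaps.
Variable F : fieldType.

(* The family [v] need not be free: a reproducing pair (v, phi) computes traces. *)
Lemma trace_on_frame (T : vectType F) (U : {vspace T}) (g : T -> T) (I : finType)
    (v : I -> T) (phi : I -> T -> F) :
  linear g -> (forall i, scalar (phi i)) ->
  (forall x, x \in U -> g x \in U) -> (forall i, v i \in U) ->
  (forall x, x \in U -> x = \sum_i phi i x *: v i) ->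
  trace_on U g = \sum_i phi i (g (v i)).
Proof.
move=> glin philin gU vU frame.
pose gl : {linear T -> T} := HB.pack g (GRing.isLinear.Build F T T _ g glin).
pose phil i : {linear T -> F | *%R} :=
  HB.pack (phi i) (GRing.isLinear.Build F T F _ (phi i) (philin i)).
have bU i : (i < \dim U)%N -> (vbasis U)`_i \in U.
  by move=> lt; apply: vbasis_mem; apply: mem_nth; rewrite size_tuple.
transitivity (\sum_i \sum_(j < \dim U) coord (vbasis U) j (v i) * phi i (g (vbasis U)`_j)).
  rewrite exchange_big; apply: eq_bigr => j _.
  rewrite {1}(frame _ (gU _ (bU _ (ltn_ord j)))) linear_sum; apply: eq_bigr => i _.
  by rewrite linearZ /= mulrC.
apply: eq_bigr => i _; rewrite [v i in RHS](coord_vbasis (vU i)).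
rewrite -[g _]/(gl _) -[phi i _ in RHS]/(phil i _) !linear_sum; apply: eq_bigr => j _.
by rewrite [gl _]linearZ [phil _ _]linearZ.
Qed.

Lemma linfun_linE (aT rT : vectType F) (f : aT -> rT) : linear f -> linfun f =1 f.
Proof.
move=> flin x.
exact: (lfunE (HB.pack f (GRing.isLinear.Build F aT rT _ f flin) : {linear aT -> rT})).
Qed.

Lemma linzE (X Y : finType) (W : vectType F) (g : X -> option Y) v y :
  linz W g v y = \sum_(x | g x == Some y) v x.
Proof.
rewrite /linz linfun_linE ?ffunE // => a x1 x2; apply/ffunP => z; rewrite !ffunE.
by rewrite scaler_sumr -big_split /=; apply: eq_bigr => x _; rewrite !ffunE.
Qed.

Lemma ten_sum (X : finType) (W : vectType F) (v : {ffun X -> W}) :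
  v = \sum_x ten x (v x).
Proof.
apply/ffunP => y; rewrite sum_ffunE (bigD1 y) //= ffunE eqxx big1 ?addr0 // => x ne.
by rewrite ffunE eq_sym (negbTE ne).
Qed.

Lemma ten_linear (X : finType) (W : vectType F) (x : X) : linear (@ten F X W x).
Proof.
move=> a w1 w2; apply/ffunP => y; rewrite !ffunE.
by case: eqP => // _; rewrite scaler0 addr0.
Qed.

HB.instance Definition _ (X : finType) (W : vectType F) (x : X) :=
  GRing.isLinear.Build F W {ffun X -> W} _ (@ten F X W x) (ten_linear x).

Lemma eq_on_ten (X : finType) (W S : vectType F) (f1 f2 : {linear {ffun X -> W} -> S}) :
  (forall x w, f1 (ten x w) = f2 (ten x w)) -> f1 =1 f2.
Proof.
by move=> e v; rewrite (ten_sum v) !linear_sum; apply: eq_bigr => x _; apply: e.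
Qed.

Lemma linz_ten (X Y : finType) (W : vectType F) (g : X -> option Y) x w :
  linz W g (ten x w) = if g x is Some y then ten y w else 0.
Proof.
apply/ffunP => z; rewrite linzE.
case gx: (g x) => [y|]; last first.
  rewrite ffunE big1 // => x' /eqP gx'; rewrite ffunE; case: eqP => // e.
  by rewrite e gx in gx'.
rewrite ffunE; case: eqP => [->|ne].
  rewrite (bigD1 x) ?gx //= ffunE eqxx big1 ?addr0 // => x' /andP[_ ne].
  by rewrite ffunE (negbTE ne).
rewrite big1 // => x' /eqP gx'; rewrite ffunE; case: eqP => // e.
by move: gx'; rewrite e gx => -[] /esym.
Qed.

Section Quotient.
Variables (T : vectType F) (U : {vspace T}).

Lemma quo_pi_linear : linear (@quo_pi F T U).
Proof. by move=> a x y; rewrite /quo_pi !linearP. Qed.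

HB.instance Definition _ :=
  GRing.isLinear.Build F T (quo U) _ (@quo_pi F T U) quo_pi_linear.

Lemma quo_piK (x : quo U) : quo_pi U (vsval x) = x.
Proof.
have dis : ((U^C)%VS :&: U = 0)%VS by rewrite capvC capv_compl.
apply/val_inj; rewrite /quo_pi /= vsprojK ?memv_pi //.
by rewrite daddv_pi_id // ; apply: (valP x).
Qed.

Lemma quo_pi_sub (t : T) : t - vsval (quo_pi U t) \in U.
Proof.
have dis : ((U^C)%VS :&: U = 0)%VS by rewrite capvC capv_compl.
rewrite /quo_pi vsprojK ?memv_pi //.
have {1}<- : daddv_pi (U^C)%VS U t + daddv_pi U (U^C)%VS t = t.
  by rewrite daddv_pi_add // addvC addv_complf memvf.
by rewrite addrC addKr memv_pi.
Qed.

Lemma quo_pi_eq0 (t : T) : t \in U -> quo_pi U t = 0.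
Proof.
move=> tU; apply/val_inj; rewrite /=.
have dis : (U :&: (U^C)%VS = 0)%VS by rewrite capv_compl.
apply/eqP; rewrite -memv0 -dis memv_cap (valP (quo_pi U t)) andbT.
have -> : vsval (quo_pi U t) = t - (t - vsval (quo_pi U t)) by rewrite subKr.
by rewrite rpredB ?quo_pi_sub.
Qed.

Lemma quo_mapE (g : 'End(T)) (x : quo U) : quo_map U g x = quo_pi U (g (vsval x)).
Proof.
by rewrite /quo_map linfun_linE // => a x1 x2; rewrite !linearP.
Qed.

Lemma quo_map_pi (g : 'End(T)) (t : T) : (forall u, u \in U -> g u \in U) ->
  quo_map U g (quo_pi U t) = quo_pi U (g t).
Proof.
move=> gU; rewrite quo_mapE; apply/eqP; rewrite -subr_eq0 -linearB /= -linearB /=.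
rewrite quo_pi_eq0 // -[X in g X]opprB linearN rpredN gU //.
exact: quo_pi_sub.
Qed.

End Quotient.

End LinearMaps.

Section SpechtModule.
Variables (F : numFieldType) (m : nat) (la : seq nat).
Hypothesis sla : sumn la = m.
Implicit Types (s t : 'S_m).

Local Notation GA := {ffun 'S_m -> F^o}.

Lemma lmulpE t (x : GA) s : lmulp F t x s = x (s * t^-1)%g.
Proof.
rewrite /lmulp linzE (big_pred1 (s * t^-1)%g) // => u /=.
by rewrite /eq_op /= (can2_eq (mulgK t) (mulgKV t)).
Qed.

Lemma lmulpM s t (x : GA) : lmulp F t (lmulp F s x) = lmulp F (s * t) x.
Proof. by apply/ffunP => u; rewrite !lmulpE invMg mulgA. Qed.

Lemma young_symmetrizerE s : young_symmetrizer F m la s = ratr (gyoung m la s).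
Proof.
rewrite gmulE rmorph_sum /= /young_symmetrizer exchange_big /= sum_ffunE.
rewrite big_mkcond /=; apply: eq_bigr => q _; rewrite rmorphM /= /gcol /grow !ffunE.
case: ifP => qQ; last by rewrite rmorph0 mul0r.
rewrite sum_ffunE rmorph_sign rmorph_nat /=.
transitivity (\sum_(p : 'S_m | row_stab la p) (-1) ^+ odd_perm q * (s == q * p)%g%:R : F).
  by apply: eq_bigr => p _; rewrite !ffunE /=; case: eqP => _; rewrite /GRing.scale /= ?mulr0.
rewrite -mulr_sumr; congr (_ * _); rewrite big_mkcond /= (bigD1 (q^-1 * s)%g) //=.
rewrite mulKVg eqxx big1 ?addr0 => [|p ne]; first by case: ifP.
rewrite [s == _]eq_sym; case: ifP => // _; suff -> : (q * p == s)%g = false by [].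
by apply/negbTE; apply: contra ne => /eqP <-; rewrite mulKg.
Qed.

Definition young_idem : GA := [ffun s => ratr ((hook_product m la)^-1 * gyoung m la s)].

Lemma young_idemE s : young_idem s = ratr ((hook_product m la)^-1 * gyoung m la s).
Proof. by rewrite ffunE. Qed.

(** In [galg] the operator [lmulp s] is right multiplication by s, so for e = c/n the sum of the
    x(s) [lmulp s e] is the product e x; for x = c this is c^2/n = c. *)
Lemma young_symmetrizer_frame :
  \sum_s young_symmetrizer F m la s *: lmulp F s young_idem = young_symmetrizer F m la.
Proof.
apply/ffunP => g; rewrite sum_ffunE young_symmetrizerE.
have -> : gyoung m la g = (hook_product m la)^-1 * (gyoung m la * gyoung m la) g.
  by rewrite gyoung_sq // gscaleE mulKf // hook_product_neq0.
rewrite gmulE mulr_sumr rmorph_sum /= [RHS](reindex_inj invg_inj) [RHS](reindex_inj (mulIg g^-1%g)) /=.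
apply: eq_bigr => h _.
have -> : (young_symmetrizer F m la h *: lmulp F h young_idem) g =
    young_symmetrizer F m la h * lmulp F h young_idem g by rewrite ffunE.
rewrite young_symmetrizerE lmulpE young_idemE.
rewrite invgK mulgKV invMg invgK !rmorphM /=.
by rewrite [LHS]mulrC -mulrA.
Qed.

Lemma specht_gen s : lmulp F s (young_symmetrizer F m la) \in specht F m la.
Proof. by apply/memv_span/map_f; rewrite mem_enum. Qed.

Lemma young_symmetrizer_specht : young_symmetrizer F m la \in specht F m la.
Proof.
have := specht_gen 1; have -> // : lmulp F 1 (young_symmetrizer F m la) = young_symmetrizer F m la.
by apply/ffunP => g; rewrite lmulpE invg1 mulg1.
Qed.

Lemma specht_lmulp s x : x \in specht F m la -> lmulp F s x \in specht F m la.
Proof.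
have /subvP sub : (specht F m la <= lmulp F s @^-1: specht F m la)%VS.
  apply/span_subvP => _ /mapP[t _ ->].
  by rewrite -memv_preim lmulpM specht_gen.
by move=> /sub; rewrite -memv_preim.
Qed.

Lemma young_idem_specht : young_idem \in specht F m la.
Proof.
have -> : young_idem = ratr (hook_product m la)^-1 *: young_symmetrizer F m la.
  apply/ffunP => g; rewrite young_idemE rmorphM /= -young_symmetrizerE.
  by rewrite [RHS]ffunE.
by rewrite memvZ ?young_symmetrizer_specht.
Qed.

(** The equation e x = x passes from c to its translates, which span the ideal. The translates of e
    with the coordinates x(s) are thus a reproducing pair for [trace_on_frame]. *)
Lemma specht_frame x : x \in specht F m la -> x = \sum_s x s *: lmulp F s young_idem.
Proof.
pose P (x : GA) : GA := \sum_s x s *: lmulp F s young_idem.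
have Plin : linear P.
  move=> a x1 x2; rewrite /P scaler_sumr -big_split /=; apply: eq_bigr => s _.
  by rewrite !ffunE scalerDl scalerA.
have /subvP sub : (specht F m la <= lker (linfun P - \1%VF))%VS.
  apply/span_subvP => _ /mapP[t _ ->].
  rewrite memv_ker add_lfunE opp_lfunE id_lfunE linfun_linE //.
  move: young_symmetrizer_frame; move: (young_symmetrizer F m la) => y fr.
  rewrite -{2}fr linear_sum /P subr_eq0; apply/eqP.
  rewrite (reindex_inj (mulIg t)) /=; apply: eq_bigr => s _.
  by rewrite linearZ /= lmulpM lmulpE mulgK.
move=> /sub; rewrite memv_ker add_lfunE opp_lfunE id_lfunE linfun_linE // subr_eq0.
by move=> /eqP.
Qed.

Lemma WS_actE t (w : WS F m la) : vsval (WS_act F la t w) = lmulp F t (vsval w).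
Proof.
rewrite /WS_act linfun_linE; last by move=> a w1 w2; rewrite !linearP.
by rewrite vsprojK // specht_lmulp //; apply: (valP w).
Qed.

Definition WS_idem : WS F m la := vsproj (specht F m la) young_idem.

Lemma WS_idemE : vsval WS_idem = young_idem.
Proof. by rewrite vsprojK ?young_idem_specht. Qed.

Lemma WS_frame (w : WS F m la) : w = \sum_s vsval w s *: WS_act F la s WS_idem.
Proof.
apply/val_inj; rewrite /= linear_sum {1}(specht_frame (valP w)); apply: eq_bigr => s _.
by rewrite linearZ /= WS_actE WS_idemE.
Qed.

Lemma chiSE t : chiS F la t = ratr (specht_char la t).
Proof.
rewrite /chiS (@trace_on_frame F (WS F m la) fullv _ 'S_m
  (fun s => WS_act F la s WS_idem) (fun s w => vsval w s)).
- rewrite /specht_char mulr_sumr rmorph_sum /=; apply: eq_bigr => s _.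
  by rewrite !WS_actE WS_idemE lmulpM lmulpE young_idemE invMg mulgA.
- by move=> a w1 w2; rewrite linearP.
- by move=> s a w1 w2; rewrite linearP !ffunE.
- by move=> x _; apply: memvf.
- by move=> s; apply: memvf.
- by move=> w _; apply: WS_frame.
Qed.

End SpechtModule.

(** * Multiplicity spaces of the tensor power *)

Lemma rook_comp_some (n : nat) (s : rook n) (X : finType) (f g : {ffun X -> 'I_n}) :
  rook_comp s f = Some g <-> forall x, val s (f x) = Some (g x).
Proof.
rewrite /rook_comp; case: forallP => H; split=> [e x|e] //.
- case: e => <-; rewrite ffunE; have := H x.
  by case: (val s (f x)).
- by congr Some; apply/ffunP => x; rewrite ffunE e.
- by case: H => x; rewrite e.
Qed.

Lemma rook_comp_none (n : nat) (s : rook n) (X : finType) (f : {ffun X -> 'I_n}) :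
  rook_comp s f = None <-> exists x, val s (f x) = None.
Proof.
rewrite /rook_comp; case: ifPn => [/forallP H|H]; split=> //.
  by case=> x e; have := H x; rewrite e.
move: H; rewrite negb_forall => /existsP[x].
by rewrite negbK => /eqP; exists x.
Qed.

Lemma rook_inj (n : nat) (s : rook n) (i j : 'I_n) :
  val s i != None -> val s i = val s j -> i = j.
Proof.
move=> ne e; have /forallP/(_ i)/forallP/(_ j)/implyP := valP s.
by rewrite ne -e eqxx => /(_ isT)/eqP.
Qed.

Lemma rook_comp_precomp (n : nat) (s : rook n) (X Y : finType) (f : {ffun Y -> 'I_n})
    (h : X -> Y) : (forall y, exists x, h x = y) ->
  rook_comp s [ffun x => f (h x)] =
  omap (fun g : {ffun Y -> 'I_n} => [ffun x => g (h x)]) (rook_comp s f).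
Proof.
move=> hs; case e: (rook_comp s f) => [g|] /=.
  move/rook_comp_some in e; apply/rook_comp_some => x.
  by rewrite !ffunE e.
move/rook_comp_none: e => [y e]; apply/rook_comp_none.
by have [x ex] := hs y; exists x; rewrite ffunE ex.
Qed.

Section PPCharacter.
Variables (F : numFieldType) (n k : nat) (la : seq nat).
Notation m := (sumn la).
Hypothesis mn : (m <= n)%N.
Notation W := (WS F m la).
Notation T := (tensor_space F n k).
Notation bal := (balance_rel F n la).
Implicit Types (s : rook n) (t : 'S_m) (g : Defs.inj_map m n) (f : {ffun 'I_k -> 'I_m}).

Definition rook_inj_map s g : option (Defs.inj_map m n) := obind insub (rook_comp s (val g)).

Lemma rook_inj_map_some s g g' :
  rook_inj_map s g = Some g' <-> rook_comp s (val g) = Some (val g').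
Proof.
rewrite /rook_inj_map; case e: (rook_comp s (val g)) => [h|] //=; split.
  by case: insubP => // u _ <- [->].
by case=> ->; rewrite valK.
Qed.

Lemma rook_inj_map_none s g :
  rook_inj_map s g = None <-> rook_comp s (val g) = None.
Proof.
rewrite /rook_inj_map; case e: (rook_comp s (val g)) => [h|] //=; split=> //.
case: insubP => // /injectiveP []; move/rook_comp_some in e => x y exy.
apply: (injectiveP _ (valP g)); apply: (@rook_inj _ s); first by rewrite e.
by rewrite !e exy.
Qed.

Definition delta (y : {ffun 'I_k -> 'I_n}) : T := ten y (1 : F^o).

Lemma deltaE y z : delta y z = (z == y)%:R.
Proof. by rewrite ffunE; case: eqP. Qed.

Lemma rook_tensor_delta s y : rook_tensor F k s (delta y) =
  if rook_comp s y is Some z then delta z else 0.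
Proof. exact: linz_ten. Qed.

Definition word g t f : {ffun 'I_k -> 'I_n} := [ffun x => val g (t (f x))].

(** The morphism attached to f: w is read as a combination of permutations t, and each pair (g, t)
    yields the word g o t o f. *)
Definition hom_fun f (v : {ffun Defs.inj_map m n -> W}) : T :=
  \sum_g \sum_t vsval (v g) t *: delta (word g t f).

Lemma hom_fun_linear f : linear (hom_fun f).
Proof.
move=> a v1 v2; rewrite /hom_fun scaler_sumr -big_split /=; apply: eq_bigr => g _.
rewrite scaler_sumr -big_split /=; apply: eq_bigr => t _.
have -> : (a *: v1 + v2) g = a *: v1 g + v2 g by rewrite !ffunE.
by rewrite linearP !ffunE scalerDl scalerA.
Qed.

HB.instance Definition _ f := GRing.isLinear.Build F _ _ _ (hom_fun f) (hom_fun_linear f).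

Lemma hom_fun_ten f g (w : W) :
  hom_fun f (ten g w) = \sum_t vsval w t *: delta (word g t f).
Proof.
rewrite /hom_fun (bigD1 g) //= [X in _ + X]big1 ?addr0 => [|g' ne].
  by apply: eq_bigr => t _; rewrite ffunE eqxx.
apply: big1 => t _; rewrite ffunE (negbTE ne).
by rewrite linear0 ffunE scale0r.
Qed.

Lemma bal_sub (V : {vspace {ffun Defs.inj_map m n -> W}}) :
  (forall g t w, ten (inj_map_comp g t) w - ten g (WS_act F la t w) \in V) ->
  (bal <= V)%VS.
Proof.
move=> H; apply/subv_sumP => g _; apply/subv_sumP => t _; apply/span_subvP => _ /mapP[w _ ->].
exact: H.
Qed.

Lemma bal_mem g t (w : W) :
  (ten (inj_map_comp g t) w - ten g (WS_act F la t w) : {ffun Defs.inj_map m n -> W}) \in bal.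
Proof.
have lin : linear (fun w : W =>
    ten (inj_map_comp g t) w - ten g (WS_act F la t w) : {ffun Defs.inj_map m n -> W}).
  move=> a w1 w2; rewrite linearP [WS_act F la t _]linearP linearP.
  by rewrite scalerBr opprD addrACA.
rewrite -[X in X \in _](linfun_linE lin) (coord_vbasis (memvf w)) linear_sum.
apply: memv_suml => i _; rewrite linearZ memvZ //= linfun_linE //.
apply: (subvP (sumv_sup g _ (sumv_sup t _ (subvv _)))) => //.
apply/memv_span/mapP; exists (vbasis {:W})`_i => //.
by apply: mem_nth; rewrite size_tuple.
Qed.

Lemma lmul_reindex (V : lmodType F) t (w : W) (G : 'S_m -> V) :
  \sum_u vsval (WS_act F la t w) u *: G u = \sum_u vsval w u *: G (u * t)%g.
Proof.
rewrite (reindex_inj (mulIg t)) /=; apply: eq_bigr => u _.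
by rewrite WS_actE // lmulpE mulgK.
Qed.

Lemma hom_fun_bal f u : u \in bal -> hom_fun f u = 0.
Proof.
have /subvP sub : (bal <= lker (linfun (hom_fun f)))%VS.
  apply: bal_sub => g t w; rewrite memv_ker lfunE linearB /= !hom_fun_ten.
  rewrite lmul_reindex subr_eq0; apply/eqP/eq_bigr => p _; congr (_ *: delta _).
  by apply/ffunP => x; rewrite !ffunE permM.
by move=> /sub; rewrite memv_ker lfunE => /eqP.
Qed.

Lemma onto_ex (X Y : finType) (h : {ffun X -> Y}) : onto h -> forall y, exists x, h x = y.
Proof. by move=> /forallP H y; have /existsP[x /eqP] := H y; exists x. Qed.

(** As f is onto, the word uses every value of g, so a rook undefined at some value of g also kills
    the word. *)
Lemma rook_comp_word s g t f : onto f ->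
  rook_comp s (word g t f) = omap (fun h : Defs.inj_map m n => word h t f) (rook_inj_map s g).
Proof.
move=> fo; have ho (y : 'I_m) : exists x, t (f x) = y.
  by have [x ex] := onto_ex fo (t^-1 y)%g; exists x; rewrite ex permKV.
rewrite /word rook_comp_precomp //; case e: (rook_inj_map s g) => [g'|].
  by move/rook_inj_map_some: e => -> /=.
by move/rook_inj_map_none: e => ->.
Qed.

Lemma hom_fun_rook s f v : onto f ->
  hom_fun f (linz W (rook_inj_map s) v) = rook_tensor F k s (hom_fun f v).
Proof.
move=> fo; apply: (@eq_on_ten _ _ _ _ (hom_fun f \o linz W (rook_inj_map s))
  (rook_tensor F k s \o hom_fun f)) v => g w /=.
rewrite linz_ten hom_fun_ten linear_sum /=.
under [RHS]eq_bigr => t _ do rewrite linearZ /= rook_tensor_delta rook_comp_word //.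
case: (rook_inj_map s g) => [g'|] /=; first by rewrite hom_fun_ten.
by rewrite linear0 big1 // => t _; rewrite scaler0.
Qed.

Lemma rook_bal s u : u \in bal -> linz W (rook_inj_map s) u \in bal.
Proof.
have /subvP sub : (bal <= linz W (rook_inj_map s) @^-1: bal)%VS.
  apply: bal_sub => g t w; rewrite -memv_preim linearB /= !linz_ten.
  case e: (rook_inj_map s g) => [g'|].
    have -> : rook_inj_map s (inj_map_comp g t) = Some (inj_map_comp g' t).
      apply/rook_inj_map_some/rook_comp_some => x.
      by move/rook_inj_map_some/rook_comp_some: e => e; rewrite !ffunE e.
    exact: bal_mem.
  have -> : rook_inj_map s (inj_map_comp g t) = None.
    apply/rook_inj_map_none/rook_comp_none.
    move/rook_inj_map_none/rook_comp_none: e => [x e].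
    by exists (t^-1 x)%g; rewrite ffunE permKV.
  by rewrite subr0 mem0v.
by move=> /sub; rewrite -memv_preim.
Qed.

Lemma WR_act_pi s v : WR_act F la s (quo_pi bal v) = quo_pi bal (linz W (rook_inj_map s) v).
Proof. by apply: quo_map_pi => u; apply: rook_bal. Qed.

Lemma quo_pi_comp g t (w : W) :
  quo_pi bal (ten (inj_map_comp g t) w) = quo_pi bal (ten g (WS_act F la t w)).
Proof. by apply/eqP; rewrite -subr_eq0 -linearB /= quo_pi_eq0 // bal_mem. Qed.

Definition hom_word f : 'Hom(WR F n la, T) := linfun (fun x : WR F n la => hom_fun f (vsval x)).

Lemma hom_wordE f x : hom_word f x = hom_fun f (vsval x).
Proof. by apply: linfun_linE => a x1 x2; rewrite !linearP. Qed.

Lemma hom_word_pi f v : hom_word f (quo_pi bal v) = hom_fun f v.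
Proof.
apply/eqP; rewrite hom_wordE eq_sym -subr_eq0 -linearB /=.
by rewrite hom_fun_bal // quo_pi_sub.
Qed.

Lemma WPP_mem (phi : 'Hom(WR F n la, T)) :
  (phi \in WPP F n k la) <->
  (forall s x, phi (WR_act F la s x) = rook_tensor F k s (phi x)).
Proof.
have lin s : linear (fun phi : 'Hom(WR F n la, T) =>
    ((phi \o WR_act F la s) - (rook_tensor F k s \o phi))%VF).
  move=> a p1 p2; apply/lfunP => x.
  rewrite !(add_lfunE, opp_lfunE, comp_lfunE, scale_lfunE) linearP.
  by rewrite scalerBr opprD addrACA.
have memE s : (phi \in lker (linfun (fun phi : 'Hom(WR F n la, T) =>
       ((phi \o WR_act F la s) - (rook_tensor F k s \o phi))%VF))) <->
    (forall x, phi (WR_act F la s x) = rook_tensor F k s (phi x)).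
  rewrite memv_ker linfun_linE // subr_eq0; split=> [/eqP/lfunP H x|H].
    by have := H x; rewrite !comp_lfunE.
  by apply/eqP/lfunP => x; rewrite !comp_lfunE.
rewrite /WPP memvE; split=> [/subv_bigcapP H s|H].
  by apply/memE; rewrite memvE; apply: H.
by apply/subv_bigcapP => s _; rewrite -memvE; apply/memE.
Qed.

Lemma hom_word_WPP f : onto f -> hom_word f \in WPP F n k la.
Proof.
move=> fo; apply/WPP_mem => s x; rewrite -[x]quo_piK WR_act_pi !hom_word_pi.
exact: hom_fun_rook.
Qed.

(** * Equivariant maps determined by their value at a generator *)

Fact incl_subproof : injectiveb [ffun a : 'I_m => widen_ord mn a].
Proof.
by apply/injectiveP => a b; rewrite !ffunE => /(congr1 val) /= /val_inj.
Qed.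

Definition incl : Defs.inj_map m n :=
  exist (fun f : {ffun 'I_m -> 'I_n} => injectiveb f) _ incl_subproof.

Lemma inclE (a : 'I_m) : val incl a = widen_ord mn a.
Proof. by rewrite ffunE. Qed.

Definition incl_word f : {ffun 'I_k -> 'I_n} := [ffun x => widen_ord mn (f x)].

Lemma incl_word_inj : injective incl_word.
Proof.
move=> f1 f2 /ffunP e; apply/ffunP => x; have := e x.
by rewrite !ffunE => /(congr1 val) /= /val_inj.
Qed.

Fact rook_of_inj_subproof g :
  rookb [ffun i : 'I_n => omap (fun a : 'I_m => val g a) (insub (i : nat))].
Proof.
apply/forallP => i; apply/forallP => j; apply/implyP; rewrite !ffunE.
case: insubP => [a _ ea|] //=; case: insubP => [b _ eb|] //=.
by move=> /eqP[/(injectiveP _ (valP g)) e]; apply/eqP/val_inj; rewrite /= -ea -eb e.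
Qed.

(** The rook that carries [incl] to g; through it the value of an equivariant map at [incl]
    determines its value at every g. *)
Definition rook_of_inj g : rook n := exist (@rookb n) _ (rook_of_inj_subproof g).

Lemma rook_of_inj_widen g (a : 'I_m) : val (rook_of_inj g) (widen_ord mn a) = Some (val g a).
Proof. by rewrite /= ffunE valK. Qed.

Fact rook_id_subproof (S : pred 'I_n) : rookb [ffun i => if S i then Some i else None].
Proof.
apply/forallP => i; apply/forallP => j; apply/implyP; rewrite !ffunE.
by case: (S i); case: (S j) => //= /eqP[->].
Qed.

Definition rook_id (S : pred 'I_n) : rook n := exist (@rookb n) _ (rook_id_subproof S).

Lemma rook_idE (S : pred 'I_n) i : val (rook_id S) i = if S i then Some i else None.
Proof. by rewrite /= ffunE. Qed.

Lemma rook_tensor_id (S : pred 'I_n) (v : T) y :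
  rook_tensor F k (rook_id S) v y = if [forall x, S (y x)] then v y else 0.
Proof.
rewrite linzE; case: forallP => H.
  rewrite (big_pred1 y) // => z; apply/eqP/eqP => [|->].
    move/rook_comp_some => e; apply/ffunP => x; have := e x.
    by rewrite rook_idE; case: ifP => // _ [].
  by apply/rook_comp_some => x; rewrite rook_idE H.
rewrite big1 // => z /eqP/rook_comp_some e; case: H => x; have := e x.
by rewrite rook_idE; case: ifP => // Sz [<-].
Qed.

Notation ide := (@WS_idem F m la).
Notation gen := (quo_pi bal (ten incl ide)).

Section Equivariant.
Variable phi : 'Hom(WR F n la, T).
Hypothesis phiP : forall s x, phi (WR_act F la s x) = rook_tensor F k s (phi x).

(* The partial identities in the rook monoid force the words that occur at the
   generator to have image exactly [m]. *)
Lemma gen_support y : phi gen y != 0 -> exists2 f, onto f & y = incl_word f.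
Proof.
move=> ne.
have loc (S : pred 'I_n) : [forall x, S (y x)] ->
    phi gen y = phi (WR_act F la (rook_id S) gen) y.
  by move=> SP; rewrite phiP rook_tensor_id SP.
(* The partial identity on the first m letters fixes the generator and kills every word with another
   letter. *)
have lt x : (y x < m)%N.
  have e : WR_act F la (rook_id (fun i => i < m)%N) gen = gen.
    rewrite WR_act_pi linz_ten; suff -> : rook_inj_map (rook_id (fun i => i < m)%N) incl = Some incl by [].
    by apply/rook_inj_map_some/rook_comp_some => a; rewrite rook_idE inclE /= ltn_ord.
  have := ne; rewrite -{1}e phiP rook_tensor_id; case: forallP => [H _|]; first exact: H.
  by rewrite eqxx.
pose f : {ffun 'I_k -> 'I_m} := [ffun x => Ordinal (lt x)].
have yf : y = incl_word f by apply/ffunP => x; rewrite !ffunE; apply/val_inj.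
(* If f misses the letter a, the partial identity omitting a kills the generator but keeps the word
   y. *)
exists f => //; apply: contraNT ne; rewrite negb_forall => /existsP[a].
rewrite negb_exists => /forallP H; rewrite (loc (fun i => i != widen_ord mn a)); last first.
  apply/forallP => x; rewrite yf ffunE; apply: contra (H x) => /eqP/(congr1 val) /= e.
  by apply/eqP/val_inj.
rewrite WR_act_pi linz_ten; set h := rook_inj_map _ _.
suff -> : h = None by rewrite !linear0 ffunE.
by apply/rook_inj_map_none/rook_comp_none; exists a; rewrite rook_idE inclE eqxx.
Qed.

Lemma gen_expand : phi gen = \sum_(f | onto f) phi gen (incl_word f) *: delta (incl_word f).
Proof.
apply/ffunP => y; rewrite sum_ffunE.
under eq_bigr => f _ do rewrite ffunE deltaE.
have [y0|ne] := eqVneq (phi gen y) 0.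
  rewrite y0 big1 // => f _; case: eqP => [<-|]; rewrite ?scaler0 // y0.
  by rewrite scale0r.
have [f fo ef] := gen_support ne.
rewrite (bigD1 f) //= ef eqxx [_ *: 1]mulr1 big1 ?addr0 // => f' /andP[_ ne'].
by rewrite (inj_eq incl_word_inj) eq_sym (negbTE ne') scaler0.
Qed.

Lemma hom_expand_idem g :
  phi (quo_pi bal (ten g ide)) =
  \sum_(f | onto f) phi gen (incl_word f) *: delta (word g 1 f).
Proof.
have -> : quo_pi bal (ten g ide) = WR_act F la (rook_of_inj g) gen.
  rewrite WR_act_pi linz_ten; suff -> : rook_inj_map (rook_of_inj g) incl = Some g by [].
  by apply/rook_inj_map_some/rook_comp_some => a; rewrite inclE rook_of_inj_widen.
rewrite phiP {1}gen_expand linear_sum /=; apply: eq_bigr => f _.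
rewrite linearZ /= rook_tensor_delta.
suff -> : rook_comp (rook_of_inj g) (incl_word f) = Some (word g 1 f) by [].
by apply/rook_comp_some => x; rewrite [incl_word f x]ffunE rook_of_inj_widen [word _ _ _ x]ffunE perm1.
Qed.

Lemma hom_expand : phi = \sum_(f | onto f) phi gen (incl_word f) *: hom_word f.
Proof.
apply/lfunP => x; rewrite -[x]quo_piK; move: (vsval x) => v {x}.
rewrite sum_lfunE; under [RHS]eq_bigr => f _ do rewrite scale_lfunE hom_word_pi.
pose R (v : {ffun Defs.inj_map m n -> W}) : T :=
  \sum_(f | onto f) phi gen (incl_word f) *: hom_fun f v.
have Rlin : linear R.
  move=> a v1 v2; rewrite /R scaler_sumr -big_split /=; apply: eq_bigr => f _.
  by rewrite linearP scalerDr !scalerA mulrC.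
pose Rl : {linear {ffun Defs.inj_map m n -> W} -> T} :=
  HB.pack R (GRing.isLinear.Build F _ _ _ R Rlin).
apply: (@eq_on_ten _ _ _ _ (phi \o @quo_pi _ _ bal) Rl) v => g w /=.
rewrite {1}(WS_frame erefl w) linear_sum linear_sum linear_sum /=.
transitivity (\sum_t vsval w t *: \sum_(f | onto f) phi gen (incl_word f) *: delta (word g t f)).
  apply: eq_bigr => t _; rewrite !linearZ /= -quo_pi_comp hom_expand_idem; congr (_ *: _).
  apply: eq_bigr => f _; congr (_ *: delta _); apply/ffunP => x.
  by rewrite !ffunE perm1.
rewrite /R; under eq_bigr => t _ do rewrite scaler_sumr.
rewrite exchange_big /=; apply: eq_bigr => f _; rewrite hom_fun_ten scaler_sumr.
by apply: eq_bigr => t _; rewrite !scalerA mulrC.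
Qed.

End Equivariant.

(** The maps [hom_word f] span but are in general linearly dependent. By [hom_expand] the values at
    the generator are coordinates for them, which is all that [trace_on_frame] asks for. *)
Lemma trace_WPP (D : 'End(T)) :
  (forall s v, D (rook_tensor F k s v) = rook_tensor F k s (D v)) ->
  trace_on (WPP F n k la) (fun phi => (D \o phi)%VF) =
  \sum_(f | onto f) \sum_t young_idem F m la t *
     D (delta (word incl t f)) (incl_word f).
Proof.
move=> Dcom.
rewrite (@trace_on_frame F _ (WPP F n k la) _ {ffun 'I_k -> 'I_m}
  (* The frame is indexed by all f, so the maps that are not onto contribute the zero morphism. *)
  (fun f => if onto f then hom_word f else 0) (fun f phi => phi gen (incl_word f))).
- rewrite [RHS]big_mkcond; apply: eq_bigr => f _; case: ifP => fo; last first.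
    by rewrite comp_lfunE lfunE /= linear0 ffunE.
  rewrite comp_lfunE hom_word_pi hom_fun_ten linear_sum sum_ffunE.
  by apply: eq_bigr => t _; rewrite WS_idemE linearZ /= ffunE.
- by move=> a p1 p2; rewrite comp_lfunDr comp_lfunZr.
- by move=> f a p1 p2; rewrite add_lfunE scale_lfunE !ffunE.
- move=> phi /WPP_mem H; apply/WPP_mem => s x.
  by rewrite !comp_lfunE H Dcom.
- by move=> f; case: ifP => fo; rewrite ?mem0v // hom_word_WPP.
- move=> phi /WPP_mem H; rewrite {1}(hom_expand H) big_mkcond.
  by apply: eq_bigr => f _; case: ifP => // _; rewrite scaler0.
Qed.

End PPCharacter.

(** The count of onto intertwiners as a class function of t; its values at the standard permutations
    are the [nsurj]. *)
Definition nonto (m : nat) (mu : seq nat) (t : 'S_m) : rat :=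
  \sum_(g : {ffun 'I_(sumn mu) -> 'I_m} | intertwine t (mu := mu) g) (onto g)%:R.

Lemma nonto_cyc (m : nat) (rho mu : seq nat) : rho \in parts_of m -> 0%N \notin mu ->
  nonto mu (cyc m rho) = nsurj rho mu.
Proof.
move=> prho mu0; have srho := parts_of_sumn prho.
rewrite -(sum_onto_intertwine (parts_of_pos prho) mu0) /nonto -srho cyc_id.
by apply: eq_bigl => g; apply: eq_forallb => a; rewrite permE.
Qed.

Lemma nontoJ (m : nat) (mu : seq nat) (s t : 'S_m) : nonto mu (t ^ s)%g = nonto mu t.
Proof.
rewrite /nonto (reindex_onto (fun g : {ffun 'I_(sumn mu) -> 'I_m} => [ffun a => s (g a)])
  (fun g => [ffun a => s^-1 (g a)]%g)) /=; last first.
  by move=> g _; apply/ffunP => a; rewrite !ffunE permKV.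
apply: eq_big => [g|g _].
  have -> : [ffun a => (s^-1)%g ([ffun b => s (g b)] a)] = g.
    by apply/ffunP => a; rewrite !ffunE permK.
  rewrite eqxx andbT; apply: eq_forallb => a; rewrite !ffunE permJ.
  by rewrite (inj_eq perm_inj).
congr (nat_of_bool _)%:R; apply/forallP/forallP => H y.
  have /existsP[x /eqP e] := H (s y); apply/existsP; exists x.
  by move: e; rewrite ffunE => /perm_inj ->.
have /existsP[x /eqP e] := H (s^-1 y)%g; apply/existsP; exists x.
by rewrite ffunE e permKV.
Qed.

(** * Action of the class representatives on words *)

Section Diagram.
Variables (n k : nat) (mu : seq nat).
Notation i := (sumn mu).
Hypotheses (i0 : (0 < i)%N) (ik : (i <= k)%N).
Variable d : PP k.
Hypothesis dE : val d = extend_diagram k (cycles_perm mu).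
Local Notation sigma := (cycles_perm mu).

Fact cap_subproof (u : 'I_k) : (minn u i.-1 < i)%N.
Proof. by rewrite gtn_min prednK // leqnn orbT. Qed.

(** The retraction of [k] onto its first i points that collapses all later points to the last of
    these, as the blocks of sigma[k] do; [wid] is its section. *)
Definition cap (u : 'I_k) : 'I_i := Ordinal (cap_subproof u).
Definition wid (a : 'I_i) : 'I_k := widen_ord ik a.

Lemma capK (a : 'I_i) : cap (wid a) = a.
Proof. by apply/val_inj/minn_idPl; rewrite /= -ltnS prednK. Qed.

Definition diagram_block (a : 'I_i) : {set 'I_k + 'I_k} :=
  [set x | match x with inl u => cap u == sigma a | inr b => cap b == a end].

Lemma mem_diagram B : reflect (exists a, B = diagram_block a) (B \in val d).
Proof.
have e a : diagram_block a = [set x : 'I_k + 'I_k | match x with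
    | inl u => minn u i.-1 == sigma a :> nat | inr b => minn b i.-1 == a :> nat end].
  by apply/setP => -[u|u]; rewrite !inE -val_eqE.
rewrite dE; apply: (iffP imsetP) => [[a _ ->]|[a ->]]; exists a => //; rewrite ?e //.
Qed.

Lemma pblock_diagram (j : 'I_k) :
  pblock (val d) (inl j) = diagram_block (sigma^-1 (cap j))%g.
Proof.
have /andP[/and3P[_ tI _] _] := valP d.
apply: def_pblock => //; first by apply/mem_diagram; exists (sigma^-1 (cap j))%g.
by rewrite inE permKV.
Qed.

Lemma PP_mapE (w : {ffun 'I_k -> 'I_n}) : PP_map d w =
  if [forall b, w b == w (wid (cap b))]
  then Some [ffun j => w (wid (sigma^-1 (cap j))%g)] else None.
Proof.
rewrite /PP_map.
have -> : [forall (B | B \in val d), forall j, forall j',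
     (inr j \in B) && (inr j' \in B) ==> (w j == w j')] = [forall b, w b == w (wid (cap b))].
  apply/forallP/forallP => [H b|H B].
    have /implyP H1 := H (diagram_block (cap b)).
    have /forallP/(_ b)/forallP/(_ (wid (cap b)))/implyP := H1 (introT (mem_diagram _) (ex_intro _ _ erefl)).
    by apply; rewrite !inE capK eqxx.
  apply/implyP => /mem_diagram[a ->]; apply/forallP => j; apply/forallP => j'.
  apply/implyP; rewrite !inE => /andP[/eqP ej /eqP ej'].
  by rewrite (eqP (H j)) (eqP (H j')) ej ej'.
case: forallP => // H; congr Some; apply/ffunP => j; rewrite !ffunE.
case: pickP => [j'|/(_ (wid (sigma^-1 (cap j))%g))]; rewrite pblock_diagram inE.
  by move=> /eqP e; rewrite (eqP (H j')) e.
by rewrite capK eqxx.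
Qed.

(** A rook is injective where defined, so it preserves and reflects equality of letters. The diagram
    keeps the set of letters of a word it does not kill, so the rook kills both words or neither. *)
Lemma PP_map_rook (s : rook n) (w : {ffun 'I_k -> 'I_n}) :
  obind (PP_map d) (rook_comp s w) = obind (@rook_comp n s 'I_k) (PP_map d w).
Proof.
rewrite [PP_map d w]PP_mapE; case e: (rook_comp s w) => [w'|] /=.
  move/rook_comp_some: e => e; rewrite PP_mapE.
  have -> : [forall b, w' b == w' (wid (cap b))] = [forall b, w b == w (wid (cap b))].
    apply: eq_forallb => b; apply/eqP/eqP => eb.
      by apply: (@rook_inj _ s); rewrite ?e ?eb.
    by have := e b; rewrite eb e => -[].
  case: ifP => _ //=; symmetry; apply/rook_comp_some => x.
  by rewrite !ffunE e.
case: forallP => H //=; symmetry; apply/rook_comp_none.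
move/rook_comp_none: e => [x ex]; exists (wid (sigma (cap x))).
by rewrite ffunE capK permK -(eqP (H x)).
Qed.

Lemma PP_tensor_rook (F : fieldType) (s : rook n) (v : tensor_space F n k) :
  PP_tensor F n d (rook_tensor F k s v) = rook_tensor F k s (PP_tensor F n d v).
Proof.
apply: (@eq_on_ten _ _ _ _ (PP_tensor F n d \o rook_tensor F k s)
  (rook_tensor F k s \o PP_tensor F n d)) v => w c /=.
rewrite !linz_ten; have := PP_map_rook s w.
case: (rook_comp s w) => [w1|]; case: (PP_map d w) => [w2|] /= e; rewrite ?linear0 //.
- by rewrite !linz_ten e.
- by rewrite linz_ten e.
- by rewrite linz_ten -e.
Qed.

(** The condition on f says that f factors through [cap] and that its restriction to the first i
    points intertwines sigma_mu with t; restriction loses nothing and preserves being onto. *)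
Lemma count_PP_map (la : seq nat) (mn : (sumn la <= n)%N) (t : 'S_(sumn la)) :
  \sum_(f : {ffun 'I_k -> 'I_(sumn la)} | onto f)
    (PP_map d (word (incl mn) t f) == Some (incl_word mn f))%:R = nonto mu t :> rat.
Proof.
pose ext (g : {ffun 'I_i -> 'I_(sumn la)}) : {ffun 'I_k -> 'I_(sumn la)} := [ffun x => g (cap x)].
pose res (f : {ffun 'I_k -> 'I_(sumn la)}) : {ffun 'I_i -> 'I_(sumn la)} := [ffun a => f (wid a)].
have condE f : (PP_map d (word (incl mn) t f) == Some (incl_word mn f)) =
    [forall b, f b == f (wid (cap b))] && [forall j, t (f (wid (sigma^-1 (cap j))%g)) == f j].
  rewrite PP_mapE.
  have -> : [forall b, word (incl mn) t f b == word (incl mn) t f (wid (cap b))] =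
            [forall b, f b == f (wid (cap b))].
    apply: eq_forallb => b; rewrite [word _ _ _ b]ffunE [word _ _ _ (wid _)]ffunE.
    by rewrite (inj_eq (injectiveP _ (valP (incl mn)))) (inj_eq perm_inj).
  case: ifP => //= _; apply/eqP/forallP => [[/ffunP e] j|e].
    have := e j; rewrite ffunE [word _ _ _ _]ffunE inclE [incl_word _ _ _]ffunE.
    by move/(congr1 val) => /= /val_inj ->.
  congr Some; apply/ffunP => j; rewrite ffunE [word _ _ _ _]ffunE inclE [incl_word _ _ _]ffunE.
  by rewrite (eqP (e j)).
transitivity (\sum_(f | onto f && (PP_map d (word (incl mn) t f) == Some (incl_word mn f))) 1 : rat).
  by rewrite big_mkcondr; apply: eq_bigr => f _; case: eqP.
transitivity (\sum_(g | intertwine t (mu := mu) g && onto g) 1 : rat); last first.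
  by rewrite big_mkcondr; apply: eq_bigr => g _; case: (onto g).
rewrite (reindex_onto ext res) /=.
  apply: eq_bigl => g; have -> : res (ext g) = g by apply/ffunP => a; rewrite !ffunE capK.
  rewrite eqxx andbT condE andbC; congr (_ && _).
    have -> /= : [forall b, ext g b == ext g (wid (cap b))].
      by apply/forallP => b; rewrite !ffunE capK.
    apply/forallP/intertwineP => H a.
      have := H (wid (sigma a)); rewrite !ffunE !capK permK => /eqP ->.
      by rewrite permE.
    have e : cycles_ord (sigma^-1 (cap a))%g = cap a.
      by have := permKV sigma (cap a); rewrite (permE (@cycles_ord_inj mu)).
    by rewrite !ffunE capK -H e.
  apply/forallP/forallP => H y; have /existsP[x /eqP e] := H y; apply/existsP.
    by exists (cap x); move: e; rewrite ffunE => ->.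
  by exists (wid x); rewrite ffunE capK e.
move=> f /andP[_]; rewrite condE => /andP[/forallP H _].
by apply/ffunP => x; rewrite !ffunE -(eqP (H x)).
Qed.

(** The trace is [nonto mu] evaluated at the idempotent c/n, which [sum_specht_char] turns into a
    scalar product with the Specht character. *)
Lemma chiPPE (F : numFieldType) (la : seq nat) : (sumn la <= n)%N -> 0%N \notin mu ->
  chiPP F n la d = ratr (\sum_(rho <- parts_of (sumn la)) (zee rho)%:R^-1 *
    (specht_char la (cyc (sumn la) rho) * nsurj rho mu)).
Proof.
move=> mn mu0; rewrite /chiPP (trace_WPP mn); last by move=> s v; apply: PP_tensor_rook.
pose m := sumn la; have f0 : (m`!)%:R != 0 :> rat by rewrite pnatr_eq0 -lt0n fact_gt0.
transitivity (ratr (\sum_(t : 'S_m) ((hook_product m la)^-1 * gyoung m la t) * nonto mu t) : F).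
  rewrite exchange_big rmorph_sum /=; apply: eq_bigr => t _.
  rewrite rmorphM -count_PP_map rmorph_sum mulr_sumr /=; apply: eq_bigr => f _.
  rewrite young_idemE ratr_nat; congr (_ * _).
  rewrite /PP_tensor linz_ten; case e: (PP_map d _) => [y|]; last by rewrite ffunE.
  by rewrite deltaE eq_sym.
congr ratr; apply: (mulfI f0); transitivity (\sum_(t : 'S_m) specht_char la t * nonto mu t).
  rewrite sum_specht_char //; last exact: nontoJ.
  by congr (_ * _); rewrite mulr_sumr; apply: eq_bigr => t _; rewrite mulrA.
rewrite (sum_perm_class (F := fun t : 'S_m => specht_char la t * nonto mu t)); last first.
  by move=> s t; rewrite specht_charJ nontoJ.
congr (_ * _); rewrite !big_seq; apply: eq_bigr => rho prho.
by rewrite nonto_cyc.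
Qed.

End Diagram.

(** * Symmetric functions *)

Definition shift_rmorphism : {rmorphism Lambda -> {poly Lambda}} :=
  psubst_rmorphism (@polyC Lambda \o @malgC {cmonom nat} rat)
    (fun r => (psum1 r)%:P + 'X^r).

Definition const_rmorphism : {rmorphism Lambda -> rat} :=
  psubst_rmorphism (@idfun rat) (fun=> 0).

Fact shiftZ (c : rat) (f : Lambda) :
  shift_rmorphism (c *: f) = (c%:A)%:P * shift_rmorphism f.
Proof.
rewrite psubstZ; have -> : (c%:A : Lambda) = c%:MP by rewrite -mul_malgC mulr1.
reflexivity.
Qed.

Fact shift_psum1 (r : nat) : (0 < r)%N -> shift_rmorphism (psum1 r) = (psum1 r)%:P + 'X^r.
Proof. exact: psubst_psum1. Qed.

Fact constZ (c : rat) (f : Lambda) : const_rmorphism (c *: f) = c * const_rmorphism f.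
Proof. exact: psubstZ. Qed.

Fact const_psum1 (r : nat) : (0 < r)%N -> const_rmorphism (psum1 r) = 0.
Proof. exact: psubst_psum1. Qed.

Lemma schurE (la : seq nat) : schur la = jacobi_trudi psum1 la.
Proof. by []. Qed.

Definition chi (la nu : seq nat) : rat :=
  specht_char la (cycles_perm nu).

Lemma chi_cyc (m : nat) (la nu : seq nat) : nu \in parts_of m ->
  specht_char la (cyc m nu) = chi la nu.
Proof. by move=> /parts_of_sumn <-; rewrite cyc_id. Qed.

Lemma chi_jt (m : nat) (la nu : seq nat) : la \in parts_of m -> nu \in parts_of m ->
  chi la nu = jt_char psum1 shift_rmorphism const_rmorphism la nu.
Proof.
move=> pla pnu; rewrite -(chi_cyc la pnu).
apply: (specht_char_jt (parts_of_sumn pla) shiftZ shift_psum1 constZ const_psum1) => //.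
by move: pla; rewrite mem_parts_of => /andP[].
Qed.

Lemma schur_avg (m : nat) (la : seq nat) : la \in parts_of m ->
  schur la = avg m (fun nu => chi la nu *: psum nu).
Proof.
move=> pla; rewrite schurE.
rewrite (jacobi_trudi_avg shiftZ shift_psum1 constZ const_psum1) (parts_of_sumn pla).
by apply: eq_avg => nu p s; rewrite (chi_jt pla) // mem_parts_of p s eqxx.
Qed.

Lemma chi_orthonormal (m : nat) (la mu : seq nat) :
  la \in parts_of m -> mu \in parts_of m ->
  \sum_(nu <- parts_of m) (zee nu)%:R^-1 * (chi la nu * chi mu nu) = (la == mu)%:R.
Proof.
move=> pla pmu; rewrite -(cform_jt_char shiftZ shift_psum1 constZ const_psum1 pla pmu).
rewrite /cform !big_seq; apply: eq_bigr => nu pnu.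
by rewrite (chi_jt pla pnu) (chi_jt pmu pnu).
Qed.

(** Row orthogonality provides a right inverse of the square character table; it is also a left
    inverse, which is column orthogonality. *)
Lemma chi_orthogonal_col (m : nat) (nu mu : seq nat) :
  nu \in parts_of m -> mu \in parts_of m ->
  \sum_(la <- parts_of m) chi la nu * chi la mu = (zee nu)%:R * (nu == mu)%:R.
Proof.
move=> pnu pmu; set s := parts_of m; pose N := size s.
have mem (i : 'I_N) : nth [::] s i \in s by apply: mem_nth.
pose X : 'M[rat]_N := \matrix_(i, j) chi (nth [::] s i) (nth [::] s j).
pose B : 'M[rat]_N := \matrix_(i, j) ((zee (nth [::] s i))%:R^-1 * chi (nth [::] s j) (nth [::] s i)).
have XB : X *m B = 1%:M.
  apply/matrixP => i j; rewrite !mxE.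
  rewrite -[RHS]/((val i == val j)%:R) -(nth_uniq [::] (ltn_ord i) (ltn_ord j) (parts_of_uniq m)).
  rewrite -(chi_orthonormal (mem i) (mem j)) (big_nth [::]) big_mkord.
  by apply: eq_bigr => l _; rewrite !mxE mulrCA.
have ln : (index nu s < N)%N by rewrite index_mem.
have lm : (index mu s < N)%N by rewrite index_mem.
have /matrixP/(_ (Ordinal ln) (Ordinal lm)) := mulmx1C XB; rewrite !mxE.
have z0 : (zee nu)%:R != 0 :> rat by rewrite pnatr_eq0 -lt0n zee_gt0 // (parts_of_pos pnu).
move=> e; apply: (mulfI (invr_neq0 z0)); rewrite mulKf //.
have -> : (nu == mu)%:R = (Ordinal ln == Ordinal lm)%:R :> rat.
  congr (nat_of_bool _)%:R; rewrite -val_eqE /=; apply/eqP/eqP => [-> //|ei].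
  by rewrite -(nth_index [::] pnu) ei nth_index.
rewrite -[RHS]e (big_nth [::]) big_mkord mulr_sumr; apply: eq_bigr => l _.
by rewrite !mxE /= !nth_index // mulrA.
Qed.

Lemma chi_inversion (V : lmodType rat) (m : nat) (P : seq nat -> V) (nu : seq nat) :
  nu \in parts_of m ->
  \sum_(la <- parts_of m) chi la nu *: avg m (fun mu => chi la mu *: P mu) = P nu.
Proof.
move=> pnu; have := @chi_orthogonal_col m nu; move: chi => X ortho.
rewrite /avg; under eq_bigr => la _ do rewrite scaler_sumr.
rewrite exchange_big /= (bigD1_seq nu) ?parts_of_uniq //=.
have col mu : mu \in parts_of m ->
    \sum_(la <- parts_of m) X la nu *: ((zee mu)%:R^-1 *: (X la mu *: P mu)) =
    ((zee mu)%:R^-1 * ((zee nu)%:R * (nu == mu)%:R)) *: P mu.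
  move=> pmu; rewrite -(ortho _ pnu pmu) mulr_sumr scaler_suml.
  by apply: eq_bigr => la _; rewrite !scalerA mulrCA mulrA.
rewrite col // eqxx mulr1 mulVf; last first.
  by rewrite pnatr_eq0 -lt0n zee_gt0 // (parts_of_pos pnu).
rewrite scale1r big_seq_cond big1 ?addr0 // => mu /andP[pmu ne].
by rewrite col // eq_sym (negbTE ne) !mulr0 scale0r.
Qed.

Lemma psum_schur (m : nat) (nu : seq nat) : nu \in parts_of m ->
  psum nu = \sum_(la <- parts_of m) chi la nu *: schur la.
Proof.
move=> pnu; apply: etrans (esym (chi_inversion psum pnu)) _.
by apply: eq_big_seq => la pla; rewrite (schur_avg pla).
Qed.

Lemma avgZ (V : lmodType rat) (d : nat) (c : seq nat -> rat) (P : seq nat -> V) :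
  avg d (fun nu => c nu *: P nu) = \sum_(nu <- parts_of d) ((zee nu)%:R^-1 * c nu) *: P nu.
Proof. by apply: eq_bigr => nu _; rewrite scalerA. Qed.

Lemma wdeg_mon (nu : seq nat) : 0%N \notin nu -> wdeg (mon nu) = sumn nu.
Proof.
have wdegEw (m : {cmonom nat}) (d : {fset nat}) : (finsupp m `<=` d)%fset ->
    wdeg m = (\sum_(i <- d) i.+1 * m i)%N.
  move=> le; rewrite /wdeg (big_fset_incl _ le) // => i _.
  by rewrite -cmE_eq0 => /eqP ->; rewrite muln0.
have wdegM (m1 m2 : {cmonom nat}) : wdeg (mmul m1 m2) = (wdeg m1 + wdeg m2)%N.
  rewrite (wdegEw m1 _ (fsubsetUl _ (finsupp m2))) (wdegEw m2 _ (fsubsetUr (finsupp m1) _)).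
  rewrite /wdeg mdomD -big_split /=; apply: eq_bigr => i _.
  by rewrite cmM mulnDr.
elim: nu => [|r nu IH]; first by rewrite /mon big_nil /wdeg mdom1 big_seq_fset0.
rewrite inE negb_or eq_sym -lt0n => /andP[r0 nu0].
rewrite /mon big_cons wdegM -/(mon nu) IH //= /wdeg mdomU big_seq_fset1 cmUU.
by rewrite muln1 prednK.
Qed.

(** * The Hall product on power sums and the pairing with the completion *)

Section HallProduct.
Variable hall : Lambda -> Lambda -> rat.
Hypothesis hallP : hall_product hall.

Lemma hall_suml (I : Type) (s : seq I) (c : I -> rat) (x : I -> Lambda) g :
  hall (\sum_(i <- s) c i *: x i) g = \sum_(i <- s) c i * hall (x i) g.
Proof.
case: hallP => _ lin _.
have h0 : hall 0 g = 0.
  by have := lin g (-1) 0 0; rewrite scaler0 addr0 mulN1r addNr.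
elim: s => [|i s IH]; first by rewrite !big_nil.
by rewrite !big_cons lin IH.
Qed.

Lemma hall_sumr (I : Type) (s : seq I) (c : I -> rat) (x : I -> Lambda) f :
  hall f (\sum_(i <- s) c i *: x i) = \sum_(i <- s) c i * hall f (x i).
Proof.
case: hallP => lin _ _.
have h0 : hall f 0 = 0.
  by have := lin f (-1) 0 0; rewrite scaler0 addr0 mulN1r addNr.
elim: s => [|i s IH]; first by rewrite !big_nil.
by rewrite !big_cons lin IH.
Qed.

Lemma hall_psum_schur (m : nat) (nu mu : seq nat) : nu \in parts_of m -> is_part mu ->
  hall (psum nu) (schur mu) = if sumn mu == m then chi mu nu else 0.
Proof.
move=> pnu pmu; case: hallP => _ _ ortho.
rewrite (psum_schur pnu) hall_suml.
have e la : la \in parts_of m -> hall (schur la) (schur mu) = (la == mu)%:R.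
  by rewrite mem_parts_of => /andP[pla _]; apply: ortho.
rewrite big_seq; under eq_bigr => la pla do rewrite e //.
rewrite -big_seq; case: eqP => sm.
  have mm : mu \in parts_of m by rewrite mem_parts_of pmu sm eqxx.
  rewrite (bigD1_seq mu) ?parts_of_uniq //= eqxx mulr1 big1 ?addr0 // => la /negbTE ->.
  by rewrite mulr0.
rewrite big_seq big1 // => la pla; case: eqP => [el|]; last by rewrite mulr0.
by case: sm; rewrite -el (parts_of_sumn pla).
Qed.

(** Only the values on Schur functions are given, so both arguments are expanded in them and column
    orthogonality supplies z_nu. *)
Lemma hall_psum (m : nat) (nu mu : seq nat) : nu \in parts_of m -> is_part mu ->
  hall (psum nu) (psum mu) = (zee nu)%:R * (nu == mu)%:R.
Proof.
move=> pnu pmu; have mm : mu \in parts_of (sumn mu) by rewrite mem_parts_of pmu eqxx.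
rewrite (psum_schur mm) hall_sumr big_seq.
have e la : la \in parts_of (sumn mu) ->
    hall (psum nu) (schur la) = if sumn mu == m then chi la nu else 0.
  move=> pla; rewrite (hall_psum_schur pnu) ?(parts_of_sumn pla) //.
  by move: pla; rewrite mem_parts_of => /andP[].
under eq_bigr => la pla do rewrite e //.
rewrite -big_seq; case: eqP => [sm|ne]; last first.
  rewrite big1 => [|la _]; last by rewrite mulr0.
  case: eqP => [en|]; rewrite ?mulr0 //; case: ne; rewrite -en.
  exact: parts_of_sumn pnu.
rewrite sm; rewrite sm in mm; rewrite -(chi_orthogonal_col pnu mm).
by apply: eq_bigr => la _; rewrite mulrC.
Qed.

Lemma leq_sdeg (g : Lambda) (nu : seq nat) : g@_(mon nu) != 0 -> 0%N \notin nu ->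
  (sumn nu <= sdeg g)%N.
Proof.
move=> ne nu0; rewrite -(wdeg_mon nu0).
apply: (@leq_bigmax_seq _ _ xpredT wdeg) => //.
by rewrite -mcoeff_neq0.
Qed.

(** The bound on m ensures that the truncated sum over degrees includes the only degree that
    contributes. *)
Lemma cpairing_avg (G : cLambda) (c : seq nat -> rat) (g : Lambda) (m : nat) :
  (forall d, G d = avg d (fun nu => c nu *: psum nu)) ->
  (forall d nu, d != m -> nu \in parts_of d -> hall (psum nu) g = 0) ->
  (m <= sdeg g)%N ->
  cpairing hall G g =
  \sum_(nu <- parts_of m) (zee nu)%:R^-1 * (c nu * hall (psum nu) g).
Proof.
move=> GE g0 lem; rewrite /cpairing.
have E d : hall (G d) g = \sum_(nu <- parts_of d) (zee nu)%:R^-1 * (c nu * hall (psum nu) g).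
  rewrite GE (avgZ d c psum) hall_suml.
  by apply: eq_bigr => nu _; rewrite mulrA.
rewrite (bigD1 (Ordinal (lem : (m < (sdeg g).+1)%N))) //= big1 ?addr0 // => d ne.
rewrite E big_seq big1 // => nu pnu; rewrite (g0 d) ?mulr0 //.
Qed.

End HallProduct.

(** * Character tables *)

Definition pp_char (la nu : seq nat) : rat :=
  \sum_(rho <- parts_of (sumn la)) (zee rho)%:R^-1 * (chi la rho * nsurj rho nu).

Lemma avg_avg (V : lmodType rat) (m d : nat) (a : seq nat -> rat)
    (b : seq nat -> seq nat -> rat) (P : seq nat -> V) :
  avg m (fun rho => a rho *: avg d (fun nu => b rho nu *: P nu)) =
  avg d (fun nu => (\sum_(rho <- parts_of m) (zee rho)%:R^-1 * (a rho * b rho nu)) *: P nu).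
Proof.
rewrite /avg; under eq_bigr => rho _ do rewrite !scaler_sumr.
rewrite exchange_big /=; apply: eq_bigr => nu _.
rewrite scaler_suml scaler_sumr; apply: eq_bigr => rho _; rewrite !scalerA.
by move: (_^-1) (_^-1) => x y; congr (_ *: _); ring.
Qed.

Lemma part_mem (la : seq nat) : is_part la -> la \in parts_of (sumn la).
Proof. by move=> p; rewrite mem_parts_of p eqxx. Qed.

Lemma part_pos (la : seq nat) : is_part la -> 0%N \notin la.
Proof. by case/andP. Qed.

Lemma zee_neq0 (la : seq nat) : is_part la -> (zee la)%:R != 0 :> rat.
Proof. by move=> /part_pos p; rewrite pnatr_eq0 -lt0n zee_gt0. Qed.

(** Thus s_la[Omega - 1] is the Frobenius characteristic of row la of C. *)
Lemma pleth_schur (la : seq nat) (d : nat) : is_part la ->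
  pleth (schur la) Omega_minus_1 d = avg d (fun nu => pp_char la nu *: psum nu).
Proof.
move=> pla; rewrite (schur_avg (part_mem pla)) pleth_avg.
apply: etrans (avg_avg _ _ _ _ _); apply: eq_avg => rho prho _.
by rewrite pleth_psum // part_pos.
Qed.

Lemma cpairing_psum (hall : Lambda -> Lambda -> rat) (la mu : seq nat) :
  hall_product hall -> is_part la -> is_part mu ->
  cpairing hall (pleth (psum la) Omega_minus_1) (psum mu) = nsurj la mu.
Proof.
move=> hallP pla pmu.
rewrite (cpairing_avg hallP (m := sumn mu) (c := nsurj la)).
- rewrite (bigD1_seq mu) ?parts_of_uniq ?part_mem //= (hall_psum hallP (part_mem pmu) pmu).
  rewrite eqxx mulr1 mulrC -mulrA mulfV ?zee_neq0 // mulr1.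
  rewrite big_seq_cond big1 ?addr0 // => nu /andP[pnu ne].
  by rewrite (hall_psum hallP pnu pmu) (negbTE ne) !mulr0.
- by move=> d; apply: pleth_psum; apply: part_pos.
- move=> d nu ne pnu; rewrite (hall_psum hallP pnu pmu).
  by case: eqP => [e|]; rewrite ?mulr0 //; rewrite -e (parts_of_sumn pnu) eqxx in ne.
- apply: leq_sdeg (part_pos pmu); rewrite (psum_coef (part_mem pmu) pmu) eqxx.
  exact: oner_neq0.
Qed.

Lemma cpairing_schur (hall : Lambda -> Lambda -> rat) (la mu : seq nat) :
  hall_product hall -> is_part la -> is_part mu ->
  cpairing hall (pleth (schur la) Omega_minus_1) (schur mu) =
  \sum_(nu <- parts_of (sumn mu)) (zee nu)%:R^-1 * (pp_char la nu * chi mu nu).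
Proof.
move=> hallP pla pmu.
rewrite (cpairing_avg hallP (m := sumn mu) (c := pp_char la)).
- by apply: eq_big_seq => nu pnu; rewrite (hall_psum_schur hallP pnu pmu) eqxx.
- by move=> d; apply: pleth_schur.
- by move=> d nu ne pnu; rewrite (hall_psum_schur hallP pnu pmu) eq_sym (negbTE ne).
(* The bound on the degree of s_mu needs a monomial that really occurs; one exists because the
   character has norm 1. *)
have [nu pnu ne] : exists2 nu, nu \in parts_of (sumn mu) & chi mu nu != 0.
  apply/hasP; apply: contraT => /hasPn H.
  have := chi_orthonormal (part_mem pmu) (part_mem pmu); rewrite eqxx big_seq big1.
    by move/eqP; rewrite eq_sym oner_eq0.
  by move=> nu /H; rewrite negbK => /eqP ->; rewrite mul0r mulr0.
have pn : is_part nu by move: pnu; rewrite mem_parts_of => /andP[].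
rewrite -(parts_of_sumn pnu); apply: leq_sdeg (part_pos pn).
rewrite (schur_avg (part_mem pmu)) avg_psum_coef // (parts_of_sumn pnu) eqxx.
by rewrite mulf_neq0 // invr_neq0 // zee_neq0.
Qed.

Lemma pp_char_low (la nu : seq nat) : is_part la -> is_part nu ->
  (sumn nu <= sumn la)%N ->
  pp_char la nu = if sumn nu == sumn la then chi la nu else 0.
Proof.
move=> pla pnu le; rewrite /pp_char big_seq.
have low rho : rho \in parts_of (sumn la) -> nsurj rho nu = (zee rho)%:R * (rho == nu)%:R.
  move=> prho; apply: nsurj_low => //; last by rewrite (parts_of_sumn prho).
  by move: prho; rewrite mem_parts_of => /andP[].
under eq_bigr => rho prho do rewrite low //.
rewrite -big_seq; case: eqP => e.
  have nl : nu \in parts_of (sumn la) by rewrite mem_parts_of pnu e eqxx.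
  rewrite (bigD1_seq nu) ?parts_of_uniq //= eqxx mulr1 big1 ?addr0 => [|rho ne].
    by rewrite mulrC -mulrA mulfV ?zee_neq0 // mulr1.
  by rewrite (negbTE ne) !mulr0.
rewrite big_seq big1 // => rho prho; case: eqP => [er|]; last by rewrite !mulr0.
by case: e; rewrite -er (parts_of_sumn prho).
Qed.

Lemma chi_nil : chi [::] [::] = 1.
Proof.
have := schur_avg (isT : [::] \in parts_of 0); rewrite avg0 psum_nil.
rewrite {1}/schur det_mx00 => /(congr1 (mcoeff (mon [::]))).
rewrite -psum_nil linearZ /= (psum_coef (isT : [::] \in parts_of 0)) // eqxx mulr1.
by [].
Qed.

Lemma nsurj_nil (nu : seq nat) : nsurj [::] nu = (nu == [::])%:R.
Proof.
rewrite /nsurj (big_pred1 set0) => [|A]; last first.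
  by rewrite -[LHS]/true; symmetry; apply/eqP/setP => -[].
rewrite (_ : #|_| = 0%N); last by apply/eqP; rewrite -leqn0 -(card_ord 0) max_card.
rewrite mul1r; case: nu => [|s nu]; first by rewrite big_nil.
by rewrite big_cons big1 ?mul0r // => -[].
Qed.

(** The convention for the border of C is what the formula itself gives at the empty partition. *)
Lemma pp_char_nil (la mu : seq nat) : is_part la -> is_part mu ->
  (la == [::]) || (mu == [::]) -> pp_char la mu = (la == mu)%:R.
Proof.
move=> pla pmu; case: eqP => [-> _|ne /eqP ->].
  rewrite /pp_char /= -[LHS]/(avg 0 (fun rho => chi [::] rho * nsurj rho mu : rat^o)).
  by rewrite avg0 chi_nil mul1r nsurj_nil eq_sym.
rewrite pp_char_low // (introF eqP ne) ifN //= eq_sym.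
case: la pla ne => // l la /part_pos; rewrite inE negb_or eq_sym -lt0n => /andP[l0 _] _ /=.
by rewrite addn_eq0 -leqn0 leqNgt l0.
Qed.

Lemma parts_upto_rcons (k : nat) : parts_upto k.+1 = parts_upto k ++ parts_of k.+1.
Proof. by rewrite /parts_upto -[k.+2]addn1 iotaD map_cat flatten_cat /= cats0. Qed.

Lemma parts_upto_uniq (k : nat) : uniq (parts_upto k).
Proof.
elim: k => [|k IH] //; rewrite parts_upto_rcons cat_uniq IH parts_of_uniq andbT /=.
apply/hasPn => la; rewrite mem_parts_of mem_parts_upto => /andP[-> /eqP ->] /=.
by rewrite ltnn.
Qed.

Lemma parts_upto_sorted (k i j : nat) : (i <= j)%N -> (j < nparts k)%N ->
  (sumn (nth [::] (parts_upto k) i) <= sumn (nth [::] (parts_upto k) j))%N.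
Proof.
rewrite /nparts; elim: k => [|k IH] ij.
  by case: j i ij => [|j] [|i].
rewrite parts_upto_rcons size_cat => lt.
rewrite !(nth_cat _ (parts_upto k) (parts_of k.+1)).
case: (ltnP i _) => li; case: (ltnP j _) => lj.
- exact: IH ij lj.
- have := mem_nth [::] li; rewrite mem_parts_upto => /andP[_ le].
  rewrite (parts_of_sumn (mem_nth [::] _ : nth [::] (parts_of k.+1) _ \in _)) ?leqW //.
  by rewrite ltn_subLR.
- by rewrite leqNgt (leq_ltn_trans ij lj) in li.
- have lj' : (j - size (parts_upto k) < size (parts_of k.+1))%N by rewrite ltn_subLR.
  have li' := leq_ltn_trans (leq_sub2r (size (parts_upto k)) ij) lj'.
  by rewrite !(parts_of_sumn (mem_nth [::] _)).
Qed.

Lemma part_part (k : nat) (i : 'I_(nparts k)) : is_part (part i).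
Proof.
by have := mem_nth [::] (ltn_ord i); rewrite mem_parts_upto => /andP[].
Qed.

Lemma part_le (k : nat) (i : 'I_(nparts k)) : (sumn (part i) <= k)%N.
Proof.
by have := mem_nth [::] (ltn_ord i); rewrite mem_parts_upto => /andP[].
Qed.

Lemma part_inj (k : nat) (i j : 'I_(nparts k)) : (part i == part j) = (i == j).
Proof. by rewrite /part nth_uniq ?parts_upto_uniq. Qed.

Lemma sum_part (k m : nat) (G : seq nat -> rat) : (m <= k)%N ->
  \sum_(i < nparts k | sumn (part i) == m) G (part i) = \sum_(nu <- parts_of m) G nu.
Proof.
move=> mk.
rewrite -(big_mkord (fun i => sumn (nth [::] (parts_upto k) i) == m)
  (fun i => G (nth [::] (parts_upto k) i))).
rewrite -(big_nth [::] (fun nu => sumn nu == m)) -big_filter; apply: perm_big.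
apply: uniq_perm; rewrite ?filter_uniq ?parts_upto_uniq ?parts_of_uniq // => nu.
rewrite mem_filter mem_parts_upto mem_parts_of andbC -andbA; congr (_ && _).
by case: eqP => [->|]; rewrite ?mk ?andbF.
Qed.

Section Tables.
Variable k : nat.
Local Notation N := (nparts k).

Definition Yrat : 'M[rat]_N :=
  \matrix_(i, j) if sumn (part i) == sumn (part j) then chi (part i) (part j) else 0.
Definition Rrat : 'M[rat]_N := \matrix_(i, j) ((zee (part i))%:R^-1 * nsurj (part i) (part j)).
Definition Crat : 'M[rat]_N := \matrix_(i, j) pp_char (part i) (part j).
Definition Lrat : 'M[rat]_N :=
  \matrix_(i, j) \sum_(nu <- parts_of (sumn (part j)))
    (zee nu)%:R^-1 * (pp_char (part i) nu * chi (part j) nu).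
(** By row orthogonality the inverse of Y is its transpose with rows weighted by 1/z. *)
Definition Yinv : 'M[rat]_N := \matrix_(i, j) ((zee (part i))%:R^-1 * Yrat j i).

Lemma Yrat_inv : Yrat *m Yinv = 1%:M.
Proof.
apply/matrixP => i j; rewrite !mxE -[RHS]/((i == j)%:R) -part_inj.
under eq_bigr => l _ do rewrite !mxE.
case: (eqVneq (sumn (part i)) (sumn (part j))) => [e|ne]; last first.
  have -> : part i == part j = false by apply: contraNF ne => /eqP ->.
  apply: big1 => l _; case: eqP => [<-|]; last by rewrite mul0r.
  by rewrite eq_sym (negbTE ne) !mulr0.
have pi := part_mem (part_part i); have pj := part_mem (part_part j).
rewrite e in pi; rewrite -(chi_orthonormal pi pj) -(sum_part _ (part_le j)).
rewrite [RHS]big_mkcond; apply: eq_bigr => l _; rewrite e [sumn (part l) == _]eq_sym.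
by case: eqP => _; rewrite ?mul0r // mulrCA.
Qed.

Lemma Crat_YR : Crat = Yrat *m Rrat.
Proof.
apply/matrixP => i j; rewrite !mxE /pp_char -(sum_part _ (part_le i)) big_mkcond.
apply: eq_bigr => l _; rewrite !mxE eq_sym.
by case: eqP => _; rewrite ?mul0r // mulrCA.
Qed.

Lemma Lrat_CY : Lrat = Crat *m Yinv.
Proof.
apply/matrixP => i j; rewrite !mxE -(sum_part _ (part_le j)) big_mkcond.
apply: eq_bigr => l _; rewrite !mxE [sumn (part l) == _]eq_sym.
by case: eqP => _; rewrite ?mulr0 // mulrCA.
Qed.

Lemma Crat_LY : Crat = Lrat *m Yrat.
Proof. by rewrite Lrat_CY -mulmxA (mulmx1C Yrat_inv) mulmx1. Qed.

Lemma Rrat_unitri : upper_unitriangular Rrat.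
Proof.
move=> i j; rewrite mxE; split => [ji|->].
  rewrite nsurj_low ?part_part ?parts_upto_sorted ?(ltnW ji) //.
  by rewrite part_inj -val_eqE /= gtn_eqF // !mulr0.
by rewrite nsurj_low ?part_part // eqxx mulr1 mulVf ?zee_neq0 ?part_part.
Qed.

(** For sizes up to that of its row, [pp_char] is the symmetric group character or 0, so
    orthonormality gives identity blocks on the diagonal of L and zero blocks below. *)
Lemma Lrat_low (i j : 'I_N) : (sumn (part j) <= sumn (part i))%N -> Lrat i j = (i == j)%:R.
Proof.
move=> le; rewrite mxE -part_inj; have pj := part_mem (part_part j).
have low nu : nu \in parts_of (sumn (part j)) -> pp_char (part i) nu =
    if sumn (part j) == sumn (part i) then chi (part i) nu else 0.
  move=> pnu; rewrite pp_char_low ?part_part ?(parts_of_sumn pnu) //.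
  by move: pnu; rewrite mem_parts_of => /andP[].
rewrite big_seq; under eq_bigr => nu pnu do rewrite low //.
rewrite -big_seq; case: eqP => [e|ne].
  by apply: chi_orthonormal => //; rewrite e; apply/part_mem/part_part.
rewrite big1 => [|nu _]; last by rewrite mul0r mulr0.
by case: eqP => // e; case: ne; rewrite e.
Qed.

Lemma Lrat_unitri : upper_unitriangular Lrat.
Proof.
move=> i j; split => [ji|->]; last by rewrite Lrat_low // eqxx.
by rewrite Lrat_low ?parts_upto_sorted ?(ltnW ji) // -val_eqE /= gtn_eqF.
Qed.

End Tables.

Theorem proposition6p4 (F : numClosedFieldType) (k n : nat)
    (hall : Lambda -> Lambda -> rat) :
  (1 <= k)%N -> (k <= n)%N -> hall_product hall ->
  exists L R : 'M[F]_(nparts k),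
    [/\ unique (fun A => upper_unitriangular A /\
                  Ctable F n k = A *m Ytable F k) L,
        unique (fun A => upper_unitriangular A /\
                  Ctable F n k = Ytable F k *m A) R
      & forall i j : 'I_(nparts k),
          let la := part i in let mu := part j in
          L i j = ratr (cpairing hall (pleth (schur la) Omega_minus_1) (schur mu))
          /\
          R i j = ratr ((zee la)%:R^-1 *
                        cpairing hall (pleth (psum la) Omega_minus_1) (psum mu))].
Proof.
move=> k1 kn hallP.
pose ratrF := map_mx (@ratr F) : 'M[rat]_(nparts k) -> 'M[F]_(nparts k).
have YE : Ytable F k = ratrF (Yrat k).
  apply/matrixP => i j; rewrite !mxE; cbv zeta.
  case: (sumn (part i) =P sumn (part j)) => e; last by rewrite rmorph0.
  by rewrite (chiSE F e).
have CE : Ctable F n k = ratrF (Crat k).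
  apply/matrixP => i j; rewrite !mxE; cbv zeta; case: ifP => e.
    by rewrite pp_char_nil ?part_part // rmorph_nat.
  have [l0 m0] := norP (negbT e).
  (* With this bound the diagram is propagating, so the default 0 in [chiPP_part] is not reached. *)
  have mu0 : (0 < sumn (part j) <= k)%N.
    rewrite part_le andbT lt0n; apply: contra m0.
    case: (part j) (part_part j) => // r mu /part_pos; rewrite inE negb_or /= addn_eq0.
    by rewrite eq_sym => /andP[/negbTE ->].
  rewrite /chiPP_part (insubT (@propagating k) (extend_diagramP _ mu0)) /=.
  case/andP: (mu0) => i0 ik.
  rewrite (chiPPE i0 ik) ?(part_pos (part_part j)) ?(leq_trans (part_le i)) //.
  congr (ratr _); apply: eq_big_seq => rho prho.
  by rewrite (chi_cyc _ prho).
have unitriM (A : 'M[rat]_(nparts k)) : upper_unitriangular A -> upper_unitriangular (ratrF A).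
  move=> H i j; have [H1 H2] := H i j; rewrite !mxE.
  by split => [/H1 ->|/H2 ->]; rewrite ?rmorph0 ?rmorph1.
have ratrFM A B : ratrF (A *m B) = ratrF A *m ratrF B by exact: map_mxM.
(* Y is invertible, so each of the two factorizations of C determines its other factor. *)
have YV : ratrF (Yrat k) *m ratrF (Yinv k) = 1%:M by rewrite -ratrFM Yrat_inv; exact: map_mx1.
have VY := mulmx1C YV.
exists (ratrF (Lrat k)), (ratrF (Rrat k)); split.
- split; first by split; [apply/unitriM/Lrat_unitri|rewrite CE YE -ratrFM -Crat_LY].
  move=> A [_]; rewrite CE YE Crat_LY ratrFM => /(congr1 (mulmx^~ (ratrF (Yinv k)))).
  by rewrite -!mulmxA YV !mulmx1.
- split; first by split; [apply/unitriM/Rrat_unitri|rewrite CE YE -ratrFM -Crat_YR].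
  move=> A [_]; rewrite CE YE Crat_YR ratrFM => /(congr1 (mulmx (ratrF (Yinv k)))).
  by rewrite !mulmxA VY !mul1mx.
- move=> i j la mu; split.
    have -> : ratrF (Lrat k) i j = ratr (Lrat k i j) by rewrite mxE.
    apply: (congr1 ratr); apply: etrans (esym (cpairing_schur hallP _ _)); try exact: part_part.
    by rewrite mxE.
  have -> : ratrF (Rrat k) i j = ratr (Rrat k i j) by rewrite mxE.
  apply: (congr1 ratr).
  rewrite (cpairing_psum hallP (part_part _) (part_part _)).
  by rewrite mxE.
Qed.
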